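(* Let $H$ be a finite-dimensional non-cosemisimple Hopf algebra over $\Bbbk$, with a block system $H=\bigoplus_{n\ge 0,\,d_1,d_2\ge 1}B^{d_1,d_2}_n$. Let $m=\max\{m'\ge 0\mid B^{1,1}_{m'}\ne 0\}$ and $l=\min\{m'\ge 1\mid B^{1,1}_{m'}\ne 0\}$. Then: (1) $\dim B^{1,1}_m=|G(H)|$; (2) if $l<m$ and $H$ has no nontrivial skew-primitives, then there exist integers $d_1,d_2,d_3,d_4>1$ and $l'$ with $l'>l>1$ such that $B^{d_1,1}_{l'}\ne 0$, $B^{1,d_2}_{l'}\ne 0$, $B^{d_1,d_3}_{l'-1}\ne 0$ and $B^{d_4,d_2}_{l'-1}\ne 0$.
   Context: $\Bbbk$ is an algebraically closed field of characteristic $0$. $G(H)$ is the group of group-like elements of $H$. A coalgebra is cosemisimple if it equals its coradical. $H$ has no nontrivial skew-primitives if every $x\in H$ with $\Delta(x)=x\otimes g+h\otimes x$ for some $g,h\in G(H)$ lies in $\Bbbk G(H)$ (equivalently, $H$ has no pointed Hopf subalgebra other than group algebras). Block systems. Let $C$ be a non-cosemisimple coalgebra (here the coalgebra underlying $H$) with coradical filtration $\{C_n\}_{n\ge 0}$. There is a coalgebra projection $\pi:C\to C_0$ onto the coradical whose kernel $I=\ker\pi$ is a coideal with $C=C_0\oplus I$; fix such $\pi$ and $I$. Put $\rho_L=(\pi\otimes \mathrm{id})\Delta$ and $\rho_R=(\mathrm{id}\otimes\pi)\Delta$; these make $C$ a $C_0$-bicomodule. Put $P_n=C_n\cap I$,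 a $C_0$-subbicomodule. Let $\widehat C$ index the simple subcoalgebras $D_\tau$ of $C$, with $\dim D_\tau=d_\tau^2$; let $V_\tau$ be the simple right $D_\tau$-comodule and $V_\tau^*$ the simple left $D_\tau$-comodule. The category of $C_0$-bicomodules is semisimple, and for a $C_0$-bicomodule $M$ one writes $M^{\tau,\mu}$ for the sum of the simple subbicomodules of $M$ isomorphic to $V_\tau^*\otimes V_\mu$, so $M=\bigoplus_{\tau,\mu\in\widehat C}M^{\tau,\mu}$. For each $n\ge 1$ choose a $C_0$-subbicomodule $Q_n\subseteq P_n$ with $P_n=P_{n-1}\oplus Q_n$ (so $Q_n\cong C_n/C_{n-1}$). The blocks (derived from $I$ and $\{Q_n\}$) are: $B^{d,d}_0=\bigoplus_{\tau\in\widehat C,\,d_\tau=d}D_\tau$; $B^{d_1,d_2}_0=0$ if $d_1\neq d_2$; and, for $n\ge 1$, $B^{d_1,d_2}_n=\bigoplus_{\tau,\mu\in\widehat C,\ d_\tau=d_1,\ d_\mu=d_2}Q_n^{\tau,\mu}$. The decomposition $C=\bigoplus_{n\ge 0,\,d_1,d_2\ge 1}B_n^{d_1,d_2}$ is called a block system of $C$. *)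

(* Defs.v *)
From HB Require Import structures.
From mathcomp Require Import all_boot all_order all_algebra all_field.
From mathcomp Require Import boolp classical_sets functions cardinality.

Set Implicit Arguments.
Unset Strict Implicit.
Unset Printing Implicit Defensive.
Import GRing.Theory.
Local Open Scope ring_scope.

(* Tensor product of finite-dimensional spaces: an element is the matrix of
   its coordinates in the basis e_i (x) f_j, where (e_i) and (f_j) are the
   standard bases [vbasis {:U}] and [vbasis {:V}]. *)
Definition tensor (K : fieldType) (U V : vectType K) : vectType K :=
  'M[K]_(\dim {:U}, \dim {:V}).


Definition tens (K : fieldType) (U V : vectType K) (u : U) (v : V) : tensor U V :=
  \matrix_(i, j) (coord (vbasis {:U}) i u * coord (vbasis {:V}) j v).
Notation "u *t v" := (tens u v) (at level 40, left associativity) : ring_scope.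

(* For bilinear f, [tlift f] is the linear map with tlift f (u (x) v) = f u v
   (lemma tliftE below); in Sweedler notation, tlift f (Delta x) is
   f x_(1) x_(2). *)
Definition tlift (K : fieldType) (U V W : vectType K) (f : U -> V -> W)
    (t : tensor U V) : W :=
  \sum_i \sum_j (t : 'M_(_, _)) i j *: f (vbasis {:U})`_i (vbasis {:V})`_j.

Lemma tliftE (K : fieldType) (U V W : vectType K) (f : U -> V -> W) u v :
  (forall u, linear (f u)) -> (forall v, linear (f^~ v)) ->
  tlift f (u *t v) = f u v.
Proof.
move=> fl fr.
pose Fl u := GRing.isLinear.Build K V W _ (f u) (fl u).
pose gl u : {linear V -> W} := HB.pack (f u) (Fl u).
pose Fr v := GRing.isLinear.Build K U W _ (f^~ v) (fr v).
pose gr v : {linear U -> W} := HB.pack (f^~ v) (Fr v).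
rewrite /tlift {2}(coord_vbasis (memvf u)).
rewrite -[RHS]/(gr v _) linear_sum; apply: eq_bigr => i _ /=.
rewrite -[f _ v]/(gr v _) linearZ /=.
rewrite [in RHS](coord_vbasis (memvf v)) -[f _ (\sum_(_ < _) _)]/(gl _ _).
rewrite linear_sum scaler_sumr; apply: eq_bigr => j _ /=.
by rewrite -[f _ (_ *: _)]/(gl _ _) linearZ /= mxE scalerA.
Qed.

Definition tmap (K : fieldType) (U V U' V' : vectType K) (f : U -> U')
    (g : V -> V') : tensor U V -> tensor U' V' :=
  tlift (fun u v => f u *t g v).

Definition tensv (K : fieldType) (U V : vectType K) (A : {vspace U})
    (B : {vspace V}) : {vspace (tensor U V)} :=
  <<[seq a *t b | a <- vbasis A, b <- vbasis B]>>%VS.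

(* Sum of an arbitrary family of subspaces. *)
Lemma vsum_subproof (K : fieldType) (V : vectType K)
    (P : {vspace V} -> Prop) :
  exists S : {vspace V}, forall x, x \in S <->
    exists2 s : seq {vspace V},
      (forall U, U \in s -> P U) & x \in (\sum_(U <- s) U)%VS.
Proof.
pose ok n := `[< exists2 s : seq {vspace V},
  (forall U, U \in s -> P U) & \dim (\sum_(U <- s) U)%VS = n >].
have ok0 : exists n, ok n.
  by exists 0; apply/asboolP; exists [::] => //; rewrite big_nil dimv0.
have okB n : ok n -> (n <= \dim {:V})%N.
  by move=> /asboolP [s _ <-]; apply: dimvS; apply: subvf.
case: (ex_maxnP ok0 okB) => n /asboolP [s sP ds] nmax.
exists (\sum_(U <- s) U)%VS => x; split=> [xs|[s' s'P]]; first by exists s.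
apply: subvP x; rewrite big_seq; elim/big_ind: _ => [|A B|U Us'].
- exact: sub0v.
- by rewrite subv_add => -> ->.
have le : (\sum_(U <- s) U <= \sum_(U <- U :: s) U)%VS.
  by rewrite big_cons addvSr.
have /eqP -> : (\sum_(U <- s) U == \sum_(U <- U :: s) U)%VS; last first.
  by rewrite big_cons addvSl.
rewrite eqEdim le /= ds; apply: nmax; apply/asboolP; exists (U :: s) => //.
by move=> A; rewrite inE => /orP [/eqP ->|/sP //]; apply: s'P.
Qed.

Definition vsum (K : fieldType) (V : vectType K) (P : {vspace V} -> Prop) :
  {vspace V} := projT1 (cid (vsum_subproof P)).

Lemma mem_vsum (K : fieldType) (V : vectType K) (P : {vspace V} -> Prop) x :
  x \in vsum P <-> exists2 s : seq {vspace V},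
      (forall U, U \in s -> P U) & x \in (\sum_(U <- s) U)%VS.
Proof. exact: (projT2 (cid (vsum_subproof P))). Qed.

(* (Delta (x) id) Delta = (id (x) Delta) Delta is written in tensor (tensor C C) C. *)
HB.mixin Record Vector_isCoalgebra (K : fieldType) C of Vector K C := {
  comul : 'Hom(C, tensor C C);
  counit : 'Hom(C, K^o);
  comulA : forall x : C,
    tlift (fun a b => comul a *t b) (comul x) =
    tlift (fun a b => tlift (fun b1 b2 => a *t b1 *t b2) (comul b)) (comul x);
  counitl : forall x : C, tlift (fun a b => counit a *: b) (comul x) = x;
  counitr : forall x : C, tlift (fun a b => counit b *: a) (comul x) = x
}.

#[short(type="coalgType")]
HB.structure Definition Coalgebra (K : fieldType) :=
  { C of Vector K C & Vector_isCoalgebra K C }.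

Definition tmul (K : fieldType) (A : falgType K) (s t : tensor A A) : tensor A A :=
  tlift (fun a b => tlift (fun c d => (a * c) *t (b * d)) t) s.

HB.mixin Record Falgebra_Coalgebra_isHopf (K : fieldType) H
    of Falgebra K H & Coalgebra K H := {
  comul1 : comul (1 : H) = 1 *t 1;
  comulM : forall x y : H, comul (x * y) = tmul (comul x) (comul y);
  counit1 : counit (1 : H) = 1;
  counitM : forall x y : H, counit (x * y) = counit x * counit y;
  antipode : 'End(H);
  antipodel : forall x : H,
    tlift (fun a b => antipode a * b) (comul x) = counit x *: 1;
  antipoder : forall x : H,
    tlift (fun a b => a * antipode b) (comul x) = counit x *: 1
}.

#[short(type="hopfType")]
HB.structure Definition Hopf (K : fieldType) :=
  { H of Falgebra K H & Coalgebra K H & Falgebra_Coalgebra_isHopf K H }.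

Section Coalgebra.
Variables (K : fieldType) (C : coalgType K).
Implicit Types (D E M N S : {vspace C}).

Definition grouplike (g : C) : Prop := comul g = g *t g /\ counit g = 1.

Definition grouplike_span : {vspace C} :=
  vsum (fun U => exists2 g, grouplike g & U = <[g]>%VS).

Definition no_nontrivial_skew_primitives : Prop :=
  forall g h x : C, grouplike g -> grouplike h ->
    comul x = x *t g + h *t x -> x \in grouplike_span.

Definition subcoalgebra D : Prop := forall x, x \in D -> comul x \in tensv D D.

Definition simple_subcoalgebra D : Prop :=
  [/\ D != 0%VS, subcoalgebra D &
      forall E, subcoalgebra E -> (E <= D)%VS -> E = 0%VS \/ E = D].

Definition coradical : {vspace C} := vsum simple_subcoalgebra.

Definition cosemisimple : Prop := coradical = fullv.

(* C_n = Delta^-1 (C (x) C_(n-1) + C_0 (x) C). *)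
Fixpoint coradical_filtration (n : nat) : {vspace C} :=
  if n is n'.+1 then
    (comul @^-1: (tensv fullv (coradical_filtration n')
                  + tensv coradical fullv))%VS
  else coradical.

Record right_comodule := RightComodule {
  rcarrier :> vectType K;
  rcoact : 'Hom(rcarrier, tensor rcarrier C);
  rcoactA : forall v : rcarrier,
    tlift (fun w c => rcoact w *t c) (rcoact v) =
    tlift (fun w c => tlift (fun c1 c2 => w *t c1 *t c2) (comul c)) (rcoact v);
  rcoact1 : forall v : rcarrier,
    tlift (fun (w : rcarrier) (c : C) => counit c *: w) (rcoact v) = v
}.

Record left_comodule := LeftComodule {
  lcarrier :> vectType K;
  lcoact : 'Hom(lcarrier, tensor C lcarrier);
  lcoactA : forall v : lcarrier,
    tlift (fun c w => comul c *t w) (lcoact v) =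
    tlift (fun c w => tlift (fun c' w' => c *t c' *t w') (lcoact w)) (lcoact v);
  lcoact1 : forall v : lcarrier,
    tlift (fun (c : C) (w : lcarrier) => counit c *: w) (lcoact v) = v
}.

(* A comodule over the subcoalgebra D is a C-comodule with coefficients in D. *)
Definition simple_right_comodule_over D (V : right_comodule) : Prop :=
  [/\ forall v : V, rcoact V v \in tensv fullv D,
      (fullv : {vspace V}) != 0%VS &
      forall W : {vspace V},
        (forall w, w \in W -> rcoact V w \in tensv W fullv) ->
        W = 0%VS \/ W = fullv].

Definition simple_left_comodule_over D (V : left_comodule) : Prop :=
  [/\ forall v : V, lcoact V v \in tensv D fullv,
      (fullv : {vspace V}) != 0%VS &
      forall W : {vspace V},
        (forall w, w \in W -> lcoact V w \in tensv fullv W) ->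
        W = 0%VS \/ W = fullv].

(* The bicomodule V (x) W of a left comodule V and a right comodule W:
   v (x) w |-> v_(-1) (x) (v_(0) (x) w) and v (x) w |-> (v (x) w_(0)) (x) w_(1). *)
Definition outer_lcoact (V : left_comodule) (W : right_comodule) :
    tensor V W -> tensor C (tensor V W) :=
  tlift (fun v w => tlift (fun c v' => c *t (v' *t w)) (lcoact V v)).

Definition outer_rcoact (V : left_comodule) (W : right_comodule) :
    tensor V W -> tensor (tensor V W) C :=
  tlift (fun v w => tlift (fun w' c => v *t w' *t c) (rcoact W w)).

(* Then C = C_0 (+) ker p, and ker p is a coideal. *)
Definition coalgebra_projection (p : 'End(C)) : Prop :=
  [/\ limg p = coradical,
      forall x, x \in coradical -> p x = x,
      forall x, comul (p x) = tmap p p (comul x) &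
      forall x, counit (p x) = counit x].

Section Bicomodule.
Variable p : 'End(C).

Definition rhoL (x : C) : tensor C C := tmap p id (comul x).
Definition rhoR (x : C) : tensor C C := tmap id p (comul x).

Definition subbicomodule M : Prop :=
  (forall x, x \in M -> rhoL x \in tensv coradical M) /\
  (forall x, x \in M -> rhoR x \in tensv M coradical).

Definition simple_subbicomodule S : Prop :=
  [/\ S != 0%VS, subbicomodule S &
      forall N, subbicomodule N -> (N <= S)%VS -> N = 0%VS \/ N = S].

Definition bicomodule_isom (V : left_comodule) (W : right_comodule) S : Prop :=
  exists f : 'Hom(tensor V W, C),
    [/\ lker f = 0%VS, limg f = S,
        forall t, rhoL (f t) = tmap id f (outer_lcoact t) &
        forall t, rhoR (f t) = tmap f id (outer_rcoact t)].

(* M^(tau,mu) for D = D_tau and E = D_mu; the simple left D-comodule V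
   (written V_tau^* ) and the simple right E-comodule W = V_mu are unique up
   to isomorphism. *)
Definition isotypic_component M D E : {vspace C} :=
  vsum (fun S => [/\ (S <= M)%VS, simple_subbicomodule S &
    exists (V : left_comodule) (W : right_comodule),
      [/\ simple_left_comodule_over D V, simple_right_comodule_over E W &
          bicomodule_isom V W S]]).

Definition coradical_complement (n : nat) : {vspace C} :=
  (coradical_filtration n :&: lker p)%VS.

End Bicomodule.

(* The value bs_Q 0 is unconstrained and unused. *)
Record block_system := BlockSystem {
  bs_proj : 'End(C);
  bs_projP : coalgebra_projection bs_proj;
  bs_Q : nat -> {vspace C};
  bs_Q_subbicomodule : forall n, subbicomodule bs_proj (bs_Q n.+1);
  bs_Q_sum : forall n,
    (coradical_complement bs_proj n + bs_Q n.+1)%VS =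
      coradical_complement bs_proj n.+1;
  bs_Q_direct : forall n,
    (coradical_complement bs_proj n :&: bs_Q n.+1)%VS = 0%VS
}.

Definition block (bs : block_system) (n d1 d2 : nat) : {vspace C} :=
  if n is 0 then
    if d1 == d2 then
      vsum (fun D => simple_subcoalgebra D /\ \dim D = (d1 ^ 2)%N)
    else 0%VS
  else
    vsum (fun U => exists D E,
      [/\ simple_subcoalgebra D /\ \dim D = (d1 ^ 2)%N,
          simple_subcoalgebra E /\ \dim E = (d2 ^ 2)%N &
          U = isotypic_component (bs_proj bs) (bs_Q bs n) D E]).

End Coalgebra.

Arguments grouplike {K C} g.
Arguments cosemisimple {K} C.
Arguments block_system {K} C.
Arguments no_nontrivial_skew_primitives {K} C.

(* Main.v *)
Require Import Defs.
From HB Require Import structures.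
From mathcomp Require Import all_boot all_order all_algebra all_field.
From mathcomp Require Import boolp classical_sets functions cardinality.

(** The coradical filtration is studied in the dual algebra A = H^*, with the
    convolution product. Let J be the annihilator of the coradical C_0. It is
    a nilpotent ideal, and C_n is the annihilator of J^(n+1) (jac_nilpotent,
    filtrationE). Composition with the projection p embeds the dual of C_0 in
    A as a complement of J. So A contains an idempotent e_D for each simple
    subcoalgebra D; these are orthogonal with sum 1. For n >= 1 the component
    of Q_n attached to D and E is nonzero if and only if e_D J^n e_E is not
    contained in J^(n+1) (block_jacn, jacn_block, mem_isotypic). The dimension
    of a simple subcoalgebra is a square by Burnside's theorem, which also
    describes its dual by matrix units.

    By the theorem of Larson and Sweedler, A is a Frobenius algebra: H has a
    nonzero left integral t, and f |-> f -> t is a bijection from A to H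
    (exists_integral, integral_faithful). Hence for each group-like g there is,
    up to a scalar, exactly one functional gint g with y * gint g = y(g) gint g
    for all y, and every nonzero right ideal contained in e_g A contains it
    (gint_in). It follows that the last nonzero space e_g J^N is the line of
    gint g (idem_depth). Translation by group-likes carries these lines to
    each other and preserves J, so N is the same for all g (gint_jacn). In
    particular, if N >= 1, the last nonzero block of bidegree (1, 1) is that of
    degree N, and it has one line for each group-like element, which is (1).
    When N = 0 the block is the span of the group-likes, which are independent.

    For (2), gint 1 lies in J^N and not in J^(N+1), and it has the form
    e_1 * gint 1 * e_a for a group-like a. In the absence of nontrivial
    skew-primitives, e_g J e_h is contained in J^2 for all group-likes g and h
    (no_skew). In degree one this gives l > 1. It also excludes l = N - 1: a
    component f of degree N - 1 between group-likes would satisfy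
    gint g = f * u with u in J^2 (below_top). So l' = N - 1 is larger than l.
    Inserting the sum of all the e_D into gint 1 along the factorizations
    J^N = J J^(N-2) J = J J^(N-1) = J^(N-1) J (jacn_split) gives the four
    nonzero blocks. Each of the simple subcoalgebras that occur is linked to a
    group-like in degree one, hence is not one-dimensional (no_skew_dim). *)

Set Implicit Arguments.
Unset Strict Implicit.
Unset Printing Implicit Defensive.
Import GRing.Theory.
Local Open Scope ring_scope.

(** * Tensors and their slices *)

Definition bilinear_op (K : fieldType) (U V W : vectType K) (f : U -> V -> W) :=
  (forall u, linear (f u)) /\ (forall v, linear (f^~ v)).

Section Tensor.
Variables (K : fieldType).
Implicit Types (U V W X : vectType K).

Lemma tlift_is_linear U V W (f : U -> V -> W) : linear (tlift f).
Proof.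
move=> k s t; rewrite /tlift scaler_sumr -big_split; apply: eq_bigr => i _.
rewrite scaler_sumr -big_split; apply: eq_bigr => j _ /=.
by rewrite !mxE scalerDl scalerA.
Qed.

HB.instance Definition _ U V W (f : U -> V -> W) :=
  GRing.isLinear.Build K (tensor U V) W _ (tlift f) (tlift_is_linear f).

Lemma eq_tlift U V W (f g : U -> V -> W) t :
  (forall u v, f u v = g u v) -> tlift f t = tlift g t.
Proof.
by move=> fg; apply: eq_bigr => i _; apply: eq_bigr => j _; rewrite fg.
Qed.

Lemma linear_tlift U V W X (h : {linear W -> X}) (f : U -> V -> W) t :
  h (tlift f t) = tlift (fun u v => h (f u v)) t.
Proof.
rewrite /tlift linear_sum; apply: eq_bigr => i _; rewrite linear_sum.
by apply: eq_bigr => j _; rewrite linearZ.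
Qed.

Lemma tlift_comb U V W k (f g : U -> V -> W) t :
  tlift (fun u v => k *: f u v + g u v) t = k *: tlift f t + tlift g t.
Proof.
rewrite /tlift scaler_sumr -big_split; apply: eq_bigr => i _.
rewrite scaler_sumr -big_split; apply: eq_bigr => j _ /=.
by rewrite scalerDr !scalerA mulrC.
Qed.

Lemma tens_linl U V (v : V) : linear (fun u : U => u *t v).
Proof.
move=> k a b; apply/matrixP => i j; rewrite !mxE linearP.
by rewrite mulrDl mulrA.
Qed.

Lemma tens_linr U V (u : U) : linear (fun v : V => u *t v).
Proof.
move=> k a b; apply/matrixP => i j; rewrite !mxE linearP.
by rewrite mulrDr mulrCA.
Qed.

HB.instance Definition _ U V (u : U) :=
  GRing.isLinear.Build K V (tensor U V) _ (tens u) (tens_linr u).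

(** Named so that it can carry the linearity in the left factor. *)
Definition tens_left U V (v : V) (u : U) : tensor U V := u *t v.

HB.instance Definition _ U V (v : V) :=
  GRing.isLinear.Build K U (tensor U V) _ (tens_left v) (tens_linl v).

Lemma tens_suml U V (v : V) I (r : seq I) (P : pred I) (F : I -> U) :
  (\sum_(i <- r | P i) F i) *t v = \sum_(i <- r | P i) F i *t v.
Proof. exact: (linear_sum (@tens_left U V v)). Qed.

Lemma tensZl U V (v : V) k (u : U) : (k *: u) *t v = k *: (u *t v).
Proof. by have := linearZZ (@tens_left U V v) k u. Qed.

Lemma tensDl U V (v : V) (u u' : U) : (u + u') *t v = u *t v + u' *t v.
Proof. exact: (linearD (@tens_left U V v)). Qed.

Lemma tens_bilinear U V : bilinear_op (@tens K U V).
Proof. by split=> u; [exact: tens_linr | exact: tens_linl]. Qed.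

Lemma tliftP U V W (f : U -> V -> W) u v :
  bilinear_op f -> tlift f (u *t v) = f u v.
Proof. by case=> fl fr; apply: tliftE. Qed.

Lemma tens_vbasis U V (t : tensor U V) :
  t = tlift (fun u v => u *t v) t.
Proof.
rewrite {1}[t]matrix_sum_delta; apply: eq_bigr => i _; apply: eq_bigr => j _.
congr (_ *: _); apply/matrixP => k l; rewrite !mxE.
rewrite !coord_free ?(basis_free (vbasisP _)) // -natrM mulnb.
by rewrite eq_sym [l == j]eq_sym.
Qed.

Lemma tlift_tlift U V U' V' W (g : U -> V -> tensor U' V') (f : U' -> V' -> W) t :
  tlift f (tlift g t) = tlift (fun u v => tlift f (g u v)) t.
Proof. exact: (linear_tlift (tlift f)). Qed.

(** The coordinates of a tensor are its values on pairs of coordinate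
    functionals. *)
Lemma tensor_eqP U V (s t : tensor U V) :
  (forall (f : 'Hom(U, K^o)) (g : 'Hom(V, K^o)),
     tlift (fun u v => f u * g v : K^o) s = tlift (fun u v => f u * g v : K^o) t) ->
  s = t.
Proof.
move=> st; apply/matrixP => i j.
have E (r : tensor U V) : r i j = tlift (fun u v =>
   linfun (coord (vbasis {:U}) i : U -> K^o) u *
   linfun (coord (vbasis {:V}) j : V -> K^o) v : K^o) r.
  rewrite {1}[r]tens_vbasis /tlift summxE; apply: eq_bigr => k _.
  by rewrite summxE; apply: eq_bigr => l _; rewrite !mxE !lfunE.
by rewrite !E st.
Qed.

Lemma tensor_ind U V (P : tensor U V -> Prop) :
  P 0 -> (forall k s t, P s -> P t -> P (k *: s + t)) ->
  (forall a b, P (a *t b)) -> forall t, P t.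
Proof.
move=> P0 PD Pt t; rewrite [t]tens_vbasis /tlift.
elim/big_ind: _ => // [s s' Ps Ps'|i _]; first by rewrite -[s]scale1r; apply: PD.
elim/big_ind: _ => // [s s' Ps Ps'|j _]; first by rewrite -[s]scale1r; apply: PD.
by rewrite -[_ *: _]addr0; apply: PD.
Qed.

Lemma memv_tens U V (A : {vspace U}) (B : {vspace V}) a b :
  a \in A -> b \in B -> a *t b \in tensv A B.
Proof.
move=> aA bB; rewrite (coord_vbasis aA) (coord_vbasis bB).
rewrite tens_suml memv_suml // => i _; rewrite linear_sum memv_suml // => j _.
rewrite linearZ /= tensZl !memvZ // memv_span //.
by apply/allpairsP; exists ((vbasis A)`_i, (vbasis B)`_j); split => //;
  rewrite mem_nth // size_tuple.
Qed.

Definition slicel U V (f : 'Hom(U, K^o)) (t : tensor U V) : V :=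
  tlift (fun u v => f u *: v) t.
Definition slicer U V (g : 'Hom(V, K^o)) (t : tensor U V) : U :=
  tlift (fun u v => g v *: u) t.

Lemma slicel_bilinear U V (f : 'Hom(U, K^o)) :
  bilinear_op (fun u (v : V) => f u *: v).
Proof.
split=> [u k a b|v k a b]; first by rewrite scalerDr !scalerA mulrC.
by rewrite linearP scalerDl scalerA.
Qed.

Lemma slicer_bilinear U V (g : 'Hom(V, K^o)) :
  bilinear_op (fun (u : U) v => g v *: u).
Proof.
split=> [u k a b|v k a b]; last by rewrite scalerDr !scalerA mulrC.
by rewrite linearP scalerDl scalerA.
Qed.

HB.instance Definition _ U V (f : 'Hom(U, K^o)) :=
  GRing.isLinear.Build K (tensor U V) V _ (slicel f) (tlift_is_linear _).
HB.instance Definition _ U V (f : 'Hom(V, K^o)) :=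
  GRing.isLinear.Build K (tensor U V) U _ (slicer f) (tlift_is_linear _).

Lemma slicelE U V (f : 'Hom(U, K^o)) (u : U) (v : V) :
  slicel f (u *t v) = f u *: v.
Proof. exact/tliftP/slicel_bilinear. Qed.

Lemma slicerE U V (f : 'Hom(V, K^o)) (u : U) (v : V) :
  slicer f (u *t v) = f v *: u.
Proof. exact/tliftP/slicer_bilinear. Qed.

Lemma tensv_ind U V W (A : {vspace U}) (B : {vspace V}) (S : {vspace W})
    (h : {linear tensor U V -> W}) :
  (forall a b, a \in A -> b \in B -> h (a *t b) \in S) ->
  forall t, t \in tensv A B -> h t \in S.
Proof.
move=> hS t; rewrite -[h t]lfunE memv_preim; apply: subvP.
apply/span_subvP => _ /allpairsP[[a b] [aA bB ->]].
by rewrite -memv_preim lfunE hS // vbasis_mem.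
Qed.

Lemma slicel_mem U V (A : {vspace U}) (B : {vspace V}) f t :
  t \in tensv A B -> slicel f t \in B.
Proof.
by apply: tensv_ind => a b _ bB /=; rewrite slicelE memvZ.
Qed.

Lemma slicer_mem U V (A : {vspace U}) (B : {vspace V}) f t :
  t \in tensv A B -> slicer f t \in A.
Proof.
by apply: tensv_ind => a b aA _ /=; rewrite slicerE memvZ.
Qed.

Lemma slice_tlift U V (f : 'Hom(U, K^o)) (g : 'Hom(V, K^o)) t :
  g (slicel f t) = tlift (fun u v => f u * g v : K^o) t.
Proof.
by rewrite /slicel linear_tlift; apply: eq_tlift => u v; rewrite linearZ.
Qed.

Lemma slicer_tlift U V (f : 'Hom(U, K^o)) (g : 'Hom(V, K^o)) t :
  f (slicer g t) = tlift (fun u v => f u * g v : K^o) t.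
Proof.
rewrite /slicer linear_tlift; apply: eq_tlift => u v; rewrite linearZ.
exact: mulrC.
Qed.

(** Split t along p and 1 - p in the first factor: the coordinate functionals
    composed with 1 - p vanish on A, so the slices of the second part lie in
    B. *)
Lemma mem_tensv_sum U V (A : {vspace U}) (B : {vspace V}) (p : 'End(U)) t :
  limg p = A -> {in A, forall x, p x = x} ->
  (forall f : 'Hom(U, K^o), (forall x, x \in A -> f x = 0) -> slicel f t \in B) ->
  t \in (tensv fullv B + tensv A fullv)%VS.
Proof.
move=> pA pid sl.
have -> : t = tlift (fun u v => (u - p u) *t v) t + tlift (fun u v => p u *t v) t.
  rewrite -[tlift _ _ in X in X + _]scale1r -tlift_comb {1}[t]tens_vbasis.
  by apply: eq_tlift => u v; rewrite scale1r -tensDl subrK.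
apply: memv_add.
  pose e := vbasis {:U}.
  have -> : tlift (fun u v => (u - p u) *t v) t =
      \sum_(i < \dim {:U}) e`_i *t slicel (linfun (coord e i : U -> K^o) \o (\1 - p))%VF t.
    have -> : \sum_(i < \dim {:U}) e`_i *t slicel (linfun (coord e i : U -> K^o) \o (\1 - p))%VF t =
       \sum_(i < \dim {:U}) tlift (fun u v => e`_i *t (coord e i (u - p u) *: v)) t.
      apply: eq_bigr => i _; rewrite /slicel linear_tlift.
      apply: eq_tlift => u v /=; rewrite comp_lfunE lfunE /=.
      by rewrite add_lfunE opp_lfunE id_lfunE.
    rewrite /tlift [RHS]exchange_big; apply: eq_bigr => i _ /=.
    rewrite [RHS]exchange_big; apply: eq_bigr => j _ /=.
    rewrite -scaler_sumr; congr (_ *: _).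
    rewrite {1}[_ - _](coord_vbasis (memvf _)) -/e tens_suml.
    by apply: eq_bigr => k _; rewrite tensZl linearZ.
  apply: memv_suml => i _; apply: memv_tens; first exact: memvf.
  apply: sl => x xA; rewrite comp_lfunE add_lfunE opp_lfunE id_lfunE pid //.
  by rewrite subrr linear0.
rewrite /tlift; apply: memv_suml => i _; apply: memv_suml => j _.
by apply: memvZ; apply: memv_tens; rewrite ?memvf // -pA memv_img ?memvf.
Qed.
End Tensor.

(** * Convolution algebras *)

Section Coassoc.
Variables (K : fieldType) (C : coalgType K) (W : vectType K).

(** Coassociativity applied under a trilinear map, the form in which x_(1),
    x_(2), x_(3) are used. *)
Lemma sweedler_assoc (Phi : C -> C -> C -> W) x :
  (forall a b, linear (Phi a b)) -> (forall a c, linear (fun b => Phi a b c)) ->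
  (forall b c, linear (fun a => Phi a b c)) ->
  tlift (fun a b => tlift (fun a1 a2 => Phi a1 a2 b) (comul a)) (comul x) =
  tlift (fun a b => tlift (fun b1 b2 => Phi a b1 b2) (comul b)) (comul x).
Proof.
move=> l3 l2 l1.
have Phi2 c : bilinear_op (fun a b => Phi a b c) by split=> ?.
have Phi1 : bilinear_op
    (fun (t : tensor C C) c => tlift (fun a b => Phi a b c) t).
  split=> [t k a b|c k s t]; last by rewrite linearP.
  rewrite -tlift_comb; apply: eq_tlift => u v; exact: l3.
have := congr1 (tlift (fun (t : tensor C C) c =>
  tlift (fun a b => Phi a b c) t)) (comulA x).
rewrite !tlift_tlift => E; transitivity (tlift (fun a b =>
  tlift (fun (t : tensor C C) c => tlift (fun a0 b0 => Phi a0 b0 c) t)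
    (comul a *t b)) (comul x)).
  by apply: eq_tlift => a b; rewrite tliftP.
rewrite E; apply: eq_tlift => a b; rewrite tlift_tlift.
by apply: eq_tlift => b1 b2; rewrite !tliftP.
Qed.
End Coassoc.

(** A copy of the space of linear maps: for H = B the latter already carries
    the composition product. *)
Definition conv (K : fieldType) (H : coalgType K) (B : falgType K) := 'Hom(H, B).

Section Conv.
Variables (K : fieldType) (H : hopfType K) (B : falgType K).
HB.instance Definition _ := Vector.on (conv H B).
Implicit Types (F G : conv H B).

Definition conv_fun F G (x : H) : B :=
  tlift (fun a b => F a * G b) (comul x).

Fact conv_fun_linear F G : linear (conv_fun F G).
Proof. by move=> k x y; rewrite /conv_fun !linearP. Qed.

HB.instance Definition _ F G :=
  GRing.isLinear.Build K H B _ (conv_fun F G) (conv_fun_linear F G).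

Definition conv_mul F G : conv H B := linfun (conv_fun F G).
Definition conv_unit (x : H) : B := (counit x)%:A.

Fact conv_unit_linear : linear conv_unit.
Proof. by move=> k x y; rewrite /conv_unit linearP scalerDl scalerA. Qed.

HB.instance Definition _ :=
  GRing.isLinear.Build K H B _ conv_unit conv_unit_linear.

Definition conv_one : conv H B := linfun conv_unit.

Lemma lfun_mul_bilinear (U V : vectType K) (F : 'Hom(U, B)) (G : 'Hom(V, B)) :
  bilinear_op (fun a b => F a * G b).
Proof.
split=> [u|v] k a b; rewrite linearP.
  by rewrite mulrDr scalerAr.
by rewrite mulrDl scalerAl.
Qed.

Lemma conv_mulE F G x : conv_mul F G x = tlift (fun a b => F a * G b) (comul x).
Proof. by rewrite /conv_mul /conv_one lfunE. Qed.

Lemma conv_oneE x : conv_one x = (counit x)%:A.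
Proof. by rewrite /conv_mul /conv_one lfunE. Qed.

Lemma mulr_tlift (U V : vectType K) (z : B) (f : U -> V -> B) t :
  z * tlift f t = tlift (fun u v => z * f u v) t.
Proof.
have L : linear (fun y => z * y) by move=> k u v; rewrite mulrDr scalerAr.
pose T := GRing.isLinear.Build K B B _ _ L.
pose zL : {linear B -> B} := HB.pack (fun y => z * y) T.
exact: (linear_tlift zL f t).
Qed.

Lemma mulr_tliftl (U V : vectType K) (z : B) (f : U -> V -> B) t :
  tlift f t * z = tlift (fun u v => f u v * z) t.
Proof.
have L : linear (fun y => y * z) by move=> k u v; rewrite mulrDl scalerAl.
pose T := GRing.isLinear.Build K B B _ _ L.
pose zR : {linear B -> B} := HB.pack (fun y => y * z) T.
exact: (linear_tlift zR f t).
Qed.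

Lemma conv_mulA : associative conv_mul.
Proof.
move=> F G E; apply/lfunP => x; rewrite !conv_mulE.
transitivity (tlift (fun a b : H =>
    tlift (fun b1 b2 : H => F a * G b1 * E b2) (comul b)) (comul x)).
  apply: eq_tlift => a b; rewrite conv_mulE.
  by rewrite mulr_tlift; apply: eq_tlift => u v; rewrite mulrA.
rewrite -sweedler_assoc.
- by apply: eq_tlift => a b; rewrite conv_mulE mulr_tliftl.
- by move=> a b k u v; rewrite linearP mulrDr scalerAr.
- by move=> a b k u v; rewrite linearP mulrDr mulrDl -scalerAr -scalerAl.
- by move=> a b k u v; rewrite linearP !mulrDl -!scalerAl.
Qed.

Lemma conv_mul1l : left_id conv_one conv_mul.
Proof.
move=> F; apply/lfunP => x; rewrite conv_mulE -{2}[x]counitl.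
rewrite linear_tlift; apply: eq_tlift => a b.
by rewrite linearZ conv_oneE -scalerAl mul1r.
Qed.

Lemma conv_mulr1 : right_id conv_one conv_mul.
Proof.
move=> F; apply/lfunP => x; rewrite conv_mulE -{2}[x]counitr.
rewrite linear_tlift; apply: eq_tlift => a b.
by rewrite linearZ conv_oneE -scalerAr mulr1.
Qed.

Lemma conv_mulDl : left_distributive conv_mul +%R.
Proof.
move=> F G E; apply/lfunP => x; rewrite add_lfunE !conv_mulE.
rewrite -[tlift _ _ in RHS]scale1r -tlift_comb; apply: eq_tlift => a b.
by rewrite add_lfunE mulrDl scale1r.
Qed.

Lemma conv_mulDr : right_distributive conv_mul +%R.
Proof.
move=> E F G; apply/lfunP => x; rewrite add_lfunE !conv_mulE.
rewrite -[tlift _ _ in RHS]scale1r -tlift_comb; apply: eq_tlift => a b.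
by rewrite add_lfunE mulrDr scale1r.
Qed.

Lemma conv_one_neq0 : conv_one != 0.
Proof.
apply/eqP => /(congr1 (fun F : conv H B => F 1)).
by rewrite conv_oneE counit1 zero_lfunE scale1r; apply/eqP/oner_neq0.
Qed.

HB.instance Definition _ := GRing.Zmodule_isNzRing.Build (conv H B)
  conv_mulA conv_mul1l conv_mulr1 conv_mulDl conv_mulDr conv_one_neq0.

Lemma tlift_scale (U V W : vectType K) k (f : U -> V -> W) t :
  tlift (fun u v => k *: f u v) t = k *: tlift f t.
Proof.
rewrite /tlift scaler_sumr; apply: eq_bigr => i _.
rewrite scaler_sumr; apply: eq_bigr => j _ /=.
by rewrite !scalerA mulrC.
Qed.

Lemma conv_scalerAl k F G : k *: (F * G) = (k *: F) * G.
Proof.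
apply/lfunP => x; rewrite scale_lfunE !conv_mulE -tlift_scale.
by apply: eq_tlift => a b; rewrite scale_lfunE scalerAl.
Qed.

HB.instance Definition _ := GRing.Lmodule_isLalgebra.Build K (conv H B)
  conv_scalerAl.

Lemma conv_scalerAr k F G : k *: (F * G) = F * (k *: G).
Proof.
apply/lfunP => x; rewrite scale_lfunE !conv_mulE -tlift_scale.
by apply: eq_tlift => a b; rewrite scale_lfunE scalerAr.
Qed.

HB.instance Definition _ := GRing.Lalgebra_isAlgebra.Build K (conv H B)
  conv_scalerAr.
HB.instance Definition _ := Algebra_isFalgebra.Build K (conv H B).

Lemma convM F G x : (F * G) x = tlift (fun a b => F a * G b) (comul x).
Proof. exact: conv_mulE. Qed.

Lemma conv1 x : (1 : conv H B) x = (counit x)%:A.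
Proof. exact: conv_oneE. Qed.
End Conv.

(** * The antipode is an anti-homomorphism of algebras and of coalgebras *)

Section TensorAlgebra.
Variables (K : fieldType) (A : falgType K).

(** A copy of the tensor square, which is a type of matrices and as such
    carries the matrix product. *)
Definition tensalg : Type := tensor A A.
HB.instance Definition _ := Vector.on tensalg.
Implicit Types (s t u : tensalg).

Definition tensalg_mul s t : tensalg := tmul s t.
Definition tensalg_one : tensalg := 1 *t 1.

Lemma tmul_bilinear : bilinear_op (@tmul K A).
Proof.
split=> [s k t t'|t k s s']; last by rewrite /tmul linearP.
by rewrite /tmul -tlift_comb; apply: eq_tlift => a b; rewrite linearP.
Qed.

Lemma tmul_tens a b c d : tmul (a *t b) (c *t d) = (a * c) *t (b * d) :> tensor A A.
Proof.
rewrite /tmul tliftP.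
  rewrite tliftP //; split=> [x|x] k y z.
    by rewrite mulrDr -scalerAr linearP.
  by rewrite mulrDr -scalerAr tensDl tensZl.
split=> [x|x] k y z.
  rewrite -tlift_comb; apply: eq_tlift => u v.
  by rewrite mulrDl -scalerAl linearP.
rewrite -tlift_comb; apply: eq_tlift => u v.
by rewrite mulrDl -scalerAl tensDl tensZl.
Qed.

Let mulDl k s s' t : tmul (k *: s + s') t = k *: tmul s t + tmul s' t.
Proof. exact: tmul_bilinear.2. Qed.
Let mulDr k s t t' : tmul s (k *: t + t') = k *: tmul s t + tmul s t'.
Proof. exact: tmul_bilinear.1. Qed.
Let mul0l t : tmul 0 t = 0.
Proof. by have := mulDl (-1) 0 0 t; rewrite scaler0 addr0 scaleN1r addNr. Qed.
Let mul0r t : tmul t 0 = 0.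
Proof. by have := mulDr (-1) t 0 0; rewrite scaler0 addr0 scaleN1r addNr. Qed.

Lemma tensalg_mulA : associative tensalg_mul.
Proof.
rewrite /tensalg_mul; elim/tensor_ind => [||a b].
- by move=> t u; rewrite !mul0l.
- by move=> k s s' IH IH' t u; rewrite !mulDl IH IH'.
elim/tensor_ind => [||c d].
- by move=> u; rewrite !(mul0l, mul0r).
- by move=> k s s' IH IH' u; rewrite !(mulDl, mulDr) IH IH'.
elim/tensor_ind => [||e f].
- by rewrite !mul0r.
- by move=> k s s' IH IH'; rewrite !mulDr IH IH'.
by rewrite !tmul_tens !mulrA.
Qed.

Lemma tensalg_mul1 : left_id tensalg_one tensalg_mul.
Proof.
rewrite /tensalg_mul; elim/tensor_ind => [||a b].
- by rewrite mul0r.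
- by move=> k s t IH IH'; rewrite mulDr IH IH'.
by rewrite tmul_tens !mul1r.
Qed.

Lemma tensalg_mulr1 : right_id tensalg_one tensalg_mul.
Proof.
rewrite /tensalg_mul; elim/tensor_ind => [||a b].
- by rewrite mul0l.
- by move=> k s t IH IH'; rewrite mulDl IH IH'.
by rewrite tmul_tens !mulr1.
Qed.

Lemma tensalg_mulDl : left_distributive tensalg_mul +%R.
Proof. by move=> s t u; have := mulDl 1 s t u; rewrite !scale1r. Qed.

Lemma tensalg_mulDr : right_distributive tensalg_mul +%R.
Proof. by move=> s t u; have := mulDr 1 s t u; rewrite !scale1r. Qed.

Lemma tensalg_one_neq0 : tensalg_one != 0.
Proof.
have [i i1] : exists i, coord (vbasis {:A}) i (1 : A) != 0.
  apply: contrapT => /forallNP all0.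
  have /eqP := oner_neq0 A; apply; rewrite (coord_vbasis (memvf (1 : A))).
  by rewrite big1 // => i _; have /negP := all0 i; rewrite negbK => /eqP ->;
    rewrite scale0r.
apply/eqP => /matrixP /(_ i i) /eqP; rewrite !mxE mulf_eq0 orbb.
exact/negP.
Qed.

HB.instance Definition _ := GRing.Zmodule_isNzRing.Build tensalg
  tensalg_mulA tensalg_mul1 tensalg_mulr1 tensalg_mulDl tensalg_mulDr
  tensalg_one_neq0.

Lemma tensalg_scalerAl k s t : k *: (s * t) = (k *: s) * t.
Proof. by have := mulDl k s 0 t; rewrite mul0l !addr0. Qed.

HB.instance Definition _ := GRing.Lmodule_isLalgebra.Build K tensalg
  tensalg_scalerAl.

Lemma tensalg_scalerAr k s t : k *: (s * t) = s * (k *: t).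
Proof. by have := mulDr k s t 0; rewrite mul0r !addr0. Qed.

HB.instance Definition _ := GRing.Lalgebra_isAlgebra.Build K tensalg
  tensalg_scalerAr.
HB.instance Definition _ := Algebra_isFalgebra.Build K tensalg.

Lemma tensalgM a b c d :
  (a *t b : tensalg) * (c *t d : tensalg) = (a * c) *t (b * d).
Proof. exact: tmul_tens. Qed.
End TensorAlgebra.

Lemma bihomP (K : fieldType) (U V W : vectType K) (f : U -> V -> W) :
  bilinear_op f -> exists F : 'Hom(U, 'Hom(V, W)), forall u v, F u v = f u v.
Proof.
case=> fl fr.
pose T u := GRing.isLinear.Build K V W _ (f u) (fl u).
pose g u : {linear V -> W} := HB.pack (f u) (T u).
have L : linear (fun u => linfun (g u)).
  by move=> k u v; apply/lfunP => z; rewrite add_lfunE scale_lfunE !lfunE; exact: fr.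
pose T' := GRing.isLinear.Build K U _ _ _ L.
pose h : {linear U -> 'Hom(V, W)} := HB.pack (fun u => linfun (g u)) T'.
by exists (linfun h) => u v; rewrite !lfunE.
Qed.

Section Antipode.
Variables (K : fieldType) (H : hopfType K).
Local Notation S := (@antipode K H).

Lemma sweedlerM (W : vectType K) (Phi : H -> H -> W) (x y : H) :
  bilinear_op Phi ->
  tlift Phi (comul (x * y)) =
  tlift (fun a b => tlift (fun c d => Phi (a * c) (b * d)) (comul y)) (comul x).
Proof.
move=> bPhi; rewrite comulM /tmul !tlift_tlift.
apply: eq_tlift => a b; rewrite tlift_tlift.
by apply: eq_tlift => c d; rewrite tliftP.
Qed.

(** The convolution inverse of an algebra map i is i o S, because i transports
    the identity S * id = 1 = id * S. *)
Lemma conv_antipode (B : falgType K) (i : conv H B) :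
  i (1 : H) = 1 -> (forall x y : H, i (x * y) = i x * i y) ->
  ((i \o S)%VF : conv H B) * i = 1 /\ i * ((i \o S)%VF : conv H B) = 1.
Proof.
move=> i1 iM; split; apply/lfunP => x; rewrite convM conv1.
  transitivity (i (tlift (fun a b => S a * b) (comul x))).
    by rewrite linear_tlift; apply: eq_tlift => a b /=; rewrite comp_lfunE iM.
  by rewrite antipodel linearZ /= i1.
transitivity (i (tlift (fun a b => a * S b) (comul x))).
  by rewrite linear_tlift; apply: eq_tlift => a b /=; rewrite comp_lfunE iM.
by rewrite antipoder linearZ /= i1.
Qed.

Lemma left_right_inv (B : falgType K) (a b c : B) :
  a * b = 1 -> b * c = 1 -> a = c.
Proof. by move=> ab bc; rewrite -[a]mulr1 -bc mulrA ab mul1r. Qed.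

Lemma mul_bilinear (B : falgType K) : bilinear_op (fun a b : B => a * b).
Proof. by split=> [u|u] k v w; rewrite ?mulrDr ?mulrDl -?scalerAr -?scalerAl. Qed.

(** Multiplication, seen as a map x |-> (y |-> xy) in Conv(H, Conv(H, H)), has
    (x, y) |-> S(xy) as a left and (x, y) |-> S(y)S(x) as a right convolution
    inverse. *)
Lemma antipodeM (x y : H) : S (x * y) = S y * S x.
Proof.
have [mu muE] := bihomP (mul_bilinear H).
have [nu nuE] : exists F : 'Hom(H, 'Hom(H, H)), forall u v, F u v = S v * S u.
  by apply: bihomP; split=> [u|u] k v w; rewrite linearP ?mulrDr ?mulrDl -?scalerAr -?scalerAl.
have [rho rhoE] : exists F : 'Hom(H, 'Hom(H, H)), forall u v, F u v = S (u * v).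
  by apply: bihomP; split=> [u|u] k v w; rewrite ?mulrDr ?mulrDl -?scalerAr -?scalerAl linearP.
have ev (F : H -> H -> conv H H) z t :
    tlift F t z = tlift (fun a b => F a b z) t.
  have L : linear (fun G : conv H H => G z).
    by move=> k u v; rewrite add_lfunE scale_lfunE.
  pose T := GRing.isLinear.Build K _ _ _ _ L.
  pose e : {linear (conv H H) -> H} := HB.pack (fun G : conv H H => G z) T.
  exact: (linear_tlift e).
have sub (B : falgType K) (F G : conv H B) x0 : 
  (F * G) x0 = tlift (fun a b => F a * G b) (comul x0) := convM F G x0.
suff: rho = nu by rewrite -rhoE -nuE => ->.
apply: (@left_right_inv (conv H (conv H H)) rho mu nu).
  apply/lfunP => a; apply/lfunP => b; rewrite convM conv1 scale_lfunE conv1.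
  rewrite ev; transitivity (tlift (fun a b => S a * b) (comul (a * b))).
    rewrite sweedlerM; last first.
      by split=> [u|u] k v w; rewrite ?linearP ?mulrDr ?mulrDl -?scalerAr -?scalerAl.
    apply: eq_tlift => a1 a2; rewrite convM; apply: eq_tlift => b1 b2.
    by rewrite rhoE muE.
  by rewrite antipodel counitM scalerA.
apply/lfunP => a; apply/lfunP => b; rewrite convM conv1 scale_lfunE conv1.
rewrite ev scalerA mulrC -scalerA -antipoder -tlift_scale.
apply: eq_tlift => a1 a2; rewrite convM.
transitivity (tlift (fun b1 b2 => a1 * (b1 * S b2 * S a2)) (comul b)).
  by apply: eq_tlift => b1 b2; rewrite muE nuE !mulrA.
rewrite -mulr_tlift -mulr_tliftl antipoder -scalerAl mul1r.
by rewrite scalerAr.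
Qed.

(** In Conv(H, H (x) H) one has Delta = i1 * i2 for the two inclusions i1, i2
    of H. Its inverse is therefore (i2 o S) * (i1 o S), and it is also Delta o
    S since Delta is an algebra map. *)
Lemma comul_antipode (W : vectType K) (Phi : H -> H -> W) (x : H) :
  bilinear_op Phi ->
  tlift Phi (comul (S x)) = tlift (fun a b => Phi (S b) (S a)) (comul x).
Proof.
move=> bPhi; pose B : falgType K := tensalg H.
pose i1 : conv H B := linfun (tens_left (1 : H)).
pose i2 : conv H B := linfun (tens (1 : H)).
pose D : conv H B := @comul K H.
have i1E a : i1 a = a *t 1 by rewrite lfunE.
have i2E a : i2 a = 1 *t a by rewrite lfunE.
have DE : i1 * i2 = D.
  apply/lfunP => a; rewrite convM [RHS]tens_vbasis; apply: eq_tlift => u v.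
  by rewrite i1E i2E tensalgM mulr1 mul1r.
have i1M (a b : H) : i1 (a * b) = i1 a * i1 b.
  by rewrite !i1E tensalgM mulr1.
have i2M (a b : H) : i2 (a * b) = i2 a * i2 b.
  by rewrite !i2E tensalgM mulr1.
have [i1V _] := conv_antipode (i1E 1) i1M.
have [i2V _] := conv_antipode (i2E 1) i2M.
have [_ DV] := conv_antipode (comul1 : D 1 = 1) (@comulM K H).
have DVl : ((i2 \o S)%VF : conv H B) * ((i1 \o S)%VF : conv H B) * D = 1.
  by rewrite -DE mulrA -[X in X * _]mulrA i1V mulr1 i2V.
have /lfunP/(_ x) := left_right_inv DVl DV; rewrite comp_lfunE => E.
rewrite -[comul (S x)]/(D (S x)) -E convM tlift_tlift.
apply: eq_tlift => a b; rewrite !comp_lfunE i1E i2E tensalgM mulr1 mul1r.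
by rewrite tliftP.
Qed.

Lemma counit_antipode (x : H) : counit (S x) = counit x.
Proof.
have := congr1 counit (antipodel x).
rewrite linear_tlift linearZ /= counit1 => /esym.
rewrite [X in X = _]mulr1 => ->; rewrite -{1}[x]counitr !linear_tlift.
by apply: eq_tlift => a b /=; rewrite !linearZ /= counitM mulrC.
Qed.
End Antipode.

(** * The dual algebra, its actions on H, and integrals *)

Section DualAlgebra.
Variables (K : fieldType) (H : hopfType K).
Local Notation A := (conv H K^o).
Implicit Types (f g : A) (x y : H).

(** The actions f -> x = x_(1) f(x_(2)) and x <- f = f(x_(1)) x_(2) of the
    dual algebra; they turn subcoalgebras, comodules and the coradical
    filtration into statements on submodules. *)
Definition lact f x : H := slicer f (comul x).
Definition ract x f : H := slicel f (comul x).

Lemma dual_sep x y : (forall f, f x = f y) -> x = y.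
Proof.
move=> xy; rewrite (coord_vbasis (memvf x)) (coord_vbasis (memvf y)).
apply: eq_bigr => i _; congr (_ *: _).
by have := xy (linfun (coord (vbasis {:H}) i : H -> K^o)); rewrite !lfunE.
Qed.

Lemma dualM f g x : (f * g) x = tlift (fun a b => f a * g b : K^o) (comul x).
Proof. exact: convM. Qed.

Lemma dual1 x : (1 : A) x = counit x.
Proof. by rewrite conv1 /GRing.scale /= mulr1. Qed.

Lemma lactE g f x : g (lact f x) = (g * f) x.
Proof. by rewrite slicer_tlift dualM. Qed.

Lemma ractE g f x : g (ract x f) = (f * g) x.
Proof. by rewrite slice_tlift dualM. Qed.

Lemma lact1 x : lact 1 x = x.
Proof. by apply: dual_sep => g; rewrite lactE mulr1. Qed.

Lemma ract1 x : ract x 1 = x.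
Proof. by apply: dual_sep => g; rewrite ractE mul1r. Qed.

Lemma lactM f g x : lact (f * g) x = lact f (lact g x).
Proof. by apply: dual_sep => h; rewrite !lactE mulrA. Qed.

Lemma ractM f g x : ract x (f * g) = ract (ract x f) g.
Proof. by apply: dual_sep => h; rewrite !ractE mulrA. Qed.

Lemma lract f g x : lact f (ract x g) = ract (lact f x) g.
Proof. by apply: dual_sep => h; rewrite lactE !ractE lactE mulrA. Qed.

Lemma lact_linear f : linear (lact f).
Proof. by move=> k x y; rewrite /lact !linearP. Qed.
HB.instance Definition _ f := GRing.isLinear.Build K H H _ (lact f) (lact_linear f).

(** The right action with its arguments in the order that makes it a linear
    map in x. *)
Definition ract_fun f x := ract x f.
Lemma ract_linear f : linear (ract_fun f).
Proof. by move=> k x y; rewrite /ract_fun /ract !linearP. Qed.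
HB.instance Definition _ f := GRing.isLinear.Build K H H _ (ract_fun f) (ract_linear f).

Lemma lactP k f g x : lact (k *: f + g) x = k *: lact f x + lact g x.
Proof.
by apply: dual_sep => h; rewrite linearP /= !lactE mulrDr -scalerAr add_lfunE scale_lfunE.
Qed.

Lemma ractP k f g x : ract x (k *: f + g) = k *: ract x f + ract x g.
Proof.
by apply: dual_sep => h; rewrite linearP /= !ractE mulrDl -scalerAl add_lfunE scale_lfunE.
Qed.

(** Named so that linearity in f, and not only in x, is available. *)
Definition lact_fun x f := lact f x.
HB.instance Definition _ x :=
  GRing.isLinear.Build K A H _ (lact_fun x) (fun k f g => lactP k f g x).
Definition ract_at x f := ract x f.
HB.instance Definition _ x :=
  GRing.isLinear.Build K A H _ (ract_at x) (fun k f g => ractP k f g x).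

Lemma lact_sum I (r : seq I) (P : pred I) (F : I -> A) x :
  lact (\sum_(i <- r | P i) F i) x = \sum_(i <- r | P i) lact (F i) x.
Proof. exact: (linear_sum (lact_fun x)). Qed.

Lemma ract_sum I (r : seq I) (P : pred I) (F : I -> A) x :
  ract x (\sum_(i <- r | P i) F i) = \sum_(i <- r | P i) ract x (F i).
Proof. exact: (linear_sum (ract_at x)). Qed.

Lemma lact_sumr I (r : seq I) (P : pred I) (F : I -> H) f :
  lact f (\sum_(i <- r | P i) F i) = \sum_(i <- r | P i) lact f (F i).
Proof. exact: (linear_sum (lact f)). Qed.

Lemma ract_suml I (r : seq I) (P : pred I) (F : I -> H) f :
  ract (\sum_(i <- r | P i) F i) f = \sum_(i <- r | P i) ract (F i) f.
Proof. exact: (linear_sum (ract_fun f)). Qed.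

Lemma lactZr k f x : lact f (k *: x) = k *: lact f x.
Proof. exact: (linearZZ (lact f)). Qed.

Lemma ractZl k x f : ract (k *: x) f = k *: ract x f.
Proof. exact: (linearZZ (ract_fun f)). Qed.

Lemma lact0 x : lact 0 x = 0. Proof. exact: (linear0 (lact_fun x)). Qed.
Lemma ract0 x : ract x 0 = 0. Proof. exact: (linear0 (ract_at x)). Qed.
Lemma lactZ k f x : lact (k *: f) x = k *: lact f x.
Proof. exact: (linearZZ (lact_fun x)). Qed.
Lemma ractZ k f x : ract x (k *: f) = k *: ract x f.
Proof. exact: (linearZZ (ract_at x)). Qed.

Local Notation b i := (vbasis {:H})`_(@nat_of_ord (\dim {:H}) i).

Definition cobasis (i : 'I_(\dim {:H})) : A := linfun (coord (vbasis {:H}) i : H -> K^o).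

Lemma cobasisE i x : cobasis i x = coord (vbasis {:H}) i x.
Proof. by rewrite lfunE. Qed.

Lemma sum_cobasis x : \sum_i cobasis i x *: b i = x.
Proof.
by rewrite [RHS](coord_vbasis (memvf x)); apply: eq_bigr => i _; rewrite cobasisE.
Qed.

Lemma cobasis_sum f : \sum_i f (b i) *: cobasis i = f.
Proof.
apply/lfunP => x; rewrite sum_lfunE -[in RHS](sum_cobasis x) linear_sum.
by apply: eq_bigr => i _; rewrite scale_lfunE linearZ; apply: mulrC.
Qed.

Lemma cobasisM i j x : (cobasis i * cobasis j) x = comul x i j.
Proof.
rewrite dualM [in RHS](tens_vbasis (comul x)) /tlift summxE.
apply: eq_bigr => k _; rewrite summxE; apply: eq_bigr => l _.
by rewrite !mxE !cobasisE.
Qed.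

Lemma sweedler_coord (W : vectType K) (Phi : H -> H -> W) x :
  tlift Phi (comul x) = \sum_i \sum_j (cobasis i * cobasis j) x *: Phi (b i) (b j).
Proof.
by apply: eq_bigr => i _; apply: eq_bigr => j _; rewrite cobasisM.
Qed.

Lemma sweedler_lact (W : vectType K) (Phi : H -> H -> W) x : bilinear_op Phi ->
  tlift Phi (comul x) = \sum_i Phi (lact (cobasis i) x) (b i).
Proof.
move=> [Pl Pr]; rewrite sweedler_coord exchange_big; apply: eq_bigr => j _ /=.
pose T := GRing.isLinear.Build K H W _ _ (Pr (b j)).
pose h : {linear H -> W} := HB.pack (Phi^~ (b j)) T.
rewrite -[RHS]/(h _) -[X in h X]sum_cobasis linear_sum; apply: eq_bigr => i _.
by rewrite linearZ lactE.
Qed.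

(** Any sum of f_i (x) y_i can be replaced by the sum of b^k (x) phi(b_k),
    where phi is the endomorphism z |-> sum_i f_i(z) y_i; an identity between
    endomorphisms is thus enough to rewrite it. *)
Lemma contraction (W : vectType K) (F : A -> H -> W) I (r : seq I)
    (G : I -> A) (y : I -> H) : bilinear_op F ->
  \sum_(i <- r) F (G i) (y i) =
  \sum_k F (cobasis k) (\sum_(i <- r) (G i (b k) : K) *: y i).
Proof.
move=> [Fl Fr].
transitivity (\sum_(i <- r) \sum_k G i (b k) *: F (cobasis k) (y i)).
  apply: eq_bigr => i _.
  pose T := GRing.isLinear.Build K A W _ _ (Fr (y i)).
  pose h : {linear A -> W} := HB.pack (F^~ (y i)) T.
  rewrite -[LHS]/(h _) -[X in h X]cobasis_sum linear_sum.
  by apply: eq_bigr => k _; rewrite linearZ.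
rewrite exchange_big; apply: eq_bigr => k _ /=.
pose T := GRing.isLinear.Build K H W _ _ (Fl (cobasis k)).
pose h : {linear H -> W} := HB.pack (F (cobasis k)) T.
rewrite -[RHS]/(h _) linear_sum; apply: eq_bigr => i _.
by rewrite linearZ.
Qed.

Local Notation S := (@antipode K H).

Definition dualS f : A := (f \o S)%VF.
Lemma dualSE f x : dualS f x = f (S x). Proof. by rewrite comp_lfunE. Qed.

Lemma dualSM f g : dualS f * dualS g = dualS (g * f).
Proof.
apply/lfunP => x; rewrite dualSE !dualM comul_antipode; last exact: lfun_mul_bilinear.
by apply: eq_tlift => u v; rewrite !dualSE mulrC.
Qed.

Lemma dualS1 : dualS 1 = 1.
Proof. by apply/lfunP => x; rewrite dualSE !dual1 counit_antipode. Qed.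

Lemma dualSP k f g : dualS (k *: f + g) = k *: dualS f + dualS g.
Proof. by apply/lfunP => x; rewrite !(add_lfunE, scale_lfunE, dualSE). Qed.

HB.instance Definition _ := GRing.isLinear.Build K A A _ dualS dualSP.

Definition transr f z : A := (f \o amulr z)%VF.
Definition transl f z : A := (f \o amull z)%VF.
Lemma transrE f z x : transr f z x = f (x * z).
Proof. by rewrite comp_lfunE lfunE. Qed.
Lemma translE f z x : transl f z x = f (z * x).
Proof. by rewrite comp_lfunE lfunE. Qed.

(** The Hopf module identity f(S w_(2)) h w_(1) = f(S(h_(2) w_(2)) h_(3))
    h_(1) w_(1), which rests on S(h_(2) w_(2)) h_(3) = S(w_(2)) S(h_(2))
    h_(3). *)
Lemma mul_lact_dualS h f w :
  h * lact (dualS f) w = \sum_j lact (dualS (transr f (b j))) (lact (cobasis j) h * w).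
Proof.
pose G c z := c * lact (dualS (transr f z)) w.
have fSzP k u v : dualS (transr f (k *: u + v)) =
    k *: dualS (transr f u) + dualS (transr f v).
  apply/lfunP => x; rewrite !(add_lfunE, scale_lfunE, dualSE, transrE).
  by rewrite mulrDr -scalerAr linearP.
have bG : bilinear_op G.
  split=> [c|z] k u v; rewrite /G.
    by rewrite fSzP lactP mulrDr -scalerAr.
  by rewrite mulrDl -scalerAl.
rewrite -(sweedler_lact (Phi := fun h1 h2 => lact (dualS (transr f h2)) (h1 * w)));
  last first.
  split=> [u|u] k v z; last by rewrite mulrDl -scalerAl linearP.
  by rewrite fSzP lactP.
transitivity (tlift (fun c e => tlift (fun d h2 => G c (S d * h2)) (comul e))
  (comul h)).
  have -> : h * lact (dualS f) w = G h 1.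
    rewrite /G; congr (_ * lact (dualS _) _); apply/lfunP => x.
    by rewrite transrE mulr1.
  rewrite -{1}[h]counitr.
  pose T := GRing.isLinear.Build K H H _ _ (bG.2 1).
  pose h1 : {linear H -> H} := HB.pack (G^~ 1) T.
  rewrite -[LHS]/(h1 _) linear_tlift; apply: eq_tlift => c e.
  pose T' := GRing.isLinear.Build K H H _ _ (bG.1 c).
  pose h2 : {linear H -> H} := HB.pack (G c) T'.
  have -> : tlift (fun d h2 => G c (S d * h2)) (comul e) =
     h2 (tlift (fun d h2 => S d * h2) (comul e)) by rewrite linear_tlift.
  by rewrite antipodel !linearZ.
rewrite -sweedler_assoc.
- apply: eq_tlift => h1 h2; rewrite /lact /slicer sweedlerM; last first.
    by apply: slicer_bilinear.
  apply: eq_tlift => c d; rewrite /G /lact /slicer mulr_tlift.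
  apply: eq_tlift => w1 w2.
  by rewrite -scalerAr !dualSE !transrE antipodeM mulrA.
- by move=> a c k u v; rewrite mulrDr -scalerAr bG.1.
- by move=> a c k u v; rewrite linearP mulrDl -scalerAl bG.1.
- by move=> a c k u v; rewrite bG.2.
Qed.

(** The projection onto coinvariants of the Larson-Sweedler theorem, for the
    Hopf module H over H^* on which f acts by m |-> f(S m_(2)) m_(1) and whose
    coaction is dual to left multiplication. *)
Definition averaging (m : H) : H := \sum_k lact (dualS (cobasis k)) (S (b k) * m).

(** Moving h through the sum produces h_(1) S(h_(2)) = epsilon(h) in front of
    S(b_k). *)
Lemma averaging_integral h m : h * averaging m = (counit h : K) *: averaging m.
Proof.
rewrite /averaging mulr_sumr scaler_sumr.
transitivity (\sum_j \sum_k lact (dualS (transr (cobasis k) (b j)))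
                (lact (cobasis j) h * (S (b k) * m))).
  by rewrite exchange_big; apply: eq_bigr => k _ /=; rewrite mul_lact_dualS.
transitivity (\sum_j \sum_l lact (dualS (cobasis l))
                (lact (cobasis j) h * (S (b j) * S (b l) * m))).
  apply: eq_bigr => j _.
  rewrite (contraction (F := fun g y => lact (dualS g) (lact (cobasis j) h * (y * m)))
    _ (fun k => transr (cobasis k) (b j)) (fun k => S (b k))); last first.
    split=> [g|y] k u v; last by rewrite dualSP lactP.
    by rewrite mulrDl mulrDr -scalerAl -scalerAr linearP.
  apply: eq_bigr => l _; rewrite -antipodeM; congr (lact _ (_ * (_ * _))).
  rewrite -[in RHS](sum_cobasis (b l * b j)) linear_sum; apply: eq_bigr => k _.
  by rewrite linearZ transrE.
rewrite exchange_big; apply: eq_bigr => l _ /=.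
rewrite -[LHS]linear_sum -linearZZ; congr (lact _ _).
transitivity (\sum_j (lact (cobasis j) h * S (b j)) * (S (b l) * m)).
  by apply: eq_bigr => j _; rewrite !mulrA.
rewrite -mulr_suml -(sweedler_lact (Phi := fun a c => a * S c)).
  by rewrite antipoder -scalerAl mul1r.
by split=> [u|u] k v z; rewrite ?linearP ?mulrDr ?mulrDl -?scalerAr -?scalerAl.
Qed.

(** The two sums contract to S(x_(1)) x_(2) = epsilon(x). So every m is
    recovered from averages, and these cannot all vanish. *)
Lemma sum_averaging m : \sum_i lact (dualS (cobasis i)) (averaging (b i * m)) = m.
Proof.
pose F g y := lact (dualS g) (y * m).
have bF : bilinear_op F.
  split=> [g|y] k u v; rewrite /F; last by rewrite dualSP lactP.
  by rewrite mulrDl -scalerAl linearP.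
transitivity (\sum_(p : 'I_(\dim {:H}) * 'I_(\dim {:H}))
   F (cobasis p.2 * cobasis p.1) (S (b p.2) * b p.1)).
  rewrite -(pair_bigA _ (fun i k => F (cobasis k * cobasis i) (S (b k) * b i))) /=.
  apply: eq_bigr => i _; rewrite linear_sum; apply: eq_bigr => k _ /=.
  by rewrite -lactM dualSM mulrA.
rewrite contraction //.
transitivity (\sum_k F ((counit (b k) : K) *: cobasis k) 1).
  apply: eq_bigr => k _.
  have -> : \sum_(i : 'I_(\dim {:H}) * 'I_(\dim {:H}))
     ((cobasis i.2 * cobasis i.1) (b k) : K) *: (S (b i.2) * b i.1) =
     (counit (b k) : K) *: (1 : H).
    rewrite -antipodel sweedler_coord exchange_big pair_bigA /=.
    by apply: eq_bigr.
  by rewrite /F linearZZ lactZ -scalerAl linearZZ.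
rewrite /F; transitivity (lact (dualS (\sum_k counit (b k) *: cobasis k)) m).
  rewrite linear_sum lact_sum.
  by apply: eq_bigr => k _; rewrite mul1r.
rewrite (cobasis_sum (counit : A)).
have -> : (counit : A) = 1 by apply/lfunP => x; rewrite dual1.
by rewrite dualS1 lact1.
Qed.

Theorem exists_integral : exists2 t : H, t != 0 &
  forall h : H, h * t = (counit h : K) *: t.
Proof.
apply: contrapT => no_t.
have avg0 m : averaging m = 0.
  apply/eqP/negPn/negP => nz; apply: no_t; exists (averaging m) => // h.
  exact: averaging_integral.
have := sum_averaging 1; rewrite big1 => [|i _]; last by rewrite avg0 linear0.
by move/eqP; rewrite eq_sym oner_eq0.
Qed.

(** For a left integral t one has t_(1) (x) h t_(2) = S(h_(1)) h_(2) t_(1) (x)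
    h_(3) t_(2) = S(h) t_(1) (x) t_(2). *)
Lemma integral_transl (t : H) f h :
  (forall h : H, h * t = (counit h : K) *: t) ->
  lact (transl f h) t = S h * lact f t.
Proof.
move=> tI.
have tP k u v : transl f (k *: u + v) = k *: transl f u + transl f v.
  apply/lfunP => x; rewrite !(add_lfunE, scale_lfunE, translE).
  by rewrite mulrDl -scalerAl linearP.
pose G c d := c * lact (transl f d) t.
have bG : bilinear_op G.
  split=> [c|z] k u v; rewrite /G.
    by rewrite tP lactP mulrDr -scalerAr.
  by rewrite mulrDl -scalerAl.
have GE (d : H) : lact f (d * t) = tlift (fun d1 d2 => G d1 d2) (comul d).
  rewrite /lact /slicer sweedlerM; last exact: slicer_bilinear.
  apply: eq_tlift => d1 d2; rewrite /G /lact /slicer mulr_tlift.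
  by apply: eq_tlift => t1 t2; rewrite translE -scalerAr.
transitivity (tlift (fun h1 h2 => S h1 * lact f (h2 * t)) (comul h)); last first.
  rewrite -[in RHS](counitr h) !linear_tlift mulr_tliftl.
  by apply: eq_tlift => a c /=; rewrite tI !linearZZ -scalerAr -scalerAl.
transitivity (tlift (fun h1 h2 => tlift (fun d1 d2 => G (S h1 * d1) d2) (comul h2))
   (comul h)); last first.
  apply: eq_tlift => h1 h2; rewrite (GE h2) mulr_tlift.
  by apply: eq_tlift => d1 d2; rewrite /G mulrA.
rewrite -sweedler_assoc.
- transitivity (tlift (fun h1 h2 : H => G ((counit h1 : K) *: (1 : H)) h2) (comul h)).
    have {1}-> : lact (transl f h) t = G 1 h by rewrite /G mul1r.
    rewrite -{1}[h]counitl.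
    pose T := GRing.isLinear.Build K H H _ _ (bG.1 1).
    pose h1 : {linear H -> H} := HB.pack (G 1) T.
    rewrite -[LHS]/(h1 _) linear_tlift; apply: eq_tlift => c e.
    by rewrite linearZ /G /= -scalerAl.
  apply: eq_tlift => c e; rewrite -antipodel.
  pose T := GRing.isLinear.Build K H H _ _ (bG.2 e).
  pose h1 : {linear H -> H} := HB.pack (G^~ e) T.
  by rewrite -[LHS]/(h1 _) linear_tlift.
- by move=> a c k u v; rewrite bG.1.
- by move=> a c k u v; rewrite mulrDr -scalerAr bG.2.
- by move=> a c k u v; rewrite linearP mulrDl -scalerAl bG.2.
Qed.

(** The functionals g with g -> t = 0 form a left ideal stable under g |-> g(h
    .). Such a g has g(1) epsilon = sum_i (b^i o S) * g(b_i .), so g(1) t = 0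
    and g(1) = 0. Applied to all the translates of f this gives f = 0. As H
    and H^* have the same dimension, f |-> f -> t is then bijective: H^* is a
    Frobenius algebra. *)
Theorem integral_faithful (t : H) f :
  t != 0 -> (forall h : H, h * t = (counit h : K) *: t) ->
  lact f t = 0 -> f = 0.
Proof.
move=> t0 tI.
have f1 (g : A) : (forall h, lact (transl g h) t = 0) -> g 1 = 0.
  move=> gt0; have E : \sum_i dualS (cobasis i) * transl g (b i) = (g 1 : K) *: 1.
    apply/lfunP => x; rewrite sum_lfunE scale_lfunE dual1.
    transitivity (g (tlift (fun a c => S a * c) (comul x))).
      rewrite linear_tlift.
      transitivity (\sum_i tlift (fun a c => dualS (cobasis i) a * transl g (b i) c : K^o)
         (comul x)).
        by apply: eq_bigr => i _; rewrite dualM.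
      rewrite /tlift exchange_big; apply: eq_bigr => i _ /=.
      rewrite exchange_big; apply: eq_bigr => j _ /=; rewrite -scaler_sumr.
      congr (_ *: _); rewrite -[S (b i)]sum_cobasis mulr_suml linear_sum.
      by apply: eq_bigr => k _; rewrite dualSE translE -scalerAl linearZ.
    by rewrite antipodel linearZ; apply: mulrC.
  have : lact ((g 1 : K) *: 1) t = 0.
    by rewrite -E lact_sum big1 // => i _; rewrite lactM gt0 linear0.
  by rewrite lactZ lact1 => /eqP; rewrite scaler_eq0 (negPf t0) orbF => /eqP.
move=> ft0; apply/lfunP => h; rewrite zero_lfunE.
have <- : transl f h 1 = f h by rewrite translE mulr1.
apply: f1 => h'.
have -> : transl (transl f h) h' = transl f (h * h').
  by apply/lfunP => x; rewrite !translE mulrA.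
by rewrite integral_transl // ft0 mulr0.
Qed.
End DualAlgebra.

(** * Simple comodules and matrix coefficients *)

(** Let T be a nonzero element of minimal rank. If a is an eigenvalue of XT on
    the row space of T, then TXT - aT has smaller rank, so TXT = aT for every
    X in P. Transitivity then forces T to have rank one, and the products XTY
    contain all the matrix units. *)
Theorem burnside (K : closedFieldType) d (P : {vspace 'M[K]_d}) :
  (0 < d)%N -> (forall X Y, X \in P -> Y \in P -> X *m Y \in P) ->
  (forall v w : 'rV[K]_d, v != 0 -> exists2 X, X \in P & v *m X = w) ->
  P = fullv.
Proof.
move=> d_gt0 PM trP.
have [e0 e00] : exists e : 'rV[K]_d, e != 0.
  exists (delta_mx 0 (Ordinal d_gt0)); apply/eqP => /matrixP/(_ 0 (Ordinal d_gt0)).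
  by rewrite !mxE !eqxx => /eqP; rewrite oner_eq0.
have exT : exists n, `[< exists T, [/\ T \in P, T != 0 & \rank T = n] >].
  have [X XP eX] := trP e0 e0 e00.
  exists (\rank X); apply/asboolP; exists X; split=> //.
  by apply: contraNneq e00 => X0; rewrite -eX X0 mulmx0.
case: (ex_minnP exT) => r /asboolP[T [TP T0 rT]] rmin {exT}.
have [u1 u1T] : exists u : 'rV_d, u *m T != 0.
  apply: contrapT => /forallNP nu; case/eqP: T0; apply/row_matrixP => i.
  by rewrite row0 rowE; apply/eqP/negPn/negP/nu.
have TXT X : X \in P -> exists a, T *m X *m T = a *: T.
  move=> XP; pose R := row_base T; pose M := R *m X *m T *m pinvmx R.
  have MR : M *m R = R *m X *m T.
    by rewrite mulmxKpV // eq_row_base submxMl.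
  have r_gt0 : (0 < \rank T)%N by rewrite lt0n mxrank_eq0.
  have [a] : exists a, root (char_poly M) a.
    by apply/closed_rootP; rewrite size_char_poly; case: (\rank T) r_gt0.
  rewrite -eigenvalue_root_char => /eigenvalueP[v vM v0]; exists a.
  apply/eqP; rewrite -subr_eq0; apply/negPn/negP => T'0.
  have [z zE] : exists z, v *m R = z *m T.
    by apply/submxP; rewrite -(eq_row_base T) submxMl.
  have zT : z *m T != 0.
    rewrite -zE; apply: contraNneq v0 => vR.
    have Rf : row_free R by apply: row_base_free.
    by apply/eqP/(row_free_inj Rf); rewrite /= vR mul0mx.
  have zT' : z *m (T *m X *m T - a *: T) = 0.
    have vRXT : v *m R *m X *m T = a *: (v *m R).
      rewrite -[v *m R *m X]mulmxA -[v *m _ *m T]mulmxA -MR mulmxA vM.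
      by rewrite -scalemxAl.
    by rewrite mulmxBr !mulmxA -zE -scalemxAr -zE vRXT subrr.
  have := rmin (\rank (T *m X *m T - a *: T)).
  rewrite leqNgt -rT => /(_ _)/negP; apply.
    apply/asboolP; exists (T *m X *m T - a *: T); split=> //.
    by rewrite memvB ?memvZ ?PM.
  have ker_lt : (kermx T < kermx (T *m X *m T - a *: T))%MS.
    rewrite /ltmx; apply/andP; split.
      apply/sub_kermxP; rewrite mulmxBr !mulmxA mulmx_ker !mul0mx -scalemxAr.
      by rewrite mulmx_ker scaler0 subrr.
    apply/negP => sub; case/eqP: zT; apply/sub_kermxP.
    by apply: submx_trans sub; apply/sub_kermxP.
  by have := rank_ltmx ker_lt; rewrite !mxrank_ker ltn_sub2lE ?rank_leq_row.
pose b := u1 *m T.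
have Tb (u : 'rV_d) : exists a, u *m T = a *: b.
  (* every row u of the form b X satisfies u T = u1 (T X T), a multiple of
     b *)
  have [X XP bX] := trP b u u1T; have [a Ea] := TXT X XP.
  exists a; rewrite -bX /b.
  have -> : u1 *m T *m X *m T = u1 *m (T *m X *m T) by rewrite !mulmxA.
  by rewrite Ea -scalemxAr.
pose a i := projT1 (cid (Tb (delta_mx 0 i))).
have aE i : row i T = a i *: b by rewrite rowE /a; case: cid.
pose c : 'cV[K]_d := \col_i a i.
have Tcb : T = c *m b.
  apply/row_matrixP => i; rewrite aE row_mul; apply/matrixP => j k.
  by rewrite !ord1 [LHS]mxE [RHS]mxE big_ord1 !mxE.
have c0 : c != 0 by apply: contraNneq T0 => c0; rewrite Tcb c0 mul0mx.
pose X_ j := (vbasis P)`_j.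
have XP j : X_ j \in P.
  have [lt|ge] := ltnP j (size (vbasis P)); first by rewrite vbasis_mem ?mem_nth.
  by rewrite /X_ nth_default ?mem0v.
pose G := \matrix_(i < d, j < \dim P) (X_ j *m c) i 0.
have Gfree : row_free G.
  rewrite -kermx_eq0; apply/negPn/negP => /rowV0Pn[z /sub_kermxP zG z0].
  have [e ec] : exists e : 'rV_d, e *m c != 0.
    apply: contrapT => /forallNP nu; case/eqP: c0; apply/row_matrixP => i.
    by rewrite row0 rowE; apply/eqP/negPn/negP/nu.
  have [X XinP zX] := trP z e z0; case/eqP: ec.
  rewrite -zX (coord_vbasis XinP) mulmx_sumr mulmx_suml big1 // => j _.
  rewrite -scalemxAr -scalemxAl; apply/eqP; rewrite scaler_eq0; apply/orP; right.
  have /matrixP/(_ 0 j) := zG; rewrite !mxE => Ej.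
  apply/eqP/matrixP => i k; rewrite !ord1 -mulmxA !mxE -[RHS]Ej.
  by apply: eq_bigr => l _; rewrite [G _ _]mxE.
have colP i : exists2 X, X \in P & X *m c = delta_mx i 0.
  exists (\sum_j pinvmx G j i *: X_ j); first by apply: memv_suml => j _; rewrite memvZ.
  transitivity (col i (G *m pinvmx G)).
    rewrite mulmx_suml; apply/matrixP => k l; rewrite !ord1 summxE !mxE.
    by apply: eq_bigr => j _; rewrite -scalemxAl !mxE mulrC.
  by rewrite mulmxVp // col1.
apply/eqP; rewrite eqEsubv subvf /=; apply/subvP => M _.
rewrite [M]matrix_sum_delta; apply: memv_suml => i _; apply: memv_suml => j _.
apply: memvZ; have [X X1 Xc] := colP i; have [Y Y1 bY] := trP b (delta_mx 0 j) u1T.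
have -> : delta_mx i j = X *m T *m Y.
  by rewrite Tcb mulmxA Xc -mulmxA bY mul_delta_mx.
by rewrite !PM.
Qed.

Section Comatrix.
Variables (K : fieldType) (H : hopfType K).
Local Notation A := (conv H K^o).
Implicit Types (f g : A) (x y : H) (D E M N : {vspace H}).

(** A comatrix coalgebra given by its standard basis; comatrix_dual says that
    the c i j are linearly independent. *)
Record comatrix d (c : 'I_d -> 'I_d -> H) : Prop := Comatrix {
  comatrix_gt0 : (0 < d)%N;
  comatrixM : forall f g i j, (f * g) (c i j) = \sum_k f (c i k) * g (c k j) :> K^o;
  comatrix1 : forall i j, counit (c i j) = (i == j)%:R;
  comatrix_dual : forall X : 'M[K]_d, exists f : A, forall i j, f (c i j) = X i j
}.

Definition cospan_fun d (c : 'I_d -> 'I_d -> H) (X : 'M[K]_d) : H :=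
  \sum_i \sum_j X i j *: c i j.

Fact cospan_fun_linear d (c : 'I_d -> 'I_d -> H) : linear (cospan_fun c).
Proof.
move=> k X Y; rewrite /cospan_fun scaler_sumr -big_split; apply: eq_bigr => i _.
rewrite scaler_sumr -big_split; apply: eq_bigr => j _ /=.
by rewrite !mxE scalerDl scalerA.
Qed.
HB.instance Definition _ d c :=
  GRing.isLinear.Build K 'M[K]_d H _ (@cospan_fun d c) (cospan_fun_linear c).

Definition cospan d (c : 'I_d -> 'I_d -> H) : {vspace H} :=
  limg (linfun (cospan_fun c)).

Lemma cospan_delta d (c : 'I_d -> 'I_d -> H) i j :
  cospan_fun c (delta_mx i j) = c i j.
Proof.
rewrite /cospan_fun (bigD1 i) //= (bigD1 j) //= !mxE !eqxx scale1r.
rewrite big1 ?addr0 => [|k /negPf nk]; last by rewrite mxE nk andbF scale0r.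
rewrite big1 ?addr0 // => k /negPf nk; rewrite big1 // => l _.
by rewrite mxE nk scale0r.
Qed.

Lemma mem_cospan d (c : 'I_d -> 'I_d -> H) i j : c i j \in cospan c.
Proof. by rewrite -cospan_delta -[cospan_fun _ _]lfunE memv_img ?memvf. Qed.

Lemma cospanP d (c : 'I_d -> 'I_d -> H) x :
  reflect (exists X, x = \sum_i \sum_j X i j *: c i j) (x \in cospan c).
Proof.
apply: (iffP memv_imgP) => [[X _ ->]|[X ->]].
  by exists X; rewrite lfunE.
exists (\matrix_(i, j) X i j); rewrite ?memvf // lfunE.
by apply: eq_bigr => i _; apply: eq_bigr => j _; rewrite mxE.
Qed.

Lemma cospan_sub d (c : 'I_d -> 'I_d -> H) D :
  (forall i j, c i j \in D) -> (cospan c <= D)%VS.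
Proof.
move=> cD; apply/subvP => x /cospanP[X ->]; apply: memv_suml => i _.
by apply: memv_suml => j _; rewrite memvZ.
Qed.

Section Theory.
Variables (d : nat) (c : 'I_d -> 'I_d -> H).
Hypothesis cc : comatrix c.

Lemma comul_comatrix i j : comul (c i j) = \sum_k c i k *t c k j.
Proof.
apply: tensor_eqP => f g; rewrite -[LHS](dualM f g) (comatrixM cc) linear_sum.
apply: eq_bigr => k _; rewrite /= tliftP //; exact: lfun_mul_bilinear.
Qed.

Lemma cospan_eval f X :
  f (cospan_fun c X) = \sum_i \sum_j X i j * f (c i j) :> K.
Proof.
rewrite linear_sum; apply: eq_bigr => i _; rewrite linear_sum.
by apply: eq_bigr => j _; rewrite linearZ.
Qed.

Lemma sum_mx_delta (F : 'I_d -> 'I_d -> K) i j (X : 'M[K]_d) : X = delta_mx i j ->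
  \sum_k \sum_l F k l * X k l = F i j.
Proof.
move=> ->; rewrite (bigD1 i) //= (bigD1 j) //= mxE !eqxx mulr1.
rewrite big1 ?addr0 => [|k /negPf nk]; last by rewrite mxE nk andbF mulr0.
rewrite big1 ?addr0 // => k /negPf nk; rewrite big1 // => l _.
by rewrite mxE nk mulr0.
Qed.

Lemma cospan_inj X : cospan_fun c X = 0 -> X = 0.
Proof.
move=> X0; apply/matrixP => i j; rewrite mxE.
have [f fE] := comatrix_dual cc (delta_mx i j).
have := congr1 f X0; rewrite linear0 cospan_eval => <-.
rewrite -(sum_mx_delta X (erefl (delta_mx i j))).
by apply: eq_bigr => k _; apply: eq_bigr => l _; rewrite fE.
Qed.

Lemma dim_cospan : \dim (cospan c) = (d ^ 2)%N.
Proof.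
rewrite limg_dim_eq; first by rewrite dimvf dim_matrix -[RHS]mulnn.
apply/eqP; rewrite capfv -subv0; apply/subvP => X; rewrite memv_ker lfunE memv0.
by move=> /eqP/cospan_inj ->.
Qed.

Lemma cospan_subcoalgebra : subcoalgebra (cospan c).
Proof.
move=> _ /cospanP[X ->]; rewrite linear_sum; apply: memv_suml => i _.
rewrite linear_sum; apply: memv_suml => j _; rewrite linearZ memvZ //=.
by rewrite comul_comatrix; apply: memv_suml => k _; rewrite memv_tens ?mem_cospan.
Qed.

(** The functionals dual to the c i j act from both sides as matrix units, and
    carry any nonzero coordinate of an element of E to any place. *)
Lemma cospan_bistable E : (forall f x, x \in E -> lact f x \in E) ->
  (forall f x, x \in E -> ract x f \in E) -> (E <= cospan c)%VS ->
  E = 0%VS \/ E = cospan c.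
Proof.
move=> lE rE EC; have [->|E0] := eqVneq E 0%VS; [by left | right].
apply/eqP; rewrite eqEsubv EC /=; apply: cospan_sub => r s.
have xE := memv_pick E; have := E0; rewrite -vpick0; set x := vpick E in xE *.
have /cospanP[X xX] := subvP EC _ xE => x0.
have [p [q Xpq]] : exists p q : 'I_d, X p q != 0.
  apply: contrapT => nX; case/eqP: x0; rewrite xX big1 // => p _; rewrite big1 // => q _.
  have [->|Xpq] := eqVneq (X p q) 0; first by rewrite scale0r.
  by case: nX; exists p, q.
have [f fE] := comatrix_dual cc (delta_mx p r).
have [g gE] := comatrix_dual cc (delta_mx s q).
have : lact g (ract x f) \in E by rewrite lE ?rE.
have -> : lact g (ract x f) = X p q *: c r s.
  apply: dual_sep => h; rewrite lactE ractE linearZ /=.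
  have -> : x = cospan_fun c (\matrix_(i, j) X i j).
    by rewrite xX; apply: eq_bigr => i _; apply: eq_bigr => j _; rewrite mxE.
  rewrite cospan_eval; transitivity (X p q * h (c r s) : K); last by [].
  rewrite -(sum_mx_delta (fun k l => X k l * h (c r s)) (erefl (delta_mx p q))).
  apply: eq_bigr => i _; apply: eq_bigr => j _; rewrite mxE -mulrA; congr (_ * _).
  rewrite (comatrixM cc) (bigD1 r) //= fE big1 ?addr0; last first.
    by move=> k /negPf nk; rewrite fE mxE nk andbF mul0r.
  rewrite (comatrixM cc) (bigD1 s) //= gE big1 ?addr0; last first.
    by move=> k /negPf nk; rewrite gE mxE nk mulr0.
  rewrite !mxE !eqxx andbT mulrCA; congr (_ * _).
  by rewrite -natrM mulnb.
by move/(memvZ (X p q)^-1); rewrite scalerA mulVf // scale1r.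
Qed.

Lemma cospan_simple : simple_subcoalgebra (cospan c).
Proof.
have d0 := comatrix_gt0 cc; split=> [||E Esub EC].
- by rewrite -dimv_eq0 dim_cospan -lt0n expn_gt0 d0.
- exact: cospan_subcoalgebra.
apply: cospan_bistable => // f x; first by move/Esub/slicer_mem; apply.
by move/Esub/slicel_mem; apply.
Qed.
End Theory.

Definition ract_stable M := forall x f, x \in M -> ract x f \in M.

(** A subspace of minimal dimension among the stable ones strictly above N. *)
Lemma exists_simple N T : ract_stable N -> ract_stable T -> (N <= T)%VS -> N != T ->
  exists M, [/\ ract_stable M, (N <= M)%VS, N != M, (M <= T)%VS &
    forall L, ract_stable L -> (N <= L)%VS -> (L <= M)%VS -> L = N \/ L = M].
Proof.
move=> sN sT NT neNT; pose ok n := `[< exists M, [/\ ract_stable M, (N <= M)%VS,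
  N != M, (M <= T)%VS & \dim M = n] >].
have exn : exists n, ok n by exists (\dim T); apply/asboolP; exists T; split.
case: (ex_minnP exn) => n /asboolP[M [sM NM neNM MT dM]] nmin.
exists M; split=> // L sL NL LM; have [->|neNL] := eqVneq L N; [by left | right].
apply/eqP; rewrite eqEdim LM dM; apply: nmin; apply/asboolP; exists L.
by split=> //; [rewrite eq_sym | exact: subv_trans MT].
Qed.

Lemma subcoalgebra_ract D : subcoalgebra D -> ract_stable D.
Proof. by move=> sD x f /sD/slicel_mem; apply. Qed.

Lemma subcoalgebra_lact D x f : subcoalgebra D -> x \in D -> lact f x \in D.
Proof. by move=> sD /sD/slicer_mem; apply. Qed.

End Comatrix.

Section SimpleComodule.
Variables (K : closedFieldType) (H : hopfType K).
Local Notation A := (conv H K^o).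
Implicit Types (f g : A) (x y : H) (D E M N : {vspace H}).

(** The matrix coefficients of the simple quotient M / N, in a basis s of a
    complement of N in M. The functionals f act on M / N by the matrices (f (c
    i j)), which form a transitive algebra; by Burnside's theorem they are all
    the matrices, so the coefficients are independent. *)
Lemma simple_coeff N M : ract_stable N -> ract_stable M -> (N <= M)%VS -> N != M ->
  (forall L, ract_stable L -> (N <= L)%VS -> (L <= M)%VS -> L = N \/ L = M) ->
  exists d (c : 'I_d -> 'I_d -> H), [/\ comatrix c,
    forall x f, x \in M -> (forall i j, f (c i j) = 0) -> ract x f \in N &
    forall i j, exists2 x, x \in M & exists f, c i j = lact f x].
Proof.
move=> sN sM NM neNM simp; pose d := \dim (M :\: N)%VS.
pose s : d.-tuple H := vbasis (M :\: N)%VS.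
pose pr := daddv_pi (M :\: N)%VS N.
have dMN : ((M :\: N) :&: N = 0)%VS := capv_diff M N.
have MN : (M :\: N + N)%VS = M by rewrite addv_diff; apply/addv_idPl.
have prN x : x \in N -> pr x = 0.
  move=> xN; have xMN : x \in (M :\: N + N)%VS by rewrite MN (subvP NM).
  have E := daddv_pi_add dMN xMN; apply/eqP.
  rewrite -memv0 -dMN memv_cap memv_pi -[pr x](addrK (daddv_pi N (M :\: N) x)) E.
  by rewrite memvB ?memv_pi.
have prM x : x \in M -> x - pr x \in N.
  rewrite -MN => xMN; rewrite -[X in X - _](daddv_pi_add dMN xMN) addrC addKr.
  exact: memv_pi.
pose l j : A := (linfun (coord s j : H -> K^o) \o pr)%VF.
have lE j x : l j x = coord s j (pr x) by rewrite comp_lfunE lfunE.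
have lN j x : x \in N -> l j x = 0 by move=> xN; rewrite lE prN ?linear0.
have prE x : pr x = \sum_j (l j x : K) *: s`_j.
  rewrite [LHS](coord_vbasis (memv_pi _ _ _)).
  by apply: eq_bigr => j _; rewrite lE.
have sD i : s`_(nat_of_ord (n := d) i) \in (M :\: N)%VS.
  by rewrite vbasis_mem // mem_nth // size_tuple.
have sMi i : s`_(nat_of_ord (n := d) i) \in M by rewrite (subvP (diffvSl M N)).
have ls i j : l j s`_(nat_of_ord (n := d) i) = (i == j)%:R.
  rewrite lE daddv_pi_id // coord_free ?(basis_free (vbasisP _)) //.
pose c i j := lact (l j) s`_(nat_of_ord (n := d) i).
have cE f i j : f (c i j) = l j (ract s`_(nat_of_ord i) f).
  by rewrite lactE ractE.
have decomp f i : exists2 n, n \in N &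
    ract s`_(nat_of_ord (n := d) i) f = \sum_k (f (c i k) : K) *: s`_k + n.
  exists (ract s`_i f - pr (ract s`_i f)); first by rewrite prM ?sM.
  rewrite addrC -[LHS](subrK (pr (ract s`_i f))); congr (_ + _).
  by rewrite prE; apply: eq_bigr => k _; rewrite cE.
have cM f g i j : (f * g) (c i j) = \sum_k f (c i k) * g (c k j) :> K^o.
  rewrite cE ractM; have [n nN ->] := decomp f i.
  rewrite -[ract _ g]/(ract_fun g _) linearD linear_sum /= linearD /=.
  rewrite [X in _ + X]lN ?addr0; last exact: sN.
  rewrite linear_sum; apply: eq_bigr => k _; rewrite linearZ /= linearZ /=.
  by rewrite (cE g k j).
exists d, c; split.
- have d_gt0 : (0 < d)%N.
    rewrite lt0n dimv_eq0; apply: contraNneq neNM => MN0.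
    by rewrite -MN MN0 add0v.
  split=> //.
    by move=> i j; rewrite -dual1 cE ract1 ls.
  have rL : linear (fun f : A => \matrix_(i < d, j < d) (f (c i j) : K)).
    by move=> k f g; apply/matrixP => i j; rewrite !mxE add_lfunE scale_lfunE.
  pose T := GRing.isLinear.Build K A 'M[K]_d _ _ rL.
  pose rho : {linear A -> 'M[K]_d} :=
    HB.pack (fun f : A => \matrix_(i < d, j < d) (f (c i j) : K)) T.
  have full : limg (linfun rho) = fullv.
    apply: burnside => // [_ _ /memv_imgP[f _ ->] /memv_imgP[g _ ->]|v w v0].
      apply/memv_imgP; exists (f * g); rewrite ?memvf // !lfunE.
      apply/matrixP => i j; rewrite [in RHS]mxE [in LHS]mxE cM.
      by apply: eq_bigr => k _; rewrite !mxE.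
    pose vec (u : 'rV[K]_d) := \sum_i u 0 i *: s`_(nat_of_ord i).
    have vecD u : vec u \in (M :\: N)%VS.
      by apply: memv_suml => i _; rewrite memvZ.
    have lvec u j : l j (vec u) = u 0 j.
      rewrite linear_sum (bigD1 j) //= linearZ /= ls eqxx big1 => [|k /negPf nk].
        by rewrite addr0; apply: mulr1.
      by rewrite linearZ /= ls nk; apply: mulr0.
    pose L := (N + (linfun (ract_at (vec v)) @: fullv))%VS.
    have memL y : y \in L -> exists2 n, n \in N & exists f, y = n + ract (vec v) f.
      case/memv_addP => n nN [_ /memv_imgP[f _ ->] ->]; exists n => //.
      by exists f; rewrite lfunE.
    have vL f : ract (vec v) f \in L.
      have -> : ract (vec v) f = linfun (ract_at (vec v)) f by rewrite lfunE.
      by apply: (subvP (addvSr _ _)); rewrite memv_img ?memvf.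
    have sL : ract_stable L.
      move=> y f /memL[n nN [g ->]].
      rewrite -[ract _ f]/(ract_fun f _) linearD /= memvD //.
        by rewrite (subvP (addvSl _ _)) //; apply: sN.
      by rewrite /ract_fun -ractM.
    have NL : (N <= L)%VS := addvSl _ _.
    have LM : (L <= M)%VS.
      rewrite subv_add NM; apply/subvP => _ /memv_imgP[f _ ->]; rewrite lfunE.
      by apply: sM; apply: (subvP (diffvSl M N)).
    have [LN|LM'] := simp L sL NL LM.
      have := vL 1; rewrite ract1 LN => vN; case/eqP: v0; apply/rowP => j.
      by rewrite mxE -lvec lN.
    have : vec w \in L by rewrite LM'; apply: (subvP (diffvSl M N)).
    case/memL => n nN [f wE]; exists (rho f).
      by apply/memv_imgP; exists f; rewrite ?memvf ?lfunE.
    apply/rowP => j; rewrite -(lvec w) wE linearD /= lN // add0r.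
    have -> : ract (vec v) f = \sum_i v 0 i *: ract s`_(nat_of_ord (n := d) i) f.
      rewrite -[LHS]/(ract_fun f (\sum_i v 0 i *: s`_(nat_of_ord i))).
      by rewrite (linear_sum (ract_fun f)); apply: eq_bigr => i _; rewrite linearZ.
    rewrite [LHS]mxE [RHS]linear_sum; apply: eq_bigr => k _.
    by rewrite linearZ mxE cE.
  move=> X; have : X \in limg (linfun rho) by rewrite full memvf.
  by case/memv_imgP => f _ ->; exists f => i j; rewrite lfunE mxE.
- move=> x f xM f0; rewrite -[x](subrK (pr x)).
  rewrite -[ract _ f]/(ract_fun f _) linearD /= memvD //; first exact/sN/prM.
  rewrite prE linear_sum memv_suml // => i _; rewrite linearZ memvZ //=.
  have [n nN E] := decomp f i; rewrite /ract_fun E big1 ?add0r // => k _.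
  by rewrite f0 scale0r.
- by move=> i j; exists s`_(nat_of_ord i); [exact: sMi | exists (l j)].
Qed.

(** The coefficients of a minimal nonzero right coideal of D span a
    subcoalgebra of D. *)
Lemma simple_subcoalgebraP D : simple_subcoalgebra D ->
  exists d (c : 'I_d -> 'I_d -> H), comatrix c /\ D = cospan c.
Proof.
case=> D0 sD simp.
have z_st : ract_stable (0%VS : {vspace H}).
  by move=> x f; rewrite !memv0 => /eqP ->; rewrite -[ract _ _]/(ract_fun f _) linear0.
have [||M [sM zM neM MD Msimp]] := exists_simple z_st (subcoalgebra_ract sD).
- exact: sub0v.
- by rewrite eq_sym.
have [d [c [cc _ cM]]] := simple_coeff z_st sM zM neM Msimp.
exists d, c; split=> //; symmetry.
have [||c0|//] := simp (cospan c).
- exact: cospan_subcoalgebra.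
- apply: cospan_sub => i j; have [x xM [f ->]] := cM i j.
  by apply: subcoalgebra_lact => //; apply: (subvP MD).
by have [] := cospan_simple cc; rewrite c0 eqxx.
Qed.
End SimpleComodule.

(** * The radical of the dual algebra and the coradical filtration *)

Section VectorSpaces.
Variable K : fieldType.

(** Functionals separate a vector from a subspace; all the dualities between H
    and H^* come from this. *)
Lemma separate (W : vectType K) (U : {vspace W}) (x : W) : x \notin U ->
  exists f : 'Hom(W, K^o), (forall y, y \in U -> f y = 0) /\ f x != 0.
Proof.
move=> xU; have : x - projv U x != 0.
  by apply: contraNneq xU => /eqP; rewrite subr_eq0 => /eqP ->; rewrite memv_proj.
set z := x - _ => z0.
have [i zi] : exists i, coord (vbasis {:W}) i z != 0.
  apply: contrapT => /forallNP nz; case/eqP: z0.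
  rewrite (coord_vbasis (memvf z)) big1 // => i _.
  by have /negP := nz i; rewrite negbK => /eqP ->; rewrite scale0r.
exists (linfun (coord (vbasis {:W}) i : W -> K^o) \o (\1 - projv U))%VF; split=> [y yU|].
  by rewrite comp_lfunE add_lfunE opp_lfunE id_lfunE projv_id // subrr linear0.
by rewrite comp_lfunE add_lfunE opp_lfunE id_lfunE lfunE.
Qed.

Lemma sumv_seq_sup (W : vectType K) (s : seq {vspace W}) U :
  U \in s -> (U <= \sum_(V <- s) V)%VS.
Proof. by move=> Us; rewrite (big_rem U) //= addvSl. Qed.

Lemma sumv_seq_sub (W : vectType K) (s : seq {vspace W}) S :
  (forall U, U \in s -> (U <= S)%VS) -> (\sum_(V <- s) V <= S)%VS.
Proof.
move=> sS; rewrite big_seq; elim/big_ind: _ => [|U V|//]; first exact: sub0v.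
by rewrite subv_add => -> ->.
Qed.

Lemma vsum_sub (W : vectType K) (P : {vspace W} -> Prop) (S : {vspace W}) :
  (forall U : {vspace W}, P U -> (U <= S)%VS) -> (vsum P <= S)%VS.
Proof.
move=> PS; apply/subvP => x /mem_vsum[s sP]; apply: subvP.
by apply: sumv_seq_sub => U /sP/PS.
Qed.

Lemma sub_vsum (W : vectType K) (P : {vspace W} -> Prop) (U : {vspace W}) :
  P U -> (U <= vsum P)%VS.
Proof.
move=> PU; apply/subvP => x xU; apply/mem_vsum; exists [:: U].
  by move=> V; rewrite inE => /eqP ->.
by rewrite big_cons big_nil addv0.
Qed.

Lemma vsum_finite (W : vectType K) (P : {vspace W} -> Prop) :
  exists2 s : seq {vspace W}, (forall U, U \in s -> P U) &
    vsum P = (\sum_(U <- s) U)%VS.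
Proof.
have ex (i : 'I_(\dim (vsum P))) : exists s : seq {vspace W},
    (forall U, U \in s -> P U) /\ (vbasis (vsum P))`_i \in (\sum_(U <- s) U)%VS.
  have : (vbasis (vsum P))`_i \in vsum P by rewrite vbasis_mem // mem_nth // size_tuple.
  by case/mem_vsum => s sP xs; exists s.
pose s i := projT1 (cid (ex i)).
have sP i : (forall U, U \in s i -> P U) /\
    (vbasis (vsum P))`_i \in (\sum_(U <- s i) U)%VS := projT2 (cid (ex i)).
pose s' := flatten [seq s i | i <- enum 'I_(\dim (vsum P))].
have s'P U : U \in s' -> P U.
  by case/flatten_mapP => i _ /(sP i).1.
exists s' => //; apply/eqP; rewrite eqEsubv; apply/andP; split; last first.
  by apply: sumv_seq_sub => U /s'P/sub_vsum.
apply/subvP => x /coord_vbasis ->; apply: memv_suml => i _; apply: memvZ.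
apply: (subvP _ _ (sP i).2).
apply: sumv_seq_sub => U Us; apply: sumv_seq_sup.
by apply/flatten_mapP; exists i; rewrite ?mem_enum.
Qed.
End VectorSpaces.

Section Annihilator.
Variables (K : fieldType) (H : hopfType K).
Local Notation A := (conv H K^o).
Implicit Types (f g : A) (x y : H) (U : {vspace H}) (V : {vspace A}).

Definition eval_at x f : K^o := f x.
Fact eval_at_linear x : linear (eval_at x).
Proof. by move=> k f g; rewrite /eval_at add_lfunE scale_lfunE. Qed.
HB.instance Definition _ x := GRing.isLinear.Build K A K^o _ (eval_at x) (eval_at_linear x).

Definition annih U : {vspace A} :=
  (\bigcap_(i < \dim U) lker (linfun (eval_at (vbasis U)`_i)))%VS.
Definition perp V : {vspace H} := (\bigcap_(i < \dim V) lker ((vbasis V)`_i : 'Hom(H, K^o)))%VS.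

Lemma annihP U f : reflect (forall x, x \in U -> f x = 0) (f \in annih U).
Proof.
apply: (iffP idP) => [/subv_bigcapP fU x xU|f0].
  rewrite (coord_vbasis xU) linear_sum big1 // => i _; rewrite linearZ /=.
  have /(_ i isT) := fU; rewrite -memvE memv_ker lfunE => /eqP.
  rewrite /= /eval_at => ->.
  exact: mulr0.
apply/subv_bigcapP => i _; rewrite -memvE memv_ker lfunE; apply/eqP/f0.
by rewrite vbasis_mem // mem_nth // size_tuple.
Qed.

Lemma perpP V x : reflect (forall f, f \in V -> f x = 0) (x \in perp V).
Proof.
apply: (iffP idP) => [/subv_bigcapP xV f fV|x0].
  rewrite (coord_vbasis fV) sum_lfunE big1 // => i _; rewrite scale_lfunE.
  have /(_ i isT) := xV; rewrite -memvE memv_ker => /eqP ->.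
  exact: mulr0.
apply/subv_bigcapP => i _; rewrite -memvE memv_ker; apply/eqP/x0.
by rewrite vbasis_mem // mem_nth // size_tuple.
Qed.

Lemma annihK U : perp (annih U) = U.
Proof.
apply/vspaceP => x; apply/perpP/idP => [x0|xU f /annihP]; last exact.
apply/negPn/negP => /separate[f [fU fx]]; case/eqP: fx; apply: x0.
exact/annihP.
Qed.

Lemma perpK V : annih (perp V) = V.
Proof.
apply/vspaceP => f; apply/annihP/idP => [f0|fV x /perpP]; last exact.
apply/negPn/negP => /separate[phi [phiV phif]]; case/eqP: phif.
pose x := \sum_i (phi (cobasis i) : K) *: (vbasis {:H})`_(nat_of_ord i).
have phiE g : phi g = g x.
  rewrite -{1}[g]cobasis_sum !linear_sum; apply: eq_bigr => i _.
  by rewrite !linearZ; apply: mulrC.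
by rewrite phiE f0 //; apply/perpP => g gV; rewrite -phiE phiV.
Qed.

End Annihilator.

Section Jacobson.
Variables (K : fieldType) (H : hopfType K).
Local Notation A := (conv H K^o).
Implicit Types (f g : A) (x y : H).

Lemma coradical_ract : ract_stable (coradical H).
Proof.
move=> x f; rewrite -[ract x f]/(ract_fun f x) -[ract_fun f x]lfunE memv_preim.
apply: subvP; apply: vsum_sub => D simpD; have [D0 sD _] := simpD; apply/subvP => y yD.
rewrite -memv_preim lfunE; apply: (subvP (sub_vsum simpD)); exact: subcoalgebra_ract.
Qed.

Lemma coradical_lact f x : x \in coradical H -> lact f x \in coradical H.
Proof.
rewrite -[lact f x]lfunE memv_preim.
apply: subvP; apply: vsum_sub => D simpD; have [D0 sD _] := simpD; apply/subvP => y yD.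
rewrite -memv_preim lfunE; apply: (subvP (sub_vsum simpD)); exact: subcoalgebra_lact.
Qed.

(** This is the Jacobson radical of H^*: it is nilpotent, and the quotient by
    it is the dual of the coradical. *)
Definition jac : {vspace A} := annih (coradical H).

Lemma jacP f : reflect (forall x, x \in coradical H -> f x = 0) (f \in jac).
Proof. exact: annihP. Qed.

Lemma jacMl f g : f \in jac -> g * f \in jac.
Proof.
move=> /jacP fJ; apply/jacP => x xC; rewrite -ractE fJ //; exact: coradical_ract.
Qed.

Lemma jacMr f g : f \in jac -> f * g \in jac.
Proof.
move=> /jacP fJ; apply/jacP => x xC; rewrite -lactE fJ //; exact: coradical_lact.
Qed.

(** Powers of jac, with jacn 0 the whole algebra, so that jacn n is an ideal
    for every n and annihilates C_(n-1) also when n = 0, with C_(-1) = 0. *)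
Fixpoint jacn n : {vspace A} := if n is m.+1 then (jac * jacn m)%VS else fullv.

Lemma jac_full : (fullv * jac = jac)%VS.
Proof.
apply/eqP; rewrite eqEsubv; apply/andP; split.
  by apply/prodvP => f g _; apply: jacMl.
by apply/subvP => f fJ; rewrite -[f]mul1r memv_mul ?memvf.
Qed.

Lemma full_full : (fullv * fullv = fullv :> {vspace A})%VS.
Proof.
by apply/eqP; rewrite eqEsubv subvf; apply/subvP => f _; rewrite -[f]mul1r memv_mul ?memvf.
Qed.

Lemma jacnD m n : (jacn m * jacn n)%VS = jacn (m + n).
Proof.
elim: m => [|m IH]; last by rewrite addSn /= -prodvA IH.
by case: n => [|n] /=; rewrite ?full_full // prodvA jac_full.
Qed.

Lemma jacn1 : jacn 1 = jac.
Proof.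
apply/eqP; rewrite eqEsubv /=; apply/andP; split.
  by apply/prodvP => f g fJ _; apply: jacMr.
by apply/subvP => f fJ; rewrite -[f]mulr1 memv_mul ?memvf.
Qed.

Lemma jacnMl n f g : f \in jacn n -> g * f \in jacn n.
Proof. by move=> fJ; rewrite -[n]add0n -jacnD memv_mul ?memvf. Qed.

Lemma jacnMr n f g : f \in jacn n -> f * g \in jacn n.
Proof. by move=> fJ; rewrite -[n]addn0 -jacnD memv_mul ?memvf. Qed.

Lemma jacnM m n f g : f \in jacn m -> g \in jacn n -> f * g \in jacn (m + n).
Proof. by move=> fm gn; rewrite -jacnD memv_mul. Qed.

Lemma jacnS m n : (m <= n)%N -> (jacn n <= jacn m)%VS.
Proof.
move=> /subnK <-; rewrite -jacnD; apply/prodvP => f g _; exact: jacnMl.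
Qed.

(** By induction: x lies in C_(n+1) if and only if x <- f lies in C_n for all
    f in J, and g(x <- f) = (f * g)(x). *)
Lemma filtrationE n : coradical_filtration H n = perp (jacn n.+1).
Proof.
elim: n => [|n IH]; first by rewrite jacn1 annihK.
apply/vspaceP => x; rewrite /= -memv_preim.
apply/idP/perpP => [xC|x0].
  have rx f : f \in jac -> ract x f \in coradical_filtration H n.
    move=> /jacP fJ; have /memv_addP[t t1 [u u1 E]] := xC.
    rewrite /ract E linearD /= memvD //; first exact: slicel_mem t1.
    have : slicel f u \in 0%VS.
      apply: tensv_ind u1 => a b aC _ /=.
      by rewrite slicelE fJ // scale0r mem0v.
    by rewrite memv0 => /eqP ->; apply: mem0v.
  move=> h hJ; have : (jacn n.+2 <= annih <[x]>)%VS.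
    apply/prodvP => f g fJ gJ; apply/annihP => _ /vlineP[k ->].
    rewrite linearZ /= -ractE; have := rx f fJ; rewrite IH => /perpP ->//.
    exact: mulr0.
  by move=> /subvP/(_ h hJ)/annihP; apply; apply: memv_line.
apply: (mem_tensv_sum (limg_proj _)) => [y|f f0]; first exact: projv_id.
rewrite -/(ract x f) IH; apply/perpP => g gJ; rewrite ractE; apply: x0.
by apply: memv_mul => //; apply/jacP.
Qed.

Lemma filtration_ract n : ract_stable (coradical_filtration H n).
Proof.
move=> x f; rewrite filtrationE => /perpP x0; apply/perpP => g gJ.
by rewrite ractE x0 // jacnMl.
Qed.

Lemma grouplikeP (g : H) :
  grouplike g <-> (forall f f' : A, (f * f') g = f g * f' g :> K) /\ counit g = 1.
Proof.
split=> [[Dg eg]|[gM eg]]; split=> //.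
  by move=> f f'; rewrite dualM Dg tliftP //; apply: lfun_mul_bilinear.
apply: tensor_eqP => f f'; rewrite -[LHS](dualM f f') gM.
by rewrite tliftP //; apply: lfun_mul_bilinear.
Qed.

Lemma grouplike_neq0 (g : H) : grouplike g -> g != 0.
Proof.
by case=> _ eg; apply: contra_eq_neq eg => ->; rewrite linear0 eq_sym oner_neq0.
Qed.

Lemma lact_grouplike (g : H) f : grouplike g -> lact f g = (f g : K) *: g.
Proof.
move=> /grouplikeP[gM _]; apply: dual_sep => h; rewrite lactE gM linearZ.
exact: mulrC.
Qed.

Lemma grouplike_simple (g : H) : grouplike g -> simple_subcoalgebra <[g]>%VS.
Proof.
move=> gg; have g0 := grouplike_neq0 gg; split.
- by rewrite -dimv_eq0 dim_vline g0.
- move=> _ /vlineP[k ->]; rewrite linearZ memvZ //= (proj1 gg).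
  by rewrite memv_tens ?memv_line.
move=> E _ Eg; have [->|E0] := eqVneq E 0%VS; [by left | right].
apply/eqP; rewrite eqEdim Eg dim_vline g0 lt0n dimv_eq0 //.
Qed.

Lemma simple_dim1 (D : {vspace H}) : simple_subcoalgebra D -> \dim D = 1%N ->
  exists2 g, grouplike g & D = <[g]>%VS.
Proof.
case=> D0 sD _ dD; have x0 : vpick D != 0 by rewrite vpick0.
have Dx : D = <[vpick D]>%VS.
  apply/eqP; rewrite eq_sym eqEdim dim_vline x0 dD leqnn andbT.
  by rewrite -memvE memv_pick.
set x := vpick D in x0 Dx.
have xD : x \in D by apply: memv_pick.
have rx f : exists k : K, ract x f = k *: x.
  by apply/vlineP; rewrite -Dx; apply: subcoalgebra_ract.
have ex : counit x != 0.
  have [k Ek] : exists k, forall f : A, f x = counit x * k f.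
    pose k f := projT1 (cid (rx f)).
    have kE f : ract x f = k f *: x := projT2 (cid (rx f)).
    exists k => f; rewrite -[f in LHS]mulr1 -ractE kE linearZ /= dual1.
    exact: mulrC.
  apply: contraNneq x0 => ex; apply/eqP/dual_sep => f.
  by rewrite Ek ex mul0r linear0.
pose g := (counit x)^-1 *: x : H.
have eg : counit g = 1 by rewrite linearZ; apply: mulVf.
exists g; last first.
  rewrite Dx; apply/eqP; rewrite eq_sym eqEdim -memvE memvZ ?memv_line //=.
  by rewrite !dim_vline scaler_eq0 invr_eq0 (negPf ex) (negPf x0).
apply/grouplikeP; split=> // f f'.
have [k kE] : exists k : K, ract g f = k *: g.
  have [k kx] := rx f; exists k; rewrite /g -[ract _ f]/(ract_fun f _) linearZ /=.
  by rewrite /ract_fun kx scalerA mulrC -scalerA.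
rewrite -ractE kE linearZ /=; congr (_ * _).
by rewrite -[f in RHS]mulr1 -ractE kE linearZ /= dual1 eg; rewrite [RHS]mulr1.
Qed.
End Jacobson.

Section Nilpotent.
Variables (K : closedFieldType) (H : hopfType K).
Local Notation A := (conv H K^o).

(** If C_n is not all of H, take a simple subquotient M / C_n. Its matrix
    coefficients span a simple subcoalgebra, so J kills it, and M is contained
    in C_(n+1). *)
Lemma jacn_strict n : jacn H n.+1 != 0%VS -> jacn H n.+2 != jacn H n.+1.
Proof.
apply: contraNneq => E; rewrite -(perpK (jacn H n.+1)).
pose N := perp (jacn H n.+1).
have NE : N = coradical_filtration H n by rewrite filtrationE.
suff -> : perp (jacn H n.+1) = fullv.
  rewrite -subv0; apply/subvP => f /annihP f0; rewrite memv0; apply/eqP/lfunP => x.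
  by rewrite f0 ?memvf // zero_lfunE.
apply/eqP/negPn/negP => Nf.
have sN : ract_stable N by rewrite NE; apply: filtration_ract.
have fs : ract_stable (fullv : {vspace H}) by move=> ? ? _; apply: memvf.
have [M [sM NM neNM _ simp]] := exists_simple sN fs (subvf _) Nf.
have [d [c [cc cN _]]] := simple_coeff sN sM NM neNM simp.
have MC : (M <= N)%VS.
  rewrite {1}/N -E; apply/subvP => x xM; apply/perpP => h hJ.
  have : (jacn H n.+2 <= annih <[x]>)%VS.
    apply/prodvP => f g /jacP fJ gJ; apply/annihP => _ /vlineP[k ->].
    rewrite linearZ /= -ractE; have : ract x f \in N.
      apply: cN => // i j; apply: fJ; apply: (subvP (sub_vsum (cospan_simple cc))).
      exact: mem_cospan.
    by move=> /perpP ->//; exact: mulr0.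
  by move=> /subvP/(_ h hJ)/annihP; apply; apply: memv_line.
by case/eqP: neNM; apply/eqP; rewrite eqEsubv NM MC.
Qed.

Theorem jac_nilpotent : exists n, jacn H n = 0%VS.
Proof.
have bound n : jacn H n.+1 = 0%VS \/ (\dim (jacn H n.+1) + n <= \dim (jacn H 1))%N.
  elim: n => [|n [IH|IH]]; first by right; rewrite addn0.
    by left; apply/eqP; rewrite -subv0 -IH jacnS.
  have [E|J0] := eqVneq (jacn H n.+1) 0%VS.
    by left; apply/eqP; rewrite -subv0 -E jacnS.
  right; rewrite addnS -addSn; apply: leq_trans IH; rewrite leq_add2r.
  rewrite ltn_neqAle dimvS ?jacnS // andbT.
  apply: contraNneq (jacn_strict J0) => dE.
  by rewrite eqEdim jacnS //= dE.
have [E|] := bound (\dim (jacn H 1)).+1; first by exists (\dim (jacn H 1)).+2.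
by rewrite addnS ltnNge leq_addl.
Qed.
End Nilpotent.

(** * Idempotents attached to the simple subcoalgebras *)

Lemma daddv_pi_ker (K : fieldType) (W : vectType K) (U V : {vspace W}) x :
  (U :&: V = 0)%VS -> x \in V -> daddv_pi U V x = 0.
Proof.
move=> UV xV; have xUV : x \in (U + V)%VS by rewrite (subvP (addvSr U V)).
have E := daddv_pi_add UV xUV; apply/eqP.
rewrite -memv0 -UV memv_cap memv_pi -[daddv_pi U V x](addrK (daddv_pi V U x)) E.
by rewrite memvB ?memv_pi.
Qed.

Section Simples.
Variables (K : closedFieldType) (H : hopfType K).
Local Notation A := (conv H K^o).
Implicit Types (f g : A) (x y : H) (D E F U : {vspace H}).

(** The annihilator of D is a prime ideal: from f killing E and g killing F,
    neither of them zero on D, matrix units of D produce a product f * h * g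
    that kills E + F but not D. *)
Lemma simple_prime D E F : simple_subcoalgebra D ->
  subcoalgebra E -> subcoalgebra F -> (D <= E + F)%VS -> (D <= E)%VS \/ (D <= F)%VS.
Proof.
move=> /simple_subcoalgebraP[d [c [cc ->]]] sE sF DEF.
apply: contrapT => /not_orP[nE nF].
have nsub (G : {vspace H}) : ~ (cospan c <= G)%VS ->
    exists f : A, exists i j, (forall x, x \in G -> f x = 0) /\ f (c i j) != 0.
  move=> nG; have [i [j cG]] : exists i j, c i j \notin G.
    apply: contrapT => /forallNP all; apply: nG; apply: cospan_sub => i j.
    by have /forallNP/(_ j)/negP := all i; rewrite negbK.
  by have [f [fG fc]] := separate cG; exists f, i, j.
have [f [i [j [fE fc]]]] := nsub E nE.
have [g [k [l [gF gc]]]] := nsub F nF.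
have [h hE] := comatrix_dual cc (delta_mx j k).
have : (f * h * g) (c i l) = 0.
  have [x xE [y yF ->]] := memv_addP (subvP DEF _ (mem_cospan c i l)).
  rewrite linearD /=.
  have -> : (f * h * g) x = 0.
    by rewrite -mulrA -lactE fE //; apply: subcoalgebra_lact.
  by rewrite -ractE gF ?addr0 //; apply: subcoalgebra_ract.
rewrite (comatrixM cc) (bigD1 k) //= big1 => [|b /negPf nb]; last first.
  rewrite (comatrixM cc) big1 ?mul0r // => a _.
  by rewrite hE mxE nb andbF mulr0.
rewrite addr0 (comatrixM cc) (bigD1 j) //= big1 => [|a /negPf na]; last first.
  by rewrite hE mxE na mulr0.
rewrite addr0 hE mxE !eqxx mulr1 => /eqP; rewrite mulf_eq0.
by rewrite (negPf fc) (negPf gc).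
Qed.

Lemma addv_subcoalgebra E F :
  subcoalgebra E -> subcoalgebra F -> subcoalgebra (E + F)%VS.
Proof.
move=> sE sF _ /memv_addP[x /sE xE [y /sF yF ->]]; rewrite linearD memvD //=.
  apply: subvP xE; apply/span_subvP => _ /allpairsP[[a b] [aE bE ->]] /=.
  by rewrite memv_tens // (subvP (addvSl E F)) // vbasis_mem.
apply: subvP yF; apply/span_subvP => _ /allpairsP[[a b] [aE bE ->]] /=.
by rewrite memv_tens // (subvP (addvSr E F)) // vbasis_mem.
Qed.

Lemma zero_subcoalgebra : subcoalgebra (0%VS : {vspace H}).
Proof. by move=> x; rewrite memv0 => /eqP ->; rewrite linear0 mem0v. Qed.

Lemma sum_subcoalgebra (s : seq {vspace H}) :
  (forall U, U \in s -> subcoalgebra U) -> subcoalgebra (\sum_(U <- s) U)%VS.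
Proof.
elim: s => [|U s IH] sP; first by rewrite big_nil; apply: zero_subcoalgebra.
rewrite big_cons; apply: addv_subcoalgebra; first by apply: sP; rewrite mem_head.
by apply: IH => V Vs; apply: sP; rewrite inE Vs orbT.
Qed.

Lemma simple_mem D (s : seq {vspace H}) : simple_subcoalgebra D ->
  (forall U, U \in s -> simple_subcoalgebra U) -> (D <= \sum_(U <- s) U)%VS ->
  D \in s.
Proof.
move=> sD; elim: s => [|U s IH] sP.
  by rewrite big_nil subv0; case: sD => /negPf ->.
have sU : simple_subcoalgebra U by apply: sP; rewrite mem_head.
have sP' V : V \in s -> simple_subcoalgebra V by move=> Vs; apply: sP; rewrite inE Vs orbT.
rewrite big_cons => /(simple_prime sD)[||DU|Ds].
- by case: sU.
- by apply: sum_subcoalgebra => V /sP'[].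
- rewrite inE; apply/orP; left; apply/eqP.
  by case: sU => _ _ /(_ D) []//; case: sD => // /eqP.
by rewrite inE IH ?orbT.
Qed.

Lemma simples_exist : exists s : seq {vspace H}, [/\ uniq s,
  forall U, U \in s <-> simple_subcoalgebra U & coradical H = (\sum_(U <- s) U)%VS].
Proof.
have [s sP sE] := vsum_finite (@simple_subcoalgebra K H).
have E : coradical H = (\sum_(U <- undup s) U)%VS.
  rewrite /coradical sE; apply/eqP; rewrite eqEsubv; apply/andP.
  by split; apply: sumv_seq_sub => U Us; apply: sumv_seq_sup; rewrite mem_undup in Us *.
exists (undup s); split=> //; first exact: undup_uniq.
move=> U; split=> [|sU]; first by rewrite mem_undup; apply: sP.
apply: simple_mem => // [V|]; first by rewrite mem_undup; apply: sP.
by rewrite -E; apply: sub_vsum.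
Qed.

Definition simples : seq {vspace H} := projT1 (cid simples_exist).
Lemma simples_uniq : uniq simples.
Proof. by rewrite /simples; case: cid => s []. Qed.
Lemma simplesP U : U \in simples <-> simple_subcoalgebra U.
Proof. by rewrite /simples; case: cid => s []. Qed.
Definition other_simples D := (\sum_(U <- rem D simples) U)%VS.

Lemma simple_other D : simple_subcoalgebra D -> (D :&: other_simples D = 0)%VS.
Proof.
move=> sD; have [d [c [cc Dc]]] := simple_subcoalgebraP sD.
have sO : subcoalgebra (other_simples D).
  by apply: sum_subcoalgebra => U /mem_rem/simplesP[].
have sD' : subcoalgebra D by case: sD.
have := @cospan_bistable _ _ _ _ cc (D :&: other_simples D)%VS.
case=> [f x|f x|||DO] //.
- by rewrite !memv_cap => /andP[xD xO]; rewrite !subcoalgebra_lact.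
- rewrite !memv_cap => /andP[xD xO].
  by rewrite (subcoalgebra_ract sD') ?(subcoalgebra_ract sO).
- by rewrite -Dc capvSl.
have : D \in rem D simples.
  apply: simple_mem => // [U /mem_rem/simplesP //|].
  by rewrite [X in (X <= _)%VS]Dc -DO capvSr.
by rewrite (mem_rem_uniq _ simples_uniq) inE eqxx.
Qed.

Section Projection.
Variables (p : 'End(H)).
Hypothesis pP : coalgebra_projection p.

(** As p is a coalgebra projection onto C_0, the maps f o p form a subalgebra
    of H^* that is isomorphic to the dual of C_0 and complementary to J. *)
Definition pull f : A := (f \o p)%VF.
Lemma pullE f x : pull f x = f (p x). Proof. by rewrite comp_lfunE. Qed.

Lemma proj_coradical x : p x \in coradical H.
Proof. by case: pP => <- _ _ _; apply: memv_img; apply: memvf. Qed.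

Lemma proj_id x : x \in coradical H -> p x = x.
Proof. by case: pP => _ + _ _; apply. Qed.

Lemma pull_coradical f x : x \in coradical H -> pull f x = f x.
Proof. by move=> xC; rewrite pullE proj_id. Qed.

Lemma pullM f g : pull (f * g) = pull f * pull g.
Proof.
apply/lfunP => x; rewrite pullE !dualM; case: pP => _ _ -> _.
rewrite /tmap tlift_tlift; apply: eq_tlift => a b.
by rewrite tliftP ?pullE //; apply: lfun_mul_bilinear.
Qed.

Lemma pull1 : pull 1 = 1.
Proof. by apply/lfunP => x; rewrite pullE !dual1; case: pP. Qed.

Lemma pullK f : pull (pull f) = pull f.
Proof. by apply/lfunP => x; rewrite !pullE (proj_id (proj_coradical x)). Qed.

Lemma pullB_jac f : f - pull f \in jac H.
Proof.
apply/jacP => x xC; rewrite add_lfunE opp_lfunE pull_coradical //; exact: subrr.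
Qed.

(** A functional of the form f o p is determined by its restriction to the
    coradical, that is, to the simple subcoalgebras. *)
Lemma pull_ext f g : pull f = f -> pull g = g ->
  (forall U x, simple_subcoalgebra U -> x \in U -> f x = g x) -> f = g.
Proof.
move=> ff gg fg; rewrite -ff -gg; apply/lfunP => x; rewrite !pullE.
apply/eqP; rewrite -subr_eq0 -opp_lfunE -add_lfunE -memv_ker.
apply: subvP (proj_coradical x); apply: vsum_sub => U sU; apply/subvP => y yU.
by rewrite memv_ker add_lfunE opp_lfunE (fg U y) // subrr.
Qed.

Lemma exists_idem D : simple_subcoalgebra D -> exists e : A, [/\ pull e = e,
  forall x, x \in D -> e x = counit x &
  forall U x, simple_subcoalgebra U -> U != D -> x \in U -> e x = 0].
Proof.
move=> sD; exists (pull ((1 : A) \o daddv_pi D (other_simples D))%VF).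
have DC : (D <= coradical H)%VS := sub_vsum sD.
split=> [|x xD|U x sU UD xU]; first exact: pullK.
  rewrite pull_coradical ?(subvP DC) // comp_lfunE daddv_pi_id ?dual1 //.
  exact: simple_other.
rewrite pull_coradical ?(subvP (sub_vsum sU)) // comp_lfunE.
rewrite daddv_pi_ker ?linear0 //; first exact: simple_other.
have Ur : U \in rem D simples.
  by rewrite (mem_rem_uniq _ simples_uniq) inE UD; apply/simplesP.
by apply: subvP xU; apply: sumv_seq_sup.
Qed.

(** Total in D, with the value 0 when D is not simple. *)
Definition idem D : A :=
  if pselect (simple_subcoalgebra D) is left sD
  then projT1 (cid (exists_idem sD)) else 0.

Lemma idemP D : simple_subcoalgebra D -> [/\ pull (idem D) = idem D,
  forall x, x \in D -> idem D x = counit x &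
  forall U x, simple_subcoalgebra U -> U != D -> x \in U -> idem D x = 0].
Proof. by rewrite /idem; case: pselect => // sD _; case: cid. Qed.

Lemma idem_lE D U f x : simple_subcoalgebra D -> simple_subcoalgebra U ->
  x \in U -> (idem D * f) x = if U == D then f x else 0.
Proof.
move=> sD sU xU; have [_ e1 e0] := idemP sD; have sU' : subcoalgebra U by case: sU.
rewrite -ractE; have [UD|UD] := eqVneq U D.
  congr (f _); apply: dual_sep => h; rewrite ractE -lactE e1 -?UD ?subcoalgebra_lact //.
  by rewrite -dual1 lactE mul1r.
suff -> : ract x (idem D) = 0 by rewrite linear0.
apply: dual_sep => h; rewrite ractE -lactE linear0 (e0 U) //.
exact: subcoalgebra_lact.
Qed.

Lemma idem_rE D U f x : simple_subcoalgebra D -> simple_subcoalgebra U ->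
  x \in U -> (f * idem D) x = if U == D then f x else 0.
Proof.
move=> sD sU xU; have [_ e1 e0] := idemP sD; have sU' : subcoalgebra U by case: sU.
rewrite -lactE; have [UD|UD] := eqVneq U D.
  congr (f _); apply: dual_sep => h; rewrite lactE -ractE e1; last first.
    by rewrite -UD; apply: subcoalgebra_ract.
  by rewrite -dual1 ractE mulr1.
suff -> : lact (idem D) x = 0 by rewrite linear0.
apply: dual_sep => h; rewrite lactE -ractE linear0 (e0 U) //.
exact: subcoalgebra_ract.
Qed.

Lemma pull_idem D : simple_subcoalgebra D -> pull (idem D) = idem D.
Proof. by case/idemP. Qed.

Lemma idem_central D f : simple_subcoalgebra D -> pull f = f ->
  idem D * f = f * idem D.
Proof.
move=> sD ff; apply: pull_ext => [||U x sU xU].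
- by rewrite pullM ff pull_idem.
- by rewrite pullM ff pull_idem.
by rewrite (idem_lE _ sD sU xU) (idem_rE _ sD sU xU).
Qed.

Lemma idemM D E : simple_subcoalgebra D -> simple_subcoalgebra E ->
  idem D * idem E = if D == E then idem D else 0.
Proof.
move=> sD sE; apply: pull_ext => [||U x sU xU].
- by rewrite pullM !pull_idem.
- case: ifP => _; first exact: pull_idem.
  by apply/lfunP => x; rewrite pullE !zero_lfunE.
rewrite (idem_lE _ sD sU xU); have [<-|UD] := eqVneq U D.
  have [<-//|UE] := eqVneq U E.
  by rewrite zero_lfunE; case: (idemP sE) => _ _ /(_ U x) ->.
have [_ _ e0] := idemP sD.
by case: ifP => _; rewrite ?zero_lfunE // (e0 U).
Qed.

Lemma sum_idem : \sum_(D <- simples) idem D = 1.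
Proof.
apply: pull_ext => [||U x sU xU].
- apply/lfunP => x; rewrite pullE !sum_lfunE big_seq [RHS]big_seq.
  by apply: eq_bigr => D /simplesP sD; rewrite -pullE pull_idem.
- exact: pull1.
have Us : U \in simples by apply/simplesP.
rewrite sum_lfunE (bigD1_seq U) ?simples_uniq //= big1_seq => [|D /andP[DU]].
  by rewrite addr0 dual1; case: (idemP sU) => _ ->.
by move/simplesP => /idemP[_ _ /(_ U x) ->//]; rewrite eq_sym.
Qed.

Local Notation eg g := (idem <[g]>%VS).

(** The block of g in the dual of C_0 is one-dimensional: f acts on e_g as the
    scalar f(g), up to a term in J. *)
Lemma idem_grouplike (g : H) f : grouplike g ->
  eg g * f = (f g : K) *: eg g + eg g * (f - pull f).
Proof.
move=> gg; have sg := grouplike_simple gg.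
rewrite mulrBr addrCA -[LHS]addr0; congr (_ + _).
apply/esym/eqP; rewrite subr_eq0; apply/eqP; apply: pull_ext => [||U x sU xU].
- by apply/lfunP => x; rewrite pullE !scale_lfunE -pullE pull_idem.
- by rewrite pullM pullK pull_idem.
rewrite (idem_lE _ sg sU xU) scale_lfunE; have [Ug|Ug] := eqVneq U _.
  have [_ e1 _] := idemP sg; rewrite Ug in xU *.
  have xC : x \in coradical H by apply: (subvP (sub_vsum sg)).
  rewrite e1 // pull_coradical //; case/vlineP: xU => k ->.
  rewrite !linearZ /=; have [_ ->] := gg.
  by rewrite /GRing.scale /= mulr1 mulrC.
have [_ _ e0] := idemP sg; rewrite (e0 U) //; exact: mulr0.
Qed.

Lemma idem_at (g h : H) : grouplike g -> grouplike h -> eg g h = (g == h)%:R.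
Proof.
move=> gg gh; have [_ e1 e0] := idemP (grouplike_simple gg).
have [<-|gh'] := eqVneq g h; first by rewrite e1 ?memv_line; case: gg.
rewrite (e0 <[h]>%VS) ?memv_line //; first exact: grouplike_simple.
apply: contraNneq gh' => E; have : h \in <[g]>%VS by rewrite -E memv_line.
case/vlineP => k hk; have := congr1 counit hk; rewrite linearZ /=.
rewrite (proj2 gh) (proj2 gg) /GRing.scale /= mulr1 => k1.
by rewrite hk -k1 scale1r.
Qed.
End Projection.
End Simples.

(** * Group-like integrals *)

Section Frobenius.
Variables (K : closedFieldType) (H : hopfType K) (p : 'End(H)).
Hypothesis pP : coalgebra_projection p.
Variable t : H.
Local Notation A := (conv H K^o).
Hypothesis t_faithful : forall f : A, lact f t = 0 -> f = 0.
Implicit Types (f y z : A) (g : H).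
Local Notation eg g := (idem pP <[g]>%VS).
Local Notation J := (jac H).

(** Injectivity and equality of dimensions. *)
Lemma lact_onto x : exists f : A, lact f t = x.
Proof.
have full : limg (linfun (lact_fun t)) = fullv.
  apply/eqP; rewrite eqEdim subvf /= limg_dim_eq.
    by rewrite !dimvf /= /dim /= muln1.
  apply/eqP; rewrite capfv -subv0; apply/subvP => f.
  by rewrite memv_ker lfunE memv0 => /eqP/t_faithful ->.
have : x \in limg (linfun (lact_fun t)) by rewrite full memvf.
by case/memv_imgP => f _ ->; exists f; rewrite lfunE.
Qed.

Lemma lact_t_inj f f' : lact f t = lact f' t -> f = f'.
Proof.
move=> E; apply/eqP; rewrite -subr_eq0; apply/eqP/t_faithful.
by rewrite -[LHS]/(lact_fun t _) linearB /= /lact_fun E subrr.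
Qed.

(** The g-integral: since z -> g = z(g) g, the equation f -> t = g means that
    f satisfies z * f = z(g) f for all z, and that it is normalized. *)
Definition gint g : A := projT1 (cid (lact_onto g)).
Lemma gintE g : lact (gint g) t = g.
Proof. exact: projT2 (cid (lact_onto g)). Qed.

Lemma gint_neq0 g : grouplike g -> gint g != 0.
Proof.
move=> gg; apply: contraNneq (grouplike_neq0 gg) => E.
by rewrite -[g]gintE E lact0.
Qed.

Lemma gint_left g z : grouplike g -> z * gint g = (z g : K) *: gint g.
Proof.
move=> gg; apply: lact_t_inj; rewrite lactM lactZ gintE; exact: lact_grouplike.
Qed.

Lemma gint_uniq g f : (forall z, z * f = (z g : K) *: f) ->
  exists k : K, f = k *: gint g.
Proof.
move=> fg; exists (counit (lact f t)); apply: lact_t_inj.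
rewrite lactZ gintE; apply: dual_sep => z.
by rewrite lactE -[z in LHS]mul1r linearZ -mulrA fg -scalerAr mul1r scale_lfunE -dual1 lactE mul1r; apply: mulrC.
Qed.

Lemma idem_idem D f : simple_subcoalgebra D -> idem pP D * (idem pP D * f) = idem pP D * f.
Proof. by move=> sD; rewrite mulrA idemM // eqxx. Qed.

(** Every nonzero right ideal inside e_g H^* contains the g-integral. Indeed f
    -> H is a nonzero subspace of H stable under <- and fixed by e_g;
    multiplying one of its elements by suitable elements of J gives a nonzero
    element of the coradical fixed by e_g, that is, a multiple of g. So g = f
    -> x = f -> (y -> t) for some y. *)
Lemma gint_in g f : grouplike g -> f != 0 -> eg g * f = f ->
  exists y, f * y = gint g.
Proof.
move=> gg f0 ef; have sg := grouplike_simple gg.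
have [u [u0 uC [x ux]]] : exists u : H, [/\ u != 0, u \in coradical H &
    exists x, u = lact f x].
  have ft0 : lact f t != 0 by apply: contraNneq f0 => /t_faithful ->.
  have ex : exists n, `[< forall h : A, h \in jacn H n -> ract (lact f t) h = 0 >].
    have [n n0] := jac_nilpotent H; exists n; apply/asboolP => h.
    by rewrite n0 memv0 => /eqP ->; rewrite ract0.
  case: (ex_minnP ex) => -[|n] /asboolP n0 nmin.
    by case/eqP: ft0; rewrite -[LHS]ract1 n0 // memvf.
  have : ~ (forall h : A, h \in jacn H n -> ract (lact f t) h = 0).
    by move=> /asboolP/nmin; rewrite ltnn.
  move=> /existsNP[h /not_implyP[hJ /eqP u0]].
  exists (ract (lact f t) h); split=> //; last by exists (ract t h); rewrite lract.
  rewrite -[coradical H]annihK; apply/perpP => j jJ.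
  rewrite -[j]mulr1 -ractE -ractM n0 ?linear0 //.
  have : h * j \in jacn H (n + 1) by apply: jacnM; rewrite ?jacn1.
  by rewrite addn1.
have ug : u = (eg g u : K) *: g.
  apply: dual_sep => z; rewrite linearZ /=.
  have eu : lact (eg g) u = u by rewrite ux -lactM ef.
  rewrite -{1}eu lactE; transitivity ((pull p z * eg g) u).
    have /eqP := mulrBl (eg g) z (pull p z); rewrite eq_sym subr_eq => /eqP ->.
    rewrite add_lfunE; have /jacP -> // : (z - pull p z) * eg g \in J.
      by apply: jacMr; apply: pullB_jac.
    by rewrite add0r.
  rewrite -(idem_central pP sg) ?pullK // (idem_grouplike pP _ gg) (pullK pP) subrr mulr0 addr0.
  by rewrite scale_lfunE pull_coradical ?(subvP (sub_vsum sg)) ?memv_line; [exact: mulrC|..].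
have eu0 : eg g u != 0 by apply: contraNneq u0 => E; rewrite ug E scale0r.
have [y yE] := lact_onto ((eg g u : K)^-1 *: x).
exists y; apply: lact_t_inj; rewrite lactM yE linearZ /= -ux gintE.
by rewrite {2}ug scalerA mulVf ?scale1r.
Qed.

(** The space of g-integrals is a line stable under right multiplication. The
    resulting character of H^* is evaluation at a group-like element. *)
Lemma gint_char g : grouplike g ->
  exists2 a, grouplike a & forall y, gint g * y = (y a : K) *: gint g.
Proof.
move=> gg; have ch y : exists k : K, gint g * y = k *: gint g.
  by apply: gint_uniq => z; rewrite mulrA gint_left // scalerAl.
pose chi y : K := projT1 (cid (ch y)).
have chiE y : gint g * y = chi y *: gint g := projT2 (cid (ch y)).
have chi_eq y k : gint g * y = k *: gint g -> chi y = k.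
  rewrite chiE => /eqP; rewrite -subr_eq0 -scalerBl scaler_eq0.
  by rewrite (negPf (gint_neq0 gg)) orbF subr_eq0 => /eqP.
have chiL : linear (chi : A -> K^o).
  move=> k y z; apply: chi_eq; rewrite mulrDr -scalerAr !chiE scalerA.
  by rewrite scalerDl.
pose T := GRing.isLinear.Build K A K^o _ _ chiL.
pose X : {linear A -> K^o} := HB.pack (chi : A -> K^o) T.
pose a := \sum_i (chi (cobasis i) : K) *: (vbasis {:H})`_(nat_of_ord i).
have aE y : y a = chi y.
  rewrite -[RHS]/(X y) -{2}[y]cobasis_sum !linear_sum.
  by apply: eq_bigr => i _; rewrite !linearZ; apply: mulrC.
exists a; last by move=> y; rewrite aE chiE.
apply/grouplikeP; split=> [y z|].
  rewrite !aE; apply: chi_eq.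
  by rewrite mulrA chiE -scalerAl chiE scalerA.
by rewrite -dual1 aE; apply: chi_eq; rewrite mulr1 scale1r.
Qed.

(** The elements of e_g H^* killed by J on the right form the socle of that
    right ideal, which is the line of g-integrals: for D other than the line
    of the group-like a of gint_char, f * e_D must vanish, since otherwise
    gint g = gint g * e_a would be of the form f * e_D * y * e_a = 0. *)
Lemma gint_socle g f : grouplike g -> eg g * f = f ->
  (forall j, j \in J -> f * j = 0) -> exists k : K, f = k *: gint g.
Proof.
move=> gg ef fJ; have [a ga ch] := gint_char gg; have sa := grouplike_simple ga.
have [->|f0] := eqVneq f 0; first by exists 0; rewrite scale0r.
have fz z : f * z = f * pull p z.
  by rewrite -[z in LHS](subrK (pull p z)) mulrDr fJ ?add0r // pullB_jac.
have fD D : simple_subcoalgebra D -> D != <[a]>%VS -> f * idem pP D = 0.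
  move=> sD Da; apply/eqP/negPn/negP => fD0.
  have [y yE] := gint_in gg fD0 (etrans (mulrA _ _ _) (congr1 (fun u => u * _) ef)).
  case/eqP: (gint_neq0 gg); transitivity (gint g * eg a).
    by rewrite ch idem_at // eqxx scale1r.
  rewrite -yE -!mulrA fz !(pullM pP) !(pull_idem pP) //.
  rewrite -(idem_central pP sa) ?(pullK pP) // (mulrA (idem pP D)).
  by rewrite idemM // (negPf Da) mul0r mulr0.
have fa : f * eg a = f.
  rewrite -[RHS]mulr1 -(sum_idem pP) mulr_sumr (bigD1_seq <[a]>%VS) ?simples_uniq //=.
    by rewrite big1_seq ?addr0 // => D /andP[Da /simplesP sD]; apply: fD.
  exact/simplesP.
have [y yE] := gint_in gg f0 ef.
have ygf : gint g = (y a : K) *: f.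
  rewrite -yE -{1}fa -mulrA (idem_grouplike pP _ ga) mulrDr -scalerAr fa.
  by rewrite fJ ?addr0 // jacMl // pullB_jac.
have ya : (y a : K) != 0.
  by apply: contraNneq (gint_neq0 gg) => ya; rewrite ygf ya scale0r.
by exists (y a)^-1; rewrite ygf scalerA mulVf // scale1r.
Qed.

Lemma translM g f f' : grouplike g -> transl (f * f') g = transl f g * transl f' g.
Proof.
move=> gg; apply/lfunP => x; rewrite translE !dualM sweedlerM; last first.
  exact: lfun_mul_bilinear.
rewrite (proj1 gg) tliftP; last first.
  split=> [u|u] k v w; rewrite -tlift_comb; apply: eq_tlift => a b.
    by rewrite mulrDl -scalerAl linearP mulrDr scalerAr.
  by rewrite mulrDl -scalerAl linearP mulrDl scalerAl.
by apply: eq_tlift => a b; rewrite !translE.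
Qed.

Lemma transl_transl f g g' : transl (transl f g) g' = transl f (g * g').
Proof. by apply/lfunP => x; rewrite !translE mulrA. Qed.

Lemma transl_1 f : transl f 1 = f.
Proof. by apply/lfunP => x; rewrite translE mul1r. Qed.

Lemma grouplike1 : grouplike (1 : H).
Proof. by split; [exact: comul1 | exact: counit1]. Qed.

Lemma grouplikeV g : grouplike g ->
  [/\ grouplike (antipode g), antipode g * g = 1 & g * antipode g = 1].
Proof.
move=> [Dg eg]; have mb : bilinear_op (fun u v : H => u * v) by apply: mul_bilinear.
have Sg : antipode g * g = 1.
  have := antipodel g; rewrite Dg eg scale1r tliftP //.
  by split=> [u|u] k v w; rewrite ?linearP ?mulrDr ?mulrDl -?scalerAr -?scalerAl.
split=> //; last first.
  have := antipoder g; rewrite Dg eg scale1r tliftP //.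
  by split=> [u|u] k v w; rewrite ?linearP ?mulrDr ?mulrDl -?scalerAr -?scalerAl.
split; last by rewrite counit_antipode.
rewrite [LHS]tens_vbasis comul_antipode ?Dg ?tliftP //.
- by split=> [u|u] k v w; rewrite linearP; [rewrite tensDl tensZl|rewrite linearP].
- exact: tens_bilinear.
Qed.

(** Left multiplication by a group-like is a coalgebra automorphism. *)
Lemma comatrix_mull d (c : 'I_d -> 'I_d -> H) g : grouplike g -> comatrix c ->
  comatrix (fun i j => g * c i j).
Proof.
move=> gg cc; split; first exact: comatrix_gt0 cc.
- move=> f f' i j; rewrite -translE translM // (comatrixM cc).
  by apply: eq_bigr => k _; rewrite !translE.
- by move=> i j; rewrite counitM (proj2 gg) mul1r (comatrix1 cc).
move=> X; have [f fE] := comatrix_dual cc X; have [_ Sg _] := grouplikeV gg.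
by exists (transl f (antipode g)) => i j; rewrite translE mulrA Sg mul1r.
Qed.

Lemma coradical_mull g x : grouplike g -> x \in coradical H -> g * x \in coradical H.
Proof.
move=> gg; have -> : g * x = amull g x by rewrite lfunE.
rewrite memv_preim; apply: subvP; apply: vsum_sub => D sD.
have [d [c [cc ->]]] := simple_subcoalgebraP sD.
apply: cospan_sub => i j; rewrite -memv_preim lfunE /=.
apply: (subvP (sub_vsum (cospan_simple (comatrix_mull gg cc)))).
exact: (mem_cospan (fun i j => g * c i j)).
Qed.

Lemma jacn_transl g n f : grouplike g -> f \in jacn H n -> transl f g \in jacn H n.
Proof.
move=> gg; elim: n f => [|n IH] f fJ; first exact: memvf.
have L : linear (fun f : A => transl f g).
  by move=> k u v; apply/lfunP => x; rewrite !(add_lfunE, scale_lfunE, translE).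
pose T := GRing.isLinear.Build K A A _ _ L.
pose X : {linear A -> A} := HB.pack (fun f : A => transl f g) T.
have XE u : linfun X u = transl u g by rewrite lfunE.
rewrite -XE memv_preim; apply: subvP fJ; apply/prodvP => u v uJ vJ.
rewrite -memv_preim XE translM // memv_mul ?IH //.
by apply/jacP => x xC; rewrite translE; move/jacP: uJ; apply; apply: coradical_mull.
Qed.

(** Translation by the inverse of g turns the integral of 1 into an integral
    of g. *)
Lemma gint_transl g : grouplike g ->
  exists k : K, transl (gint 1) (antipode g) = k *: gint g.
Proof.
move=> gg; have [gS Sg gS1] := grouplikeV gg.
apply: gint_uniq => z.
have -> : z = transl (transl z g) (antipode g) by rewrite transl_transl gS1 transl_1.
rewrite -translM // gint_left; last exact: grouplike1.
apply/lfunP => x; rewrite translE !scale_lfunE transl_transl gS1 transl_1.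
by rewrite !translE mulr1.
Qed.

(** J is stable under translation by group-likes, so the depth of the
    g-integral in the radical filtration does not depend on g. *)
Lemma gint_jacn g n : grouplike g -> (gint g \in jacn H n) = (gint 1 \in jacn H n).
Proof.
move=> gg; have [gS Sg gS1] := grouplikeV gg; have [k kE] := gint_transl gg.
have back : gint 1 = k *: transl (gint g) g.
  transitivity (transl (transl (gint 1) (antipode g)) g).
    by rewrite transl_transl Sg transl_1.
  rewrite kE.
  by apply/lfunP => x; rewrite translE !scale_lfunE translE.
have k0 : k != 0.
  apply: contraNneq (gint_neq0 grouplike1) => k0.
  by rewrite back k0 scale0r.
apply/idP/idP => [gJ|/(jacn_transl gS)].
  by rewrite back memvZ // jacn_transl.
by rewrite kE => /(memvZ k^-1); rewrite scalerA mulVf // scale1r.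
Qed.

Lemma gint_depth : exists N, forall g, grouplike g ->
  gint g \in jacn H N /\ gint g \notin jacn H N.+1.
Proof.
have [n n0] := jac_nilpotent H.
have ex : exists n, gint 1 \notin jacn H n.
  by exists n; rewrite n0 memv0 gint_neq0 //; apply: grouplike1.
case: (ex_minnP ex) => -[|N] NJ Nmin; first by rewrite memvf in NJ.
exists N => g gg; rewrite !gint_jacn //; split=> //.
by apply/negPn/negP => /Nmin; rewrite ltnn.
Qed.

Section Depth.
Variable N : nat.
Hypothesis NP : forall g, grouplike g ->
  gint g \in jacn H N /\ gint g \notin jacn H N.+1.

(** A nonzero e_g * f would contain the g-integral in the right ideal that it
    generates, and push it into J^(N+1). *)
Lemma idem_depth_lt g f : grouplike g -> f \in jacn H N.+1 -> eg g * f = 0.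
Proof.
move=> gg fJ; apply/eqP/negPn/negP => ef0.
have [y yE] := gint_in gg ef0 (idem_idem _ (grouplike_simple gg)).
have [_ /negP] := NP gg; apply; rewrite -yE; apply: jacnMr; exact: jacnMl.
Qed.

(** By the preceding lemma e_g * f is killed by J on the right, hence lies in
    the socle. *)
Lemma idem_depth g f : grouplike g -> f \in jacn H N ->
  exists k : K, eg g * f = k *: gint g.
Proof.
move=> gg fJ; apply: gint_socle => // [|j jJ].
  exact: idem_idem (grouplike_simple gg).
rewrite -mulrA idem_depth_lt // -addn1; apply: jacnM => //.
by rewrite jacn1.
Qed.
End Depth.
End Frobenius.

(** * Isotypic components *)

Section StandardComodules.
Variables (K : fieldType) (H : hopfType K) (d : nat) (c : 'I_d -> 'I_d -> H).
Hypothesis cc : comatrix c.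
Local Notation A := (conv H K^o).
Local Notation V := ('rV[K]_d : vectType K).
Local Notation e i := (delta_mx 0 i : 'rV[K]_d).

(** The coactions of the simple left and right comodules of a comatrix
    coalgebra, on row vectors. *)
Definition std_lfun (v : 'rV[K]_d) : tensor H V :=
  \sum_k \sum_j v 0 k *: (c k j *t e j).
Definition std_rfun (v : 'rV[K]_d) : tensor V H :=
  \sum_k \sum_j v 0 k *: (e j *t c j k).

Lemma std_lfunS v : std_lfun v = \sum_k \sum_j v 0 k *: (c k j *t e j).
Proof. by []. Qed.
Lemma std_rfunS v : std_rfun v = \sum_k \sum_j v 0 k *: (e j *t c j k).
Proof. by []. Qed.

Fact std_lfun_linear : linear std_lfun.
Proof.
move=> k u v; rewrite /std_lfun scaler_sumr -big_split; apply: eq_bigr => i _.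
rewrite scaler_sumr -big_split; apply: eq_bigr => j _ /=.
by rewrite !mxE scalerDl scalerA.
Qed.
Fact std_rfun_linear : linear std_rfun.
Proof.
move=> k u v; rewrite /std_rfun scaler_sumr -big_split; apply: eq_bigr => i _.
rewrite scaler_sumr -big_split; apply: eq_bigr => j _ /=.
by rewrite !mxE scalerDl scalerA.
Qed.
HB.instance Definition _ := GRing.isLinear.Build K V (tensor H V) _ std_lfun std_lfun_linear.
HB.instance Definition _ := GRing.isLinear.Build K V (tensor V H) _ std_rfun std_rfun_linear.

Lemma std_lfunE i : std_lfun (e i) = \sum_j c i j *t e j.
Proof.
rewrite /std_lfun (bigD1 i) //= [X in _ + X]big1 ?addr0 => [|k /negPf nk].
  by apply: eq_bigr => j _; rewrite mxE !eqxx scale1r.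
by rewrite big1 // => j _; rewrite mxE nk andbF scale0r.
Qed.
Lemma std_rfunE i : std_rfun (e i) = \sum_j e j *t c j i.
Proof.
rewrite /std_rfun (bigD1 i) //= [X in _ + X]big1 ?addr0 => [|k /negPf nk].
  by apply: eq_bigr => j _; rewrite mxE !eqxx scale1r.
by rewrite big1 // => j _; rewrite mxE nk andbF scale0r.
Qed.

Fact std_lcoactA v :
  tlift (fun a w => comul a *t w) (linfun std_lfun v) =
  tlift (fun a w => tlift (fun a' w' => a *t a' *t w') (linfun std_lfun w))
    (linfun std_lfun v).
Proof.
rewrite lfunE /=.
have b1 (a : H) : bilinear_op (fun (a' : H) (w' : V) => a *t a' *t w').
  split=> [u|u] k x w; first by rewrite linearP.
  by rewrite linearP tensDl tensZl.
have b2 : bilinear_op (fun (a : H) (w : V) =>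
   tlift (fun a' w' => a *t a' *t w') (linfun std_lfun w)).
  split=> [u|u] k x w; first by rewrite !linearP.
  rewrite -tlift_comb; apply: eq_tlift => a b.
  by rewrite tensDl tensZl tensDl tensZl.
have b3 : bilinear_op (fun (a : H) (w : V) => comul a *t w).
  by split=> [u|u] k x w; rewrite linearP ?tensDl ?tensZl.
rewrite std_lfunS !linear_sum; apply: eq_bigr => i _.
rewrite !linear_sum /=.
under eq_bigr => j _ do rewrite linearZ /= tliftP //.
under [RHS]eq_bigr => j _ do rewrite linearZ /= tliftP // lfunE /= std_lfunE.
rewrite -!scaler_sumr; congr (_ *: _).
under eq_bigr => j _ do rewrite (comul_comatrix cc) tens_suml.
under [RHS]eq_bigr => j _ do rewrite linear_sum /=.
under [RHS]eq_bigr => j _ do under eq_bigr => k _ do rewrite (tliftP _ _ (b1 _)).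
exact: exchange_big.
Qed.

Fact std_lcoact1 v :
  tlift (fun (a : H) (w : V) => counit a *: w) (linfun std_lfun v) = v.
Proof.
rewrite lfunE /= -/(slicel counit _) std_lfunS [RHS]row_sum_delta linear_sum.
apply: eq_bigr => i _; rewrite linear_sum (bigD1 i) //= big1 => [|j /negPf nj].
  by rewrite addr0 linearZ /= slicelE (comatrix1 cc) eqxx scale1r.
by rewrite linearZ /= slicelE (comatrix1 cc) eq_sym nj scale0r scaler0.
Qed.

Definition std_left : left_comodule H := LeftComodule std_lcoactA std_lcoact1.

Fact std_rcoactA v :
  tlift (fun w a => linfun std_rfun w *t a) (linfun std_rfun v) =
  tlift (fun w a => tlift (fun a1 a2 => w *t a1 *t a2) (comul a)) (linfun std_rfun v).
Proof.
rewrite lfunE /=.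
have b1 (w : V) : bilinear_op (fun (a1 a2 : H) => w *t a1 *t a2).
  split=> [u|u] k x z; first by rewrite linearP.
  by rewrite linearP tensDl tensZl.
have b2 : bilinear_op (fun (w : V) (a : H) =>
   tlift (fun a1 a2 => w *t a1 *t a2) (comul a)).
  split=> [u|u] k x w; first by rewrite !linearP.
  rewrite -tlift_comb; apply: eq_tlift => a b.
  by rewrite tensDl tensZl tensDl tensZl.
have b3 : bilinear_op (fun (w : V) (a : H) => linfun std_rfun w *t a).
  by split=> [u|u] k x w; rewrite linearP ?tensDl ?tensZl.
rewrite std_rfunS !linear_sum; apply: eq_bigr => i _.
rewrite !linear_sum /=.
under eq_bigr => j _ do rewrite linearZ /= tliftP // lfunE /= std_rfunE tens_suml.
under [RHS]eq_bigr => j _ do rewrite linearZ /= tliftP // (comul_comatrix cc) [tlift _ (\sum_(_ < _) _)]linear_sum /=.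
rewrite -!scaler_sumr; congr (_ *: _).
under [RHS]eq_bigr => j _ do under eq_bigr => k _ do rewrite (tliftP _ _ (b1 _)).
exact: exchange_big.
Qed.

Fact std_rcoact1 v :
  tlift (fun (w : V) (a : H) => counit a *: w) (linfun std_rfun v) = v.
Proof.
rewrite lfunE /= -/(slicer counit _) std_rfunS [RHS]row_sum_delta linear_sum.
apply: eq_bigr => i _; rewrite linear_sum (bigD1 i) //= big1 => [|j /negPf nj].
  by rewrite addr0 linearZ /= slicerE (comatrix1 cc) eqxx scale1r.
by rewrite linearZ /= slicerE (comatrix1 cc) nj scale0r scaler0.
Qed.

Definition std_right : right_comodule H := RightComodule std_rcoactA std_rcoact1.

Lemma row_full (W : {vspace V}) : (forall j, e j \in W) -> W = fullv.
Proof.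
move=> eW; apply/eqP; rewrite eqEsubv subvf /=; apply/subvP => v _.
by rewrite [v]row_sum_delta; apply: memv_suml => i _; apply: memvZ.
Qed.

Lemma row_full_neq0 : (fullv : {vspace V}) != 0%VS.
Proof. by rewrite -dimv_eq0 dimvf dim_matrix mul1r -lt0n (comatrix_gt0 cc). Qed.

Lemma std_slicel f v : slicel f (std_lfun v) = \sum_k \sum_j v 0 k *: (f (c k j) *: e j).
Proof.
rewrite linear_sum; apply: eq_bigr => k _; rewrite linear_sum.
by apply: eq_bigr => j _; rewrite linearZ /= slicelE.
Qed.

Lemma std_slicer f v : slicer f (std_rfun v) = \sum_k \sum_j v 0 k *: (f (c j k) *: e j).
Proof.
rewrite linear_sum; apply: eq_bigr => k _; rewrite linear_sum.
by apply: eq_bigr => j _; rewrite linearZ /= slicerE.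
Qed.

Lemma std_left_simple : simple_left_comodule_over (cospan c) std_left.
Proof.
split=> [v||W sW].
- rewrite lfunE /= std_lfunS; apply: memv_suml => i _; apply: memv_suml => j _.
  by rewrite memvZ // memv_tens ?memvf ?mem_cospan.
- exact: row_full_neq0.
have [->|W0] := eqVneq W 0%VS; [by left | right].
have wW := memv_pick W; have := W0; rewrite -vpick0; set w := vpick W in wW *.
move=> w0; have [k wk] : exists k, (w : 'rV[K]_d) 0 k != 0 by apply/rV0Pn.
apply: row_full => j.
have [f fE] := comatrix_dual cc (delta_mx k j).
have /(slicel_mem f) := sW w wW; rewrite lfunE std_slicel.
rewrite (bigD1 k) //= (bigD1 j) //= fE mxE !eqxx scale1r.
rewrite big1 => [|l /negPf nl]; last by rewrite fE mxE nl andbF scale0r scaler0.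
rewrite big1 => [|l /negPf nl].
  by rewrite !addr0 => /(memvZ ((w : 'rV[K]_d) 0 k)^-1); rewrite scalerA mulVf // scale1r.
by rewrite big1 // => i _; rewrite fE mxE nl scale0r scaler0.
Qed.

Lemma std_right_simple : simple_right_comodule_over (cospan c) std_right.
Proof.
split=> [v||W sW].
- rewrite lfunE /= std_rfunS; apply: memv_suml => i _; apply: memv_suml => j _.
  by rewrite memvZ // memv_tens ?memvf ?mem_cospan.
- exact: row_full_neq0.
have [->|W0] := eqVneq W 0%VS; [by left | right].
have wW := memv_pick W; have := W0; rewrite -vpick0; set w := vpick W in wW *.
move=> w0; have [k wk] : exists k, (w : 'rV[K]_d) 0 k != 0 by apply/rV0Pn.
apply: row_full => j.
have [f fE] := comatrix_dual cc (delta_mx j k).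
have /(slicer_mem f) := sW w wW; rewrite lfunE std_slicer.
rewrite (bigD1 k) //= (bigD1 j) //= fE mxE !eqxx scale1r.
rewrite big1 => [|l /negPf nl]; last by rewrite fE mxE nl scale0r scaler0.
rewrite big1 => [|l /negPf nl].
  by rewrite !addr0 => /(memvZ ((w : 'rV[K]_d) 0 k)^-1); rewrite scalerA mulVf // scale1r.
by rewrite big1 // => i _; rewrite fE mxE nl andbF scale0r scaler0.
Qed.
End StandardComodules.

Section Bicomodules.
Variables (K : closedFieldType) (H : hopfType K) (p : 'End(H)).
Hypothesis pP : coalgebra_projection p.
Local Notation A := (conv H K^o).
Implicit Types (f g h : A) (x y : H) (D E M N : {vspace H}).

(** The bicomodule structure of H over C_0 is the restriction of the two
    actions of H^* to the functionals f o p. *)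
Lemma slicel_rhoL f x : slicel f (rhoL p x) = ract x (pull p f).
Proof.
rewrite /slicel /rhoL /tmap tlift_tlift; apply: eq_tlift => a b.
by rewrite tliftP ?pullE //; apply: slicel_bilinear.
Qed.

Lemma slicer_rhoR f x : slicer f (rhoR p x) = lact (pull p f) x.
Proof.
rewrite /slicer /rhoR /tmap tlift_tlift; apply: eq_tlift => a b.
by rewrite tliftP ?pullE //; apply: slicer_bilinear.
Qed.

Lemma subbicomodule_ract M f x : subbicomodule p M -> x \in M ->
  ract x (pull p f) \in M.
Proof. by move=> [sM _] /sM/(slicel_mem f); rewrite slicel_rhoL. Qed.

Lemma subbicomodule_lact M f x : subbicomodule p M -> x \in M ->
  lact (pull p f) x \in M.
Proof. by move=> [_ sM] /sM/(slicer_mem f); rewrite slicer_rhoR. Qed.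

Section MatrixUnits.
Variables (d : nat) (c : 'I_d -> 'I_d -> H).
Hypothesis cc : comatrix c.

(** The functional dual to c i j on the coradical, extended to H along p;
    multiplication by the idempotent makes it vanish on the other simple
    subcoalgebras. *)
Definition munit i j : A := idem pP (cospan c) *
  pull p (projT1 (cid (comatrix_dual cc (delta_mx i j)))).

Lemma pull_munit i j : pull p (munit i j) = munit i j.
Proof. by rewrite (pullM pP) (pull_idem pP) ?(pullK pP) //; exact: cospan_simple. Qed.

Lemma munitE i j k l : munit i j (c k l) = ((k == i) && (l == j))%:R.
Proof.
have sD := cospan_simple cc.
rewrite /munit (idem_lE pP _ sD sD) ?mem_cospan // eqxx.
rewrite (pull_coradical pP) ?(subvP (sub_vsum sD)) ?mem_cospan //.
by case: cid => f /= ->; rewrite mxE.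
Qed.

Lemma cospan_ext (f g : A) : (forall i j, f (c i j) = g (c i j)) ->
  forall x, x \in cospan c -> f x = g x.
Proof.
move=> fg x /cospanP[X ->]; rewrite !linear_sum; apply: eq_bigr => i _.
by rewrite !linear_sum; apply: eq_bigr => j _; rewrite !linearZ /= fg.
Qed.

Lemma munitMl i j h : pull p h = h -> munit i j * h = \sum_l (h (c j l) : K) *: munit i l.
Proof.
move=> hh; have sD := cospan_simple cc; apply: (pull_ext pP) => [||U x sU xU].
- by rewrite (pullM pP) pull_munit hh.
- apply/lfunP => x; rewrite pullE !sum_lfunE; apply: eq_bigr => l _.
  by rewrite !scale_lfunE -pullE pull_munit.
have [UD|UD] := eqVneq U (cospan c); last first.
  rewrite -mulrA (idem_lE pP _ sD sU xU) (negPf UD) sum_lfunE big1 // => l _.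
  by rewrite scale_lfunE (idem_lE pP _ sD sU xU) (negPf UD) scaler0.
rewrite UD in xU; apply: cospan_ext xU => k l.
rewrite (comatrixM cc) sum_lfunE (bigD1 j) //= munitE eqxx andbT.
rewrite big1 => [|r /negPf nr]; last by rewrite munitE nr andbF mul0r.
rewrite addr0 (bigD1 l) //= big1 => [|r /negPf nr].
  rewrite scale_lfunE munitE eqxx andbT addr0.
  by case: (k == i); rewrite ?mul1r ?mul0r /GRing.scale /= ?mulr1 ?mulr0.
by rewrite scale_lfunE munitE [l == r]eq_sym nr andbF scaler0.
Qed.

Lemma munitMr i j h : pull p h = h -> h * munit i j = \sum_k (h (c k i) : K) *: munit k j.
Proof.
move=> hh; have sD := cospan_simple cc; apply: (pull_ext pP) => [||U x sU xU].
- by rewrite (pullM pP) pull_munit hh.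
- apply/lfunP => x; rewrite pullE !sum_lfunE; apply: eq_bigr => l _.
  by rewrite !scale_lfunE -pullE pull_munit.
have [UD|UD] := eqVneq U (cospan c); last first.
  rewrite /munit mulrA -(idem_central pP sD hh) -mulrA (idem_lE pP _ sD sU xU).
  rewrite (negPf UD) sum_lfunE big1 // => l _.
  by rewrite scale_lfunE (idem_lE pP _ sD sU xU) (negPf UD) scaler0.
rewrite UD in xU; apply: cospan_ext xU => k l.
rewrite (comatrixM cc) sum_lfunE (bigD1 i) //= munitE eqxx /=.
rewrite big1 => [|r /negPf nr]; last by rewrite munitE nr mulr0.
rewrite addr0 (bigD1 k) //= big1 => [|r /negPf nr].
  rewrite scale_lfunE munitE eqxx addr0.
  by case: (l == j); rewrite ?mulr1 ?mulr0 /GRing.scale /= ?mulr1 ?mulr0.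
by rewrite scale_lfunE munitE [k == r]eq_sym nr scaler0.
Qed.

Lemma sum_munit : \sum_i munit i i = idem pP (cospan c).
Proof.
have sD := cospan_simple cc; have [_ e1 e0] := idemP pP sD.
apply: (pull_ext pP) => [||U x sU xU].
- apply/lfunP => x; rewrite pullE !sum_lfunE; apply: eq_bigr => l _.
  by rewrite -pullE pull_munit.
- exact: pull_idem.
have [UD|UD] := eqVneq U (cospan c); last first.
  rewrite (e0 U) // sum_lfunE big1 // => l _.
  by rewrite (idem_lE pP _ sD sU xU) (negPf UD).
rewrite UD in xU; apply: cospan_ext xU => k l.
rewrite e1 ?mem_cospan // (comatrix1 cc) sum_lfunE (bigD1 k) //= munitE eqxx /=.
rewrite big1 ?addr0; first by rewrite eq_sym.
by move=> r /negPf nr; rewrite munitE eq_sym nr.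
Qed.
End MatrixUnits.

Section IsotypicComponent.
Variables (M : {vspace H}).
Hypothesis sM : subbicomodule p M.
Variables (d : nat) (c : 'I_d -> 'I_d -> H) (d' : nat) (c' : 'I_d' -> 'I_d' -> H).
Hypotheses (cc : comatrix c) (cc' : comatrix c').
Variables (x : H) (xM : x \in M) (a : 'I_d) (b : 'I_d').

Definition smat k l : H := lact (munit cc' l b) (ract x (munit cc a k)).

Hypothesis ab0 : smat a b != 0.

Lemma smatM k l : smat k l \in M.
Proof.
rewrite /smat -pull_munit -(pull_munit cc); apply: subbicomodule_lact => //.
exact: subbicomodule_ract.
Qed.

Lemma ract_smat h k l : pull p h = h ->
  ract (smat k l) h = \sum_j (h (c k j) : K) *: smat j l.
Proof.
move=> hh; rewrite /smat -lract -ractM munitMl // ract_sum (linear_sum (lact _)).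
by apply: eq_bigr => j _; rewrite ractZ linearZ.
Qed.

Lemma lact_smat h k l : pull p h = h ->
  lact h (smat k l) = \sum_i (h (c' i l) : K) *: smat k i.
Proof.
move=> hh; rewrite /smat -lactM munitMr // lact_sum.
by apply: eq_bigr => i _; rewrite lactZ.
Qed.

Lemma cospan_coradical d0 (c0 : 'I_d0 -> 'I_d0 -> H) : comatrix c0 ->
  forall i j, c0 i j \in coradical H.
Proof.
by move=> cc0 i j; rewrite (subvP (sub_vsum (cospan_simple cc0))) ?mem_cospan.
Qed.

Lemma rhoL_smat k l : rhoL p (smat k l) = \sum_j c k j *t smat j l.
Proof.
apply: tensor_eqP => f g; rewrite -!slice_tlift slicel_rhoL ract_smat ?(pullK pP) //.
rewrite (linear_sum (slicel f)) !(linear_sum g); apply: eq_bigr => j _.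
by rewrite linearZ /= slicelE linearZ pull_coradical // cospan_coradical.
Qed.

Lemma rhoR_smat k l : rhoR p (smat k l) = \sum_i smat k i *t c' i l.
Proof.
apply: tensor_eqP => f g; rewrite -!slicer_tlift slicer_rhoR lact_smat ?(pullK pP) //.
rewrite (linear_sum (slicer g)) !(linear_sum f); apply: eq_bigr => j _.
by rewrite linearZ /= slicerE linearZ pull_coradical // cospan_coradical.
Qed.

Lemma smat_extract (T : 'I_d -> 'I_d' -> K) i j r s :
  lact (munit cc' s j) (ract (\sum_k \sum_l T k l *: smat k l) (munit cc i r)) =
  T i j *: smat r s.
Proof.
have E k l : lact (munit cc' s j) (ract (smat k l) (munit cc i r)) =
    ((k == i) && (l == j))%:R *: smat r s.
  rewrite ract_smat ?pull_munit // (bigD1 r) //= big1 ?addr0 => [|u /negPf nu].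
    rewrite linearZ /= lact_smat ?pull_munit // (bigD1 s) //= big1 ?addr0 => [|u /negPf nu].
      by rewrite !munitE !eqxx andbT scalerA -natrM mulnb.
    by rewrite munitE nu scale0r.
  by rewrite munitE nu andbF scale0r.
transitivity (\sum_k \sum_l T k l *: (((k == i) && (l == j))%:R *: smat r s)).
  rewrite ract_suml lact_sumr; apply: eq_bigr => k _.
  rewrite ract_suml lact_sumr; apply: eq_bigr => l _.
  by rewrite ractZl lactZr E.
rewrite (bigD1 i) //= (bigD1 j) //= !eqxx scale1r.
rewrite big1 ?addr0 => [|l /negPf ->]; last by rewrite andbF scale0r scaler0.
rewrite big1 ?addr0 // => k /negPf nk; rewrite big1 // => l _.
by rewrite nk scale0r scaler0.
Qed.

Local Notation V := ('rV[K]_d : vectType K).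
Local Notation W := ('rV[K]_d' : vectType K).

Definition smat_form (v : 'rV[K]_d) (w : 'rV[K]_d') : H :=
  \sum_k \sum_l (v 0 k * w 0 l) *: smat k l.

Lemma smat_form_bilinear : bilinear_op (smat_form : V -> W -> H).
Proof.
split=> [v|w] k u u'; rewrite /smat_form scaler_sumr -big_split; apply: eq_bigr => i _;
  rewrite scaler_sumr -big_split; apply: eq_bigr => j _ /=; rewrite !mxE scalerA -scalerDl;
  congr (_ *: _).
  by rewrite mulrDr mulrCA.
by rewrite mulrDl mulrA.
Qed.

Definition smat_map : 'Hom(tensor V W, H) := linfun (tlift (smat_form : V -> W -> H)).

Definition tcoef k l : tensor V W -> K^o := tlift (fun (v : V) (w : W) => (v : 'rV[K]_d) 0 k * (w : 'rV[K]_d') 0 l : K^o).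

Lemma smat_mapE t : smat_map t = \sum_k \sum_l (tcoef k l t : K) *: smat k l.
Proof.
rewrite lfunE /= /tlift.
transitivity (\sum_i \sum_j \sum_k \sum_l ((t i j : K) * (((vbasis {:V})`_i : 'rV[K]_d) 0 k * ((vbasis {:W})`_j : 'rV[K]_d') 0 l)) *: smat k l).
  apply: eq_bigr => i _; apply: eq_bigr => j _; rewrite /smat_form scaler_sumr.
  by apply: eq_bigr => k _; rewrite scaler_sumr; apply: eq_bigr => l _; rewrite scalerA.
transitivity (\sum_k \sum_l \sum_i \sum_j ((t i j : K) * (((vbasis {:V})`_i : 'rV[K]_d) 0 k * ((vbasis {:W})`_j : 'rV[K]_d') 0 l)) *: smat k l).
  under eq_bigr => i _ do rewrite exchange_big.
  rewrite exchange_big; apply: eq_bigr => k _ /=.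
  under eq_bigr => i _ do rewrite exchange_big.
  by rewrite exchange_big.
apply: eq_bigr => k _; apply: eq_bigr => l _; rewrite /tcoef /tlift scaler_suml.
by apply: eq_bigr => i _; rewrite scaler_suml; apply: eq_bigr => j _.
Qed.

Lemma smat_map_delta k l : smat_map ((delta_mx 0 k : V) *t (delta_mx 0 l : W)) = smat k l.
Proof.
rewrite lfunE /= tliftP; last exact: smat_form_bilinear.
rewrite /smat_form (bigD1 k) //= [X in _ + X]big1 ?addr0 => [|i /negPf ni]; last first.
  by rewrite big1 // => j _; rewrite !mxE ni mul0r scale0r.
rewrite (bigD1 l) //= [X in _ + X]big1 ?addr0 => [|i /negPf ni]; last first.
  by rewrite !mxE ni mulr0 scale0r.
by rewrite !mxE !eqxx mulr1 scale1r.
Qed.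

Lemma smat_limg k l : smat k l \in limg smat_map.
Proof. by rewrite -smat_map_delta memv_img ?memvf. Qed.

Lemma smat_map_ker : lker smat_map = 0%VS.
Proof.
apply/eqP; rewrite -subv0; apply/subvP => t; rewrite memv_ker => /eqP t0.
have tc k l : tcoef k l t = 0.
  have := smat_extract (fun k l => tcoef k l t) k l a b.
  rewrite -smat_mapE t0 -[ract _ _]/(ract_fun _ 0) !linear0 => /esym/eqP.
  by rewrite scaler_eq0 (negPf ab0) orbF => /eqP.
rewrite memv0; apply/eqP; apply: tensor_eqP => f g; rewrite [RHS]linear0.
have fE (v : V) : f v = \sum_k (v : 'rV[K]_d) 0 k * f (delta_mx 0 k) :> K.
  by rewrite [v in LHS]row_sum_delta linear_sum; apply: eq_bigr => k _; rewrite linearZ.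
have gE (v : W) : g v = \sum_k (v : 'rV[K]_d') 0 k * g (delta_mx 0 k) :> K.
  by rewrite [v in LHS]row_sum_delta linear_sum; apply: eq_bigr => k _; rewrite linearZ.
transitivity (\sum_k \sum_l tcoef k l t * (f (delta_mx 0 k) * g (delta_mx 0 l)) : K).
  rewrite /tcoef /tlift.
  transitivity (\sum_i \sum_j \sum_k \sum_l (t i j : K) * (((vbasis {:V})`_i : 'rV[K]_d) 0 k * ((vbasis {:W})`_j : 'rV[K]_d') 0 l) *
     (f (delta_mx 0 k) * g (delta_mx 0 l)) : K).
    apply: eq_bigr => i _; apply: eq_bigr => j _.
    transitivity ((t i j : K) * (f (vbasis {:V})`_i * g (vbasis {:W})`_j)) => //.
    rewrite fE gE mulr_suml mulr_sumr; apply: eq_bigr => k _.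
    rewrite !mulr_sumr; apply: eq_bigr => l _.
    by rewrite -!mulrA; congr (_ * (_ * _)); rewrite mulrCA.
  transitivity (\sum_k \sum_l \sum_i \sum_j (t i j : K) * (((vbasis {:V})`_i : 'rV[K]_d) 0 k * ((vbasis {:W})`_j : 'rV[K]_d') 0 l) *
     (f (delta_mx 0 k) * g (delta_mx 0 l)) : K).
    under eq_bigr => i _ do rewrite exchange_big.
    rewrite exchange_big; apply: eq_bigr => k _ /=.
    under eq_bigr => i _ do rewrite exchange_big.
    by rewrite exchange_big.
  apply: eq_bigr => k _; apply: eq_bigr => l _; rewrite mulr_suml.
  by apply: eq_bigr => i _; rewrite mulr_suml; apply: eq_bigr => j _.
by rewrite big1 // => k _; rewrite big1 // => l _; rewrite tc mul0r.
Qed.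

Fact rhoL_linear : linear (rhoL p).
Proof. by move=> k u v; rewrite /rhoL /tmap !linearP. Qed.
Fact rhoR_linear : linear (rhoR p).
Proof. by move=> k u v; rewrite /rhoR /tmap !linearP. Qed.
HB.instance Definition _ := GRing.isLinear.Build K H (tensor H H) _ (rhoL p) rhoL_linear.
HB.instance Definition _ := GRing.isLinear.Build K H (tensor H H) _ (rhoR p) rhoR_linear.

Lemma limg_smat_map_sub N : (forall k l, smat k l \in N) -> (limg smat_map <= N)%VS.
Proof.
move=> sN; apply/subvP => _ /memv_imgP[t _ ->]; rewrite smat_mapE.
by apply: memv_suml => k _; apply: memv_suml => l _; apply: memvZ.
Qed.

Lemma smat_simple : simple_subbicomodule p (limg smat_map).
Proof.
split.
- by apply: contraNneq ab0 => S0; rewrite -memv0 -S0; apply: smat_limg.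
- split=> x0 x0S.
    rewrite -[rhoL p x0]lfunE memv_preim; apply: subvP x0S.
    apply: limg_smat_map_sub => k l; rewrite -memv_preim lfunE /= rhoL_smat.
    by apply: memv_suml => j _; rewrite memv_tens ?smat_limg ?cospan_coradical.
  rewrite -[rhoR p x0]lfunE memv_preim; apply: subvP x0S.
  apply: limg_smat_map_sub => k l; rewrite -memv_preim lfunE /= rhoR_smat.
  by apply: memv_suml => j _; rewrite memv_tens ?smat_limg ?cospan_coradical.
move=> N sN NS; have [->|N0] := eqVneq N 0%VS; [by left | right].
apply/eqP; rewrite eqEsubv NS /=; apply: limg_smat_map_sub => r s.
have uN := memv_pick N; have := N0; rewrite -vpick0; set u := vpick N in uN *.
have /memv_imgP[t _ ut] := subvP NS _ uN; rewrite ut smat_mapE => u0.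
have [k [l tkl]] : exists k l, tcoef k l t != 0.
  apply: contrapT => nt; case/eqP: u0; rewrite big1 // => k _; rewrite big1 // => l _.
  have [->|tkl] := eqVneq (tcoef k l t) 0; first by rewrite scale0r.
  by case: nt; exists k, l.
have : lact (munit cc' s l) (ract u (munit cc k r)) \in N.
  rewrite -pull_munit -(pull_munit cc); apply: subbicomodule_lact => //.
  exact: subbicomodule_ract.
rewrite ut smat_mapE (smat_extract (fun k l => tcoef k l t)).
by move/(memvZ (tcoef k l t)^-1); rewrite scalerA mulVf // scale1r.
Qed.

Lemma smat_form_deltal j w : smat_form (delta_mx 0 j) w = \sum_l w 0 l *: smat j l.
Proof.
rewrite /smat_form (bigD1 j) //= [X in _ + X]big1 ?addr0 => [|k /negPf nk].
  by apply: eq_bigr => l _; rewrite mxE !eqxx mul1r.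
by rewrite big1 // => l _; rewrite mxE nk andbF mul0r scale0r.
Qed.

Lemma smat_form_deltar v i : smat_form v (delta_mx 0 i) = \sum_k v 0 k *: smat k i.
Proof.
rewrite /smat_form; apply: eq_bigr => k _.
rewrite (bigD1 i) //= [X in _ + X]big1 ?addr0 => [|l /negPf nl].
  by rewrite mxE !eqxx mulr1.
by rewrite mxE nl andbF mulr0 scale0r.
Qed.

Lemma ract_smat_form f v w :
  ract (smat_form v w) (pull p f) = smat_form (slicel f (std_lfun c v)) w.
Proof.
pose T := GRing.isLinear.Build K V H _ _ (smat_form_bilinear.2 w).
pose h : {linear V -> H} := HB.pack (smat_form^~ w : V -> H) T.
rewrite std_slicel -[RHS]/(h _) (linear_sum h).
rewrite /smat_form ract_suml; apply: eq_bigr => k _.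
rewrite ract_suml (linear_sum h).
transitivity (\sum_l \sum_j (v 0 k * w 0 l) *: ((f (c k j) : K) *: smat j l)).
  apply: eq_bigr => l _; rewrite ractZl.
  rewrite ract_smat ?(pullK pP) // -scaler_sumr; congr (_ *: _).
  by apply: eq_bigr => j _; rewrite pull_coradical // cospan_coradical.
rewrite exchange_big; apply: eq_bigr => j _.
rewrite !(linearZZ h) /= smat_form_deltal !scaler_sumr; apply: eq_bigr => l _.
by rewrite !scalerA; congr (_ *: _); rewrite -mulrA [w 0 l * _]mulrC mulrA.
Qed.

Lemma lact_smat_form f v w :
  lact (pull p f) (smat_form v w) = smat_form v (slicer f (std_rfun c' w)).
Proof.
pose T := GRing.isLinear.Build K W H _ _ (smat_form_bilinear.1 v).
pose h : {linear W -> H} := HB.pack (smat_form v : W -> H) T.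
rewrite std_slicer -[RHS]/(h _) (linear_sum h) /smat_form exchange_big.
rewrite lact_sumr; apply: eq_bigr => l _.
rewrite lact_sumr (linear_sum h).
transitivity (\sum_k \sum_j (v 0 k * w 0 l) *: ((f (c' j l) : K) *: smat k j)).
  apply: eq_bigr => k _; rewrite lactZr.
  rewrite lact_smat ?(pullK pP) // -scaler_sumr; congr (_ *: _).
  by apply: eq_bigr => j _; rewrite pull_coradical // cospan_coradical.
rewrite exchange_big; apply: eq_bigr => j _.
rewrite !(linearZZ h) /= smat_form_deltar !scaler_sumr; apply: eq_bigr => k _.
by rewrite !scalerA; congr (_ *: _); rewrite -mulrA mulrC.
Qed.

Lemma smat_map_tens v w : smat_map ((v : V) *t (w : W)) = smat_form v w.
Proof. by rewrite lfunE /= tliftP //; apply: smat_form_bilinear. Qed.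

Lemma smat_isom : bicomodule_isom p (std_left cc) (std_right cc') (limg smat_map).
Proof.
exists smat_map; split=> [||t|t]; [exact: smat_map_ker | by [] | |].
- apply: tensor_eqP => f g; rewrite -slice_tlift slicel_rhoL.
  have -> : smat_map t = tlift (smat_form : V -> W -> H) t by rewrite lfunE.
  rewrite /outer_lcoact /tmap !tlift_tlift.
  rewrite -[ract _ _]/(ract_fun (pull p f) _) (linear_tlift (ract_fun _)) (linear_tlift g).
  apply: eq_tlift => v w; rewrite !tlift_tlift /= /ract_fun ract_smat_form.
  rewrite -smat_map_tens /slicel /= [linfun (std_lfun c) v]lfunE /= -[_ *t w]/(tens_left w _).
  rewrite (linear_tlift (tens_left w)) (linear_tlift smat_map) (linear_tlift g).
  apply: eq_tlift => a0 v'.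
  rewrite tliftP; last first.
    split=> [u|u] k z z'; first by rewrite !linearP.
    by rewrite tensDl tensZl linearP.
  rewrite tliftP; last exact: lfun_mul_bilinear.
  by rewrite /= /tens_left tensZl !linearZ.
apply: tensor_eqP => f g; rewrite -slicer_tlift slicer_rhoR.
have -> : smat_map t = tlift (smat_form : V -> W -> H) t by rewrite lfunE.
rewrite /outer_rcoact /tmap !tlift_tlift.
rewrite (linear_tlift (lact _)) (linear_tlift f).
apply: eq_tlift => v w; rewrite !tlift_tlift /= lact_smat_form.
rewrite -smat_map_tens /slicer /= [linfun (std_rfun c') w]lfunE /=.
rewrite (linear_tlift (tens v)) (linear_tlift smat_map) (linear_tlift f).
apply: eq_tlift => w' a0.
rewrite tliftP; last first.
  split=> [u|u] k z z'; first by rewrite !linearP.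
  by rewrite linearP tensDl tensZl linearP.
rewrite tliftP; last exact: lfun_mul_bilinear.
by rewrite /= !linearZ; apply: mulrC.
Qed.
End IsotypicComponent.

(** Write e_D and e_E as sums of diagonal matrix units. This decomposes x into
    vectors y = f_bb -> x <- e_aa; when y is nonzero, the vectors f_lb -> y <-
    e_ak form a basis of a simple subbicomodule isomorphic to the outer
    product of the two standard comodules. *)
Lemma mem_isotypic M D E x : subbicomodule p M ->
  simple_subcoalgebra D -> simple_subcoalgebra E -> x \in M ->
  ract x (idem pP D) = x -> lact (idem pP E) x = x ->
  x \in isotypic_component p M D E.
Proof.
move=> sM sD sE xM xD xE.
have [d [c [cc Dc]]] := simple_subcoalgebraP sD.
have [d' [c' [cc' Ec]]] := simple_subcoalgebraP sE.
have -> : x = \sum_b \sum_a lact (munit cc' b b) (ract x (munit cc a a)).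
  (* the sums of diagonal matrix units are e_D and e_E *)
  rewrite -[LHS]xE -[in LHS]xD Dc Ec -(sum_munit cc) -(sum_munit cc').
  rewrite lact_sum; apply: eq_bigr => b _.
  by rewrite ract_sum (linear_sum (lact _)).
apply: memv_suml => b _; apply: memv_suml => a _.
rewrite -[lact _ _]/(smat cc cc' x a b a b).
have [->|ab0] := eqVneq (smat cc cc' x a b a b) 0; first exact: mem0v.
have sS := smat_limg cc cc' x a b a b.
apply: (subvP (sub_vsum _)) sS; split.
- by apply: limg_smat_map_sub => k l; apply: smatM.
- exact: smat_simple.
exists (std_left cc), (std_right cc'); split.
- by rewrite Dc; apply: std_left_simple.
- by rewrite Ec; apply: std_right_simple.
exact: smat_isom.
Qed.

(** A left comodule over the line of g is trivial: its coaction is v |-> g (x)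
    v. *)
Lemma isotypic_grouplike (g h x : H) S : grouplike g -> grouplike h ->
  (exists (V : left_comodule H) (W : right_comodule H),
    [/\ simple_left_comodule_over <[g]>%VS V, simple_right_comodule_over <[h]>%VS W &
        bicomodule_isom p V W S]) -> x \in S ->
  ract x (idem pP <[g]>%VS) = x /\ lact (idem pP <[h]>%VS) x = x.
Proof.
move=> gg gh [V [W [[Vg _ _] [Wh _ _] [F [_ <- FL FR]]]]] /memv_imgP[t _ ->].
have Vf f v : slicel f (lcoact V v) = (f g : K) *: v.
  have L : linear (fun s : tensor H V => slicel f s - (f g : K) *: slicel counit s).
    move=> k s s'; rewrite !linearP /= !scalerDr scalerN !scalerA [k * _]mulrC.
    by rewrite addrACA.
  pose T := GRing.isLinear.Build K _ _ _ _ L.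
  pose X : {linear tensor H V -> V} :=
    HB.pack (fun s : tensor H V => slicel f s - (f g : K) *: slicel counit s) T.
  have : X (lcoact V v) \in 0%VS.
    apply: tensv_ind (Vg v) => _ b /vlineP[k ->] _; rewrite /X /= !slicelE memv0.
    rewrite subr_eq0 [f (_ *: _)]linearZ [counit (_ *: _)]linearZ /= (proj2 gg) scalerA; apply/eqP; congr (_ *: _).
    by rewrite /GRing.scale /= mulr1 mulrC.
  rewrite memv0 /X /= subr_eq0 => /eqP ->; congr (_ *: _).
  exact: lcoact1.
have Wf f w : slicer f (rcoact W w) = (f h : K) *: w.
  have L : linear (fun s : tensor W H => slicer f s - (f h : K) *: slicer counit s).
    move=> k s s'; rewrite !linearP /= !scalerDr scalerN !scalerA [k * _]mulrC.
    by rewrite addrACA.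
  pose T := GRing.isLinear.Build K _ _ _ _ L.
  pose X : {linear tensor W H -> W} :=
    HB.pack (fun s : tensor W H => slicer f s - (f h : K) *: slicer counit s) T.
  have : X (rcoact W w) \in 0%VS.
    apply: tensv_ind (Wh w) => b _ _ /vlineP[k ->]; rewrite /X /= !slicerE memv0.
    rewrite subr_eq0 [f (_ *: _)]linearZ [counit (_ *: _)]linearZ /= (proj2 gh) scalerA; apply/eqP; congr (_ *: _).
    by rewrite /GRing.scale /= mulr1 mulrC.
  rewrite memv0 /X /= subr_eq0 => /eqP ->; congr (_ *: _).
  exact: rcoact1.
have lft f : ract (F t) (pull p f) = (f g : K) *: F t.
  rewrite -slicel_rhoL FL {2}[t]tens_vbasis !(linear_tlift F) -tlift_scale.
  rewrite /tmap /outer_lcoact !tlift_tlift (linear_tlift (slicel f)).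
  apply: eq_tlift => v w; rewrite tlift_tlift (linear_tlift (slicel f)).
  transitivity (F (tens_left w (slicel f (lcoact V v)))).
    rewrite [slicel f (lcoact V v)]/slicel (linear_tlift (tens_left w)) (linear_tlift F).
    apply: eq_tlift => a v'; rewrite tliftP; last first.
      by split=> [u|u] k z z'; rewrite ?linearP ?tensDl ?tensZl.
    by rewrite /= slicelE /tens_left tensZl linearZ.
  by rewrite Vf /tens_left tensZl linearZ.
have rgt f : lact (pull p f) (F t) = (f h : K) *: F t.
  rewrite -slicer_rhoR FR {2}[t]tens_vbasis !(linear_tlift F) -tlift_scale.
  rewrite /tmap /outer_rcoact !tlift_tlift (linear_tlift (slicer f)).
  apply: eq_tlift => v w; rewrite tlift_tlift (linear_tlift (slicer f)).
  transitivity (F (tens v (slicer f (rcoact W w)))).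
    rewrite [slicer f (rcoact W w)]/slicer (linear_tlift (tens v)) (linear_tlift F).
    apply: eq_tlift => w' a; rewrite tliftP; last first.
      by split=> [u|u] k z z'; rewrite ?linearP ?tensDl ?tensZl.
    by rewrite /= slicerE !linearZ.
  by rewrite Wf !linearZ.
have sg := grouplike_simple gg; have sh := grouplike_simple gh.
rewrite -(pull_idem pP sg) -(pull_idem pP sh) lft rgt !idem_at // !eqxx.
by rewrite !scale1r.
Qed.
End Bicomodules.

(** * Blocks and powers of the radical *)

Section Blocks.
Variables (K : closedFieldType) (H : hopfType K) (bs : block_system H).
Local Notation A := (conv H K^o).
Local Notation p := (bs_proj bs).
Local Notation pP := (bs_projP bs).
Local Notation Q n := (bs_Q bs n).
Local Notation C n := (coradical_filtration H n).
Local Notation e D := (idem pP D).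
Local Notation eg g := (idem pP <[g]>%VS).
Implicit Types (f w : A) (x y g h : H) (D E : {vspace H}).

Lemma filtrationS m n : (m <= n)%N -> (C m <= C n)%VS.
Proof.
move=> mn; rewrite !filtrationE; apply/subvP => x /perpP x0; apply/perpP => f fJ.
by apply: x0; apply: subvP fJ; apply: jacnS.
Qed.

Lemma Q_sub n x : x \in Q n.+1 -> x \in C n.+1 /\ p x = 0.
Proof.
move=> xQ; have : x \in coradical_complement p n.+1.
  by rewrite -bs_Q_sum (subvP (addvSr _ _)).
by rewrite memv_cap memv_ker => /andP[-> /eqP ->].
Qed.

(** Q n.+1 is a complement of C_n in C_(n+1), because C_n is the sum of C_0
    and P_n. *)
Lemma Q_cap n x : x \in Q n.+1 -> x \in C n -> x = 0.
Proof.
move=> xQ xC; apply/eqP; rewrite -memv0 -(bs_Q_direct bs n) memv_cap xQ andbT.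
by rewrite memv_cap xC memv_ker; have [_ ->] := Q_sub xQ; rewrite eqxx.
Qed.

Lemma filtration_Q n x : x \in C n.+1 ->
  exists y q, [/\ y \in C n, q \in Q n.+1 & x = y + q].
Proof.
move=> xC; have p0 m : p x \in C m.
  apply: (subvP (@filtrationS 0 m isT)); exact: (proj_coradical pP).
have : x - p x \in coradical_complement p n.+1.
  apply/memv_capP; split; first by apply: memvB => //; apply: p0.
  by rewrite memv_ker linearB /= (proj_id pP (proj_coradical pP x)) subrr.
rewrite -bs_Q_sum => /memv_addP[y yP [q qQ E]].
exists (y + p x), q; split=> //.
  by rewrite memvD //; move: yP; rewrite memv_cap => /andP[].
by rewrite addrAC -E subrK.
Qed.

(** A vector of Q n.+1 lies outside C_n, so some w in J^(n+1) does not vanish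
    on it, and then neither does e_D * w * e_E. *)
Lemma block_jacn n D E x : simple_subcoalgebra D -> simple_subcoalgebra E ->
  x \in Q n.+1 -> x != 0 -> ract x (e D) = x -> lact (e E) x = x ->
  exists2 w, w \in jacn H n.+1 & e D * w * e E \notin jacn H n.+2.
Proof.
move=> sD sE xQ x0 xD xE.
have : x \notin perp (jacn H n.+1).
  by rewrite -filtrationE; apply: contra x0 => /(Q_cap xQ) ->.
have [all0|/existsNP[w /not_implyP[wJ /eqP wx]] _] :=
    pselect (forall w, w \in jacn H n.+1 -> w x = 0).
  by case/negP; apply/perpP.
exists w => //; have [xC _] := Q_sub xQ.
apply/negP => ewe; move: xC; rewrite filtrationE => /perpP/(_ _ ewe).
by rewrite -lactE xE -ractE xD => /eqP; apply/negP.
Qed.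

(** Conversely, e_D * w * e_E is nonzero on some vector of C_(n+1). It
    vanishes on C_n, so the vector can be taken in Q n.+1, and then replaced
    by its component e_E -> x <- e_D. *)
Lemma jacn_block n D E w : simple_subcoalgebra D -> simple_subcoalgebra E ->
  w \in jacn H n.+1 -> e D * w * e E \notin jacn H n.+2 ->
  exists x, [/\ x \in Q n.+1, x != 0, ract x (e D) = x & lact (e E) x = x].
Proof.
move=> sD sE wJ; rewrite -(perpK (jacn H n.+2)) -filtrationE => ewe.
have [all0|/existsNP[x /not_implyP[xC /eqP wx]]] :=
    pselect (forall x, x \in C n.+1 -> (e D * w * e E) x = 0).
  by case/negP: ewe; apply/annihP.
have [y [q [yC qQ xyq]]] := filtration_Q xC.
have eJ : e D * w * e E \in jacn H n.+1 by apply: jacnMr; apply: jacnMl.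
have y0 : (e D * w * e E) y = 0.
  by move: yC; rewrite filtrationE => /perpP/(_ _ eJ).
have sQ := bs_Q_subbicomodule bs n.
exists (lact (e E) (ract q (e D))); split.
- rewrite -(pull_idem pP sD) -(pull_idem pP sE); apply: subbicomodule_lact => //.
  exact: subbicomodule_ract.
- apply: contraNneq wx => q0; rewrite xyq linearD /= y0 add0r.
  by rewrite -lactE -ractE -lract q0 linear0.
- by rewrite -lract -ractM idemM // eqxx.
by rewrite -lactM idemM // eqxx.
Qed.

Lemma simple_dim D : simple_subcoalgebra D ->
  exists2 d, \dim D = (d ^ 2)%N & (\dim D != 1%N -> (1 < d)%N).
Proof.
move=> /simple_subcoalgebraP[d [c [cc ->]]]; exists d; rewrite dim_cospan //.
by case: d c cc => [|[|d]] c cc //; have := comatrix_gt0 cc.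
Qed.

Lemma mem_block n D E d1 d2 x : simple_subcoalgebra D -> simple_subcoalgebra E ->
  \dim D = (d1 ^ 2)%N -> \dim E = (d2 ^ 2)%N ->
  x \in Q n.+1 -> ract x (e D) = x -> lact (e E) x = x ->
  x \in block bs n.+1 d1 d2.
Proof.
move=> sD sE dD dE xQ xD xE.
have xI : x \in isotypic_component p (Q n.+1) D E.
  by apply: (mem_isotypic (bs_Q_subbicomodule bs n) sD sE xQ xD xE).
by apply: (subvP (sub_vsum _)) xI; exists D, E.
Qed.

Lemma jacn_block_neq0 n D E d1 d2 w : simple_subcoalgebra D -> simple_subcoalgebra E ->
  \dim D = (d1 ^ 2)%N -> \dim E = (d2 ^ 2)%N ->
  w \in jacn H n.+1 -> e D * w * e E \notin jacn H n.+2 ->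
  block bs n.+1 d1 d2 != 0%VS.
Proof.
move=> sD sE dD dE wJ /(jacn_block sD sE wJ)[x [xQ x0 xD xE]].
apply: contraNneq x0 => B0; rewrite -memv0 -B0.
exact: mem_block sD sE dD dE xQ xD xE.
Qed.

Lemma block11_sub n (S : {vspace H}) : (forall x g h, grouplike g -> grouplike h -> x \in Q n.+1 ->
    ract x (eg g) = x -> lact (eg h) x = x -> x \in S) ->
  (block bs n.+1 1 1 <= S)%VS.
Proof.
move=> QS; apply: vsum_sub => U [D [E [[sD dD] [sE dE] ->]]].
have [g gg Dg] := simple_dim1 sD dD; have [h gh Eh] := simple_dim1 sE dE.
apply: vsum_sub => T [TQ _ iT]; apply/subvP => x xT; rewrite Dg Eh in iT.
have [xg xh] := isotypic_grouplike pP gg gh iT xT.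
by apply: (QS x g h) => //; apply: (subvP TQ).
Qed.

Lemma block11_neq0 n : block bs n.+1 1 1 != 0%VS -> exists x g h,
  [/\ grouplike g, grouplike h, x \in Q n.+1, x != 0 &
     ract x (eg g) = x /\ lact (eg h) x = x].
Proof.
move=> B0; apply: contrapT => nx; case/negP: B0; rewrite -subv0.
apply: block11_sub => x g h gg gh xQ xg xh; rewrite memv0.
by apply/negPn/negP => x0; apply: nx; exists x, g, h.
Qed.

(** Write f = f o p + f1 and f' = f' o p + f1'. The product f1 * f1' lies in
    J^2, which vanishes on C_1, and x is an eigenvector for the action of the
    other parts; so (f * f')(x) = f(x) f'(h) + f(g) f'(x). *)
Lemma Q1_skew x g h : grouplike g -> grouplike h -> x \in Q 1 ->
  ract x (eg g) = x -> lact (eg h) x = x -> comul x = x *t h + g *t x.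
Proof.
move=> gg gh xQ xg xh; have [xC px] := Q_sub xQ.
suff D (f f' : A) : (f * f') x = f x * f' h + f g * f' x :> K.
  apply: tensor_eqP => f f'; have b := @lfun_mul_bilinear K K^o H H f f'.
  by rewrite linearD /= !(tliftP _ _ b) -D dualM.
have sg := grouplike_simple gg; have sh := grouplike_simple gh.
have fx u : pull p u x = 0 by rewrite pullE px linear0.
have E1 (u v : A) : (pull p u * v) x = u g * v x :> K.
  rewrite -ractE -xg -ractM (idem_grouplike pP _ gg) (pullK pP) subrr mulr0 addr0.
  rewrite (pull_coradical pP) ?(subvP (sub_vsum sg)) ?memv_line //.
  by rewrite ractZ xg linearZ.
have E2 (u v : A) : (u * pull p v) x = u x * v h :> K.
  rewrite -lactE -{1}xh -lactM -(idem_central pP sh (pullK pP v)).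
  rewrite (idem_grouplike pP _ gh) (pullK pP) subrr mulr0 addr0.
  rewrite (pull_coradical pP) ?(subvP (sub_vsum sh)) ?memv_line //.
  by rewrite lactZ xh linearZ; apply: mulrC.
have -> : f * f' = pull p f * f' + (f - pull p f) * pull p f' + (f - pull p f) * (f' - pull p f').
  by rewrite -addrA -mulrDr [pull p f' + _]addrC subrK -mulrDl addrC subrK.
rewrite !add_lfunE E1 E2; have -> : ((f - pull p f) * (f' - pull p f')) x = 0.
  move: xC; rewrite filtrationE => /perpP; apply.
  by apply: (@jacnM _ _ 1 1); rewrite jacn1; apply: (pullB_jac pP).
by rewrite addr0 add_lfunE opp_lfunE fx subr0 addrC.
Qed.

(** The components of Q 1 between two group-likes consist of skew-primitives. *)
Lemma no_skew : no_nontrivial_skew_primitives H ->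
  forall g h w, grouplike g -> grouplike h -> w \in jac H -> eg g * w * eg h \in jacn H 2.
Proof.
move=> nsp g h w gg gh wJ; apply/negPn/negP => ewe.
have [] := jacn_block (n := 0) (grouplike_simple gg) (grouplike_simple gh) _ ewe.
  by rewrite jacn1.
move=> x [xQ x0 xg xh]; case/eqP: x0; apply: (Q_cap xQ).
have : x \in grouplike_span H by apply: (nsp h g) => //; apply: Q1_skew.
apply: subvP; apply: vsum_sub => U [k gk ->]; apply: sub_vsum.
exact: grouplike_simple.
Qed.

(** Insert 1, the sum of the idempotents e_D, in the middle of the products v
    * w that span J^a J^b = J^(a+b). If in each term one of the two factors
    lay one step deeper, so would the sum. *)
Lemma jacn_split a b (u z z' : A) : u \in jacn H (a + b) ->
  z * u * z' \notin jacn H (a + b).+1 ->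
  exists D v w, [/\ simple_subcoalgebra D, v \in jacn H a, w \in jacn H b,
    z * v * e D \notin jacn H a.+1 & e D * w * z' \notin jacn H b.+1].
Proof.
move=> uJ zuz; apply: contrapT => nD; case/negP: zuz.
have L : linear (fun u : A => z * u * z').
  by move=> k v w; rewrite mulrDr mulrDl -scalerAr -scalerAl.
pose T := GRing.isLinear.Build K A A _ _ L.
pose X : {linear A -> A} := HB.pack (fun u : A => z * u * z') T.
have -> : z * u * z' = linfun X u by rewrite lfunE.
rewrite memv_preim; apply: subvP uJ; rewrite -jacnD; apply/prodvP => v w vJ wJ.
suff : z * (v * w) * z' \in jacn H (a + b).+1 by rewrite -memv_preim lfunE.
have -> : z * (v * w) * z' = \sum_(D <- simples H) (z * v * e D) * (e D * w * z').
  have -> : z * (v * w) * z' = z * v * (\sum_(D <- simples H) e D) * w * z'.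
    by rewrite sum_idem mulr1 !mulrA.
  rewrite mulr_sumr !mulr_suml big_seq [RHS]big_seq.
  apply: eq_bigr => D /simplesP sD.
  have eDD : e D * e D = e D by rewrite idemM // eqxx.
  by rewrite -[in LHS]eDD !mulrA.
rewrite big_seq; apply: memv_suml => D /simplesP sD.
have [zv|zv] := boolP (z * v * e D \in jacn H a.+1).
  rewrite -addSn; apply: jacnM => //; apply: jacnMr; exact: jacnMl.
have [wz|wz] := boolP (e D * w * z' \in jacn H b.+1).
  rewrite -addnS; apply: jacnM => //; apply: jacnMr; exact: jacnMl.
by case: nD; exists D, v, w.
Qed.
End Blocks.

(** * The top layer *)

Section Grouplikes.
Variables (K : closedFieldType) (H : hopfType K).
Implicit Types (g h : H) (D : {vspace H}).

Lemma grouplike_line_inj g h : grouplike g -> grouplike h ->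
  (<[g]> = <[h]>)%VS -> g = h.
Proof.
move=> [_ eg] [_ eh] E; have : g \in <[h]>%VS by rewrite -E memv_line.
case/vlineP => k gk; have := congr1 counit gk.
by rewrite linearZ /= eg eh /GRing.scale /= mulr1 gk => <-; rewrite scale1r.
Qed.

Lemma grouplikes_exist : exists2 s : seq H, uniq s & forall g, g \in s <-> grouplike g.
Proof.
pose gen D : H := if pselect (exists2 g, grouplike g & D = <[g]>%VS) is left ex
  then projT1 (cid2 ex) else 0.
have genP g : grouplike g -> gen <[g]>%VS = g.
  move=> gg; rewrite /gen; case: pselect => [ex|[]]; last by exists g.
  by case: cid2 => h gh /= E; apply: grouplike_line_inj.
exists [seq g <- undup [seq gen D | D <- simples H] | `[< grouplike g >]].
  exact/filter_uniq/undup_uniq.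
move=> g; rewrite mem_filter mem_undup; split=> [/andP[/asboolP]//|gg].
apply/andP; split; first exact/asboolP.
by apply/mapP; exists <[g]>%VS; rewrite ?genP //; apply/simplesP/grouplike_simple.
Qed.
End Grouplikes.

(** A family with a dual family, up to nonzero scalars, is free. *)
Lemma free_dual (K : fieldType) (W : vectType K) (T : eqType) (s : seq T)
    (y : T -> W) (phi : T -> 'Hom(W, K^o)) :
  uniq s -> (forall g h, g \in s -> h \in s -> (phi g (y h) == 0) = (g != h)) ->
  free (map y s).
Proof.
elim: s => [|g s IH] /=; first by rewrite nil_free.
move=> /andP[gs us] dual; rewrite free_cons IH ?andbT //; last first.
  by move=> h k hs ks; apply: dual; rewrite inE ?hs ?ks orbT.
have gg := mem_head g s; apply/negP => yg.
have : y g \in lker (phi g).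
  apply: subvP yg; apply/span_subvP => _ /mapP[h hs ->].
  rewrite memv_ker dual ?inE ?hs ?orbT ?eqxx //.
  by apply: contraNneq gs => ->.
by rewrite memv_ker dual // eqxx.
Qed.

Lemma card_eq_seq (T : eqType) (P : T -> Prop) (s : seq T) : uniq s ->
  (forall x, x \in s <-> P x) -> ([set x : T | P x]%classic #= `I_(size s))%card.
Proof.
move=> us sP; apply/card_set_bijP; exists (index^~ s); split.
- by move=> x /= /sP; rewrite index_mem.
- move=> x y; rewrite !inE => /sP xs /sP ys E.
  by rewrite -(nth_index x xs) -[RHS](nth_index x ys) E.
move=> n /= ns; case: s us sP ns => [|x0 s] us sP ns //.
exists (nth x0 (x0 :: s) n); last by rewrite index_uniq.
by apply/sP; rewrite mem_nth.
Qed.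

Section TopLayer.
Variables (K : closedFieldType) (H : hopfType K) (bs : block_system H).
Local Notation A := (conv H K^o).
Local Notation pP := (bs_projP bs).
Local Notation Q n := (bs_Q bs n).
Local Notation eg g := (idem pP <[g]>%VS).
Variable t : H.
Hypothesis tf : forall f : A, lact f t = 0 -> f = 0.
Local Notation gint := (gint tf).
Variable N : nat.
Hypothesis NP : forall g, grouplike g ->
  gint g \in jacn H N /\ gint g \notin jacn H N.+1.

(** On both sides the g-integral is supported by a single group-like. *)
Lemma gint_ends g : grouplike g -> exists2 a, grouplike a &
  (forall y, gint g * y = (y a : K) *: gint g) /\ eg g * gint g * eg a = gint g.
Proof.
move=> gg; have [a ga ch] := gint_char tf gg; exists a => //; split=> //.
by rewrite gint_left // idem_at // eqxx scale1r ch idem_at // eqxx scale1r.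
Qed.

Lemma block11_le_depth n : block bs n.+1 1 1 != 0%VS -> (n.+1 <= N)%N.
Proof.
move=> /block11_neq0[x [g [h [gg gh xQ x0 [xg xh]]]]].
have sg := grouplike_simple gg; have sh := grouplike_simple gh.
have [w wJ ewe] := block_jacn sg sh xQ x0 xg xh.
rewrite leqNgt; apply: contra ewe => Nn.
by rewrite (idem_depth_lt pP NP gg) ?mul0r ?mem0v // (subvP (jacnS _ Nn)).
Qed.

(** The pairing with e_g * J^N, which is the line of gint g, is nondegenerate
    on the vectors x of Q N with x <- e_g = x; so these form a line. *)
Lemma top_vector M g : N = M.+1 -> grouplike g ->
  exists y, [/\ y \in block bs N 1 1, ract y (eg g) = y, gint g y != 0 &
    forall x, x \in Q N -> ract x (eg g) = x -> x \in <[y]>%VS].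
Proof.
move=> NM gg; have [a ga [ch ege]] := gint_ends gg.
have sg := grouplike_simple gg; have sa := grouplike_simple ga.
have [gJ gJ'] := NP gg; rewrite -ege in gJ'; rewrite NM in gJ gJ' *.
have [y [yQ y0 yg ya]] := jacn_block sg sa gJ gJ'.
have van x : x \in Q M.+1 -> ract x (eg g) = x -> gint g x = 0 -> x = 0.
  move=> xQ xg gx; apply: (Q_cap xQ); rewrite filtrationE; apply/perpP => f fJ.
  rewrite -xg ractE; rewrite -NM in fJ.
  have [k ->] := idem_depth pP NP gg fJ.
  by rewrite scale_lfunE gx; apply: mulr0.
have gy : gint g y != 0 by apply: contraNneq y0 => /(van y yQ yg) ->.
exists y; split=> //.
  apply: (mem_block sg sa) yQ yg ya.
    by rewrite dim_vline grouplike_neq0.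
  by rewrite dim_vline grouplike_neq0.
move=> x xQ xg; apply/vlineP; exists (gint g x / gint g y).
apply/eqP; rewrite -subr_eq0; apply/eqP; apply: van.
- by rewrite memvB ?memvZ.
- by rewrite -[ract _ _]/(ract_fun (eg g) _) linearB linearZ /= /ract_fun xg yg.
rewrite linearB linearZ /=; apply/eqP; rewrite subr_eq0; apply/eqP.
by rewrite /GRing.scale /= divfK.
Qed.

(** The lines of the vectors y_g are independent, as gint g vanishes on y_h
    for h other than g: they form a basis of the block indexed by the group-
    likes. *)
Lemma dim_top : (0 < N)%N ->
  ([set g : H | grouplike g]%classic #= `I_(\dim (block bs N 1 1)))%card.
Proof.
case: (posnP N) => [->//|]; have [M NM] : exists M, N = M.+1 \/ N = 0%N.
  by case: (N) => [|M]; [exists 0%N; right | exists M; left].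
move=> N0 _; have {}NM : N = M.+1 by case: NM N0 => // ->.
have [s us sP] := grouplikes_exist H.
pose y g := if pselect (grouplike g) is left gg
  then projT1 (cid (top_vector NM gg)) else 0.
have yP g : grouplike g -> [/\ y g \in block bs N 1 1, ract (y g) (eg g) = y g,
    gint g (y g) != 0 & forall x, x \in Q N -> ract x (eg g) = x -> x \in <[y g]>%VS].
  by move=> gg; rewrite /y; case: pselect => // gg'; case: cid.
have -> : block bs N 1 1 = <<[seq y g | g <- s]>>%VS.
  apply/eqP; rewrite eqEsubv; apply/andP; split; last first.
    apply/span_subvP => _ /mapP[g /sP gg ->].
    by have [] := yP g gg.
  rewrite {1}NM; apply: block11_sub => x g h gg gh xQ xg xh.
  have [_ _ _ /(_ x)] := yP g gg; rewrite {1}NM => /(_ xQ xg).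
  by apply: subvP; rewrite -memvE memv_span // map_f //; apply/sP.
have fr : free [seq y g | g <- s].
  apply: (@free_dual _ _ _ s y gint us) => g h /sP gg /sP gh.
  have [_ yg gy _] := yP g gg; have [_ yh _ _] := yP h gh.
  have [->|ngh] := eqVneq g h.
    by apply/negbTE; have [] := yP h gh.
  rewrite -yh ractE gint_left // idem_at // [h == g]eq_sym (negPf ngh) scale0r.
  by rewrite zero_lfunE eqxx.
by move/eqP: fr => ->; rewrite size_map; apply: card_eq_seq.
Qed.

(** Otherwise there is f in e_g J^(N-1) e_h outside J^N, and gint g = f * (e_h
    * u * e_a) for some u. Up to a scalar part, which contributes nothing, e_h
    * u * e_a lies in e_h J e_a. This is contained in J^2 when there are no
    skew-primitives, and so gint g would lie in J^(N+1). *)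
Lemma below_top n : no_nontrivial_skew_primitives H ->
  block bs n.+1 1 1 != 0%VS -> n.+2 != N.
Proof.
move=> nsp /block11_neq0[x [g [h [gg gh xQ x0 [xg xh]]]]]; apply/eqP => Nn.
have sg := grouplike_simple gg; have sh := grouplike_simple gh.
have [w wJ ewe] := block_jacn sg sh xQ x0 xg xh.
set f := eg g * w * eg h in ewe.
have fJ : f \in jacn H n.+1 by apply: jacnMr; apply: jacnMl.
have f0 : f != 0 by apply: contraNneq ewe => ->; apply: mem0v.
have ef : eg g * f = f by rewrite /f !mulrA idemM // eqxx.
have fe : f * eg h = f by rewrite /f -mulrA idemM // eqxx.
have [u uE] := gint_in tf gg f0 ef.
have [a ga [ch ege]] := gint_ends gg.
have [gJ] := NP gg; rewrite -Nn in gJ *; apply/negP; rewrite negbK.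
have fue : gint g = f * (eg h * u * eg a).
  by rewrite !mulrA fe uE ch idem_at // eqxx scale1r.
have : u - pull (bs_proj bs) u \in jac H by apply: (pullB_jac pP).
set j := u - _ => jJ.
have hj2 : eg h * j * eg a \in jacn H 2 by apply: no_skew.
have euE : eg h * u * eg a = (u h : K) *: (eg h * eg a) + eg h * j * eg a.
  by rewrite (idem_grouplike pP u gh) mulrDl -scalerAl.
have fj : f * (eg h * j * eg a) \in jacn H n.+3.
  by rewrite -(addn2 n.+1); apply: jacnM.
have sa := grouplike_simple ga.
rewrite fue euE mulrDr memvD // -scalerAr.
have [Eha|neq] := eqVneq <[h]>%VS <[a]>%VS; last first.
  by rewrite idemM // (negPf neq) mulr0 scaler0 mem0v.
rewrite -Eha idemM // eqxx fe.
have : (u h : K) *: f \in jacn H n.+2.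
  have -> : (u h : K) *: f = gint g - f * (eg h * j * eg a).
    by rewrite fue euE mulrDr addrK -scalerAr -Eha idemM // eqxx fe.
  by apply: memvB => //; apply: subvP fj; apply: jacnS.
have [->|uh] := eqVneq (u h : K) 0; first by rewrite scale0r !mem0v.
move/(memvZ (u h : K)^-1); rewrite scalerA mulVf // scale1r => fJ2.
by rewrite fJ2 in ewe.
Qed.
End TopLayer.

(** A simple subcoalgebra linked to a group-like in degree one cannot itself
    be spanned by a group-like. *)
Lemma no_skew_dim (K : closedFieldType) (H : hopfType K) (bs : block_system H)
    (D : {vspace H}) (g : H) w (e := idem (bs_projP bs)) :
  no_nontrivial_skew_primitives H -> grouplike g -> simple_subcoalgebra D ->
  w \in jacn H 1 -> e <[g]>%VS * w * e D \notin jacn H 2 \/ e D * w * e <[g]>%VS \notin jacn H 2 ->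
  exists2 d, \dim D = (d ^ 2)%N & (1 < d)%N.
Proof.
rewrite jacn1 => nsp gg sD wJ ewe; have [d dD d1] := simple_dim sD.
exists d => //; apply: d1; apply/negP => /eqP D1.
have [h gh Dh] := simple_dim1 sD D1; rewrite Dh in ewe.
by case: ewe => /negP; apply; apply: no_skew.
Qed.

Theorem proposition2p17 (K : closedFieldType) (H : hopfType K)
    (bs : block_system H) :
  [pchar K] =i pred0 ->
  ~ cosemisimple H ->
  forall m : nat,
    block bs m 1 1 != 0%VS ->
    (forall n, block bs n 1 1 != 0%VS -> (n <= m)%N) ->
  ([set g : H | grouplike g]%classic #= `I_(\dim (block bs m 1 1)))%card /\
  (forall l : nat,
    (1 <= l)%N -> block bs l 1 1 != 0%VS ->
    (forall n, (1 <= n)%N -> block bs n 1 1 != 0%VS -> (l <= n)%N) ->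
    (l < m)%N ->
    no_nontrivial_skew_primitives H ->
    exists d1 d2 d3 d4 l' : nat,
      [/\ [/\ (1 < d1)%N, (1 < d2)%N, (1 < d3)%N & (1 < d4)%N],
          (1 < l)%N, (l < l')%N &
          [/\ block bs l' d1 1 != 0%VS,
              block bs l' 1 d2 != 0%VS,
              block bs l'.-1 d1 d3 != 0%VS &
              block bs l'.-1 d4 d2 != 0%VS]]).
Proof.
move=> _ _ m Bm mmax; have [t t0 tI] := exists_integral H.
have tf (f : conv H K^o) : lact f t = 0 -> f = 0 := integral_faithful t0 tI.
have [N NP] := gint_depth tf.
have mN : (0 < m)%N -> m = N.
  case: m Bm mmax => // m Bm mmax _; apply/eqP; rewrite eqn_leq.
  have le := block11_le_depth NP Bm; rewrite le /=; apply: mmax.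
  have [M NM] : exists M, N = M.+1 by case: (N) le => // M _; exists M.
  have [y [yB _ gy _]] := top_vector bs NP NM (grouplike1 H).
  by apply: contraNneq gy => B0; move: yB; rewrite B0 memv0 => /eqP ->; rewrite linear0.
split.
  (* when m = 0 the block is the span of the group-likes themselves *)
  have [m0|m_gt0] := posnP m; last first.
    by have E := mN m_gt0; rewrite E in m_gt0 *; apply: (dim_top bs NP m_gt0).
  have [s us sP] := grouplikes_exist H.
  have -> : block bs m 1 1 = <<s>>%VS.
    rewrite m0 /=; apply/eqP; rewrite eqEsubv; apply/andP; split.
      apply: vsum_sub => D [sD dD]; have [g gg ->] := simple_dim1 sD dD.
      by rewrite -memvE memv_span //; apply/sP.
    apply/span_subvP => g /sP gg; apply: (subvP (sub_vsum _)) (memv_line g).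
    by split; [exact: grouplike_simple | rewrite dim_vline grouplike_neq0].
  have fr : free s.
    rewrite -[s]map_id; apply: (@free_dual _ _ _ s id
      (fun g => idem (bs_projP bs) <[g]>%VS : 'Hom(H, K^o)) us) => g h /sP gg /sP gh.
    rewrite /= idem_at //; have [_|_] := eqVneq g h; last by rewrite eqxx.
    exact: negbTE (oner_neq0 K).
  by move/eqP: fr => ->; apply: card_eq_seq.
move=> l l_gt0 Bl _ lm nsp; have {}mN : m = N by apply: mN; apply: leq_trans lm.
case: l l_gt0 Bl lm => // l _ Bl lm.
have l1 : (1 < l.+1)%N.
  case: l Bl {lm} => // /block11_neq0[x [g [h [gg gh xQ x0 [xg xh]]]]].
  have sg := grouplike_simple gg; have sh := grouplike_simple gh.
  have [w wJ /negP[]] := block_jacn sg sh xQ x0 xg xh.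
  by apply: no_skew => //; rewrite -jacn1.
have := below_top NP nsp Bl; rewrite mN in lm => lN.
have [M NM] : exists M, N = M.+3.
  by case: (N) (leq_ltn_trans l1 lm) => [|[|[|M]]] // _; exists M.
rewrite {}NM in NP lm lN.
pose e := idem (bs_projP bs); have g1 := grouplike1 H.
have s1 := grouplike_simple g1; have [a ga [_ ege]] := gint_ends bs tf g1.
have sa := grouplike_simple ga.
have [gJ gJ'] := NP 1 g1; rewrite -ege in gJ'.
have dim1 g : grouplike g -> \dim <[g : H]>%VS = (1 ^ 2)%N.
  by move=> gg; rewrite dim_vline grouplike_neq0.
(* the integral gint 1 is cut in J^N = J * J^(N-1) at D, then the right
   part in J^(N-1) = J^(N-2) * J at E *)
have [D [v [w [sD vJ wJ veD Dwa]]]] := jacn_split bs (a := 1) (b := M.+2) gJ gJ'.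
have [d1 dD d1_gt1] := no_skew_dim nsp g1 sD vJ (or_introl veD).
have [E [v3 [w3 [sE v3J w3J DvE Ewa]]]] := jacn_split bs (a := M.+1) (b := 1)
  (etrans (congr1 (fun n => w \in jacn H n) (addn1 M.+1)) wJ)
  (etrans (congr1 (fun n => e D * w * e <[a]>%VS \notin jacn H n.+1) (addn1 M.+1)) Dwa).
have [d3 dE d3_gt1] := no_skew_dim nsp ga sE w3J (or_intror Ewa).
(* symmetrically, gint 1 is cut in J^N = J^(N-1) * J at F, then the left
   part in J^(N-1) = J * J^(N-2) at G *)
have [F [v2 [w2 [sF v2J w2J gvF Fwa]]]] := jacn_split bs (a := M.+2) (b := 1)
  (etrans (congr1 (fun n => gint tf 1 \in jacn H n) (addn1 M.+2)) gJ)
  (etrans (congr1 (fun n => e <[1]>%VS * gint tf 1 * e <[a]>%VS \notin jacn H n.+1)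
    (addn1 M.+2)) gJ').
have [d2 dF d2_gt1] := no_skew_dim nsp ga sF w2J (or_intror Fwa).
have [G [v4 [w4 [sG v4J w4J gvG Gwa]]]] := jacn_split bs (a := 1) (b := M.+1) v2J gvF.
have [d4 dG d4_gt1] := no_skew_dim nsp g1 sG v4J (or_introl gvG).
exists d1, d2, d3, d4, M.+2; split=> //=; first by rewrite ltn_neqAle -eqSS lN.
split.
- exact: jacn_block_neq0 sD sa dD (dim1 _ ga) wJ Dwa.
- exact: jacn_block_neq0 s1 sF (dim1 _ g1) dF v2J gvF.
- exact: jacn_block_neq0 sD sE dD dE v3J DvE.
exact: jacn_block_neq0 sG sF dG dF w4J Gwa.
Qed.
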